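(* Let $H$ be a Hopf algebroid over $B$ and $(\sigma,\triangleright)$ an invertible 2-cocycle of $H$ over a $B$-ring $N$. The vector space $L=N\otimes_BH\diamond_BN$ is a Hopf algebroid over $N$ (the Connes-Moscovici Hopf algebroid $N\#_\sigma H\#_\sigma N$) with $$s(n)=n\otimes1\otimes1,\qquad t(\bar n)=1\otimes1\otimes n,$$ $$\Delta(n\otimes X\otimes m)=(n\otimes X_{(1)}\otimes1)\otimes(1\otimes X_{(2)}\otimes m),\qquad\varepsilon(n\otimes X\otimes m)=n\varepsilon(X)m,$$ $$(n\otimes X\otimes m)(n'\otimes Y\otimes m')=n(X_{(1)}\triangleright n')\sigma(X_{(2)},Y_{(1)})\otimes X_{(3)}Y_{(2)}\otimes\sigma^{-1}(X_{(4)},Y_{(3)})(X_{(5)}\triangleright m')m,$$ for all $X,Y\in H$ and $n,n',m,m'\in N$. Its translation maps are given by $$(n\otimes X\otimes m)_+\otimes(n\otimes X\otimes m)_-=(n\otimes X_{+(1)}\otimes X_{+(2)}\wedge1)\otimes(X_{-(1)}\vee m\otimes X_{-(2)}\otimes1),$$ $$(n\otimes X\otimes m)_{[+]}\otimes(n\otimes X\otimes m)_{[-]}=(X_{[+](1)}\vee1\otimes X_{[+](2)}\otimes m)\otimes(1\otimes X_{[-](1)}\otimes X_{[-](2)}\wedge n).$$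
   Context: Let $k$ be a field, $B$ a unital $k$-algebra, $\overline B$ its opposite algebra, $b\mapsto\bar b$ the canonical anti-isomorphism $B\to\overline B$. $\otimes_B,\otimes_{\overline B}$ are the usual balanced tensor products; $M\diamond_BN=M\otimes N/\langle\bar bm\otimes n-m\otimes bn\rangle$. The Takeuchi product $M\times_BN\subseteq M\diamond_BN$ consists of the $\sum m_i\otimes n_i$ with $\sum m_i\bar a\otimes n_i=\sum m_i\otimes n_ia$ for all $a\in B$. Same notation over other base algebras such as $N$. A left bialgebroid over $B$ is an algebra $H$ with algebra maps $s:B\to H$, $t:\overline B\to H$ with commuting images (one writes $b,\bar b$ for $s(b),t(\bar b)$ in products), a coassociative algebra map $\Delta:H\to H\times_BH$, $X\mapsto X_{(1)}\otimes X_{(2)}$, with $\Delta(b\bar cX)=bX_{(1)}\otimes\bar cX_{(2)}$, and $\varepsilon:H\to B$ with $\varepsilon(b\bar cX)=b\varepsilon(X)c$, $\varepsilon(X_{(1)})X_{(2)}=X=\overline{\varepsilon(X_{(2)})}X_{(1)}$, $\varepsilon(1)=1$, $\varepsilon(X\varepsilon(Y))=\varepsilon(XY)=\varepsilon(X\overline{\varepsilon(Y)})$. It is a Hopf algebroid if $\lambda:H\otimes_{\overline B}H\to H\diamond_BH$, $X\otimes Y\mapsto X_{(1)}\otimes X_{(2)}Y$ and $\mu:H\otimes_BH\to H\diamond_BH$, $X\otimes Y\mapsto X_{(1)}Y\otimes X_{(2)}$ are bijective; its translation maps are $X_+\otimes X_-=\lambda^{-1}(X\otimes1)$ and $X_{[+]}\otimes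 X_{[-]}=\mu^{-1}(1\otimes X)$. 2-cocycle $(\sigma,\triangleright)$ of $H$ over a $B$-ring $N$ (algebra with algebra map $B\to N$): linear maps $\triangleright:H\otimes N\to N$ and $\sigma:H\otimes_{\overline B}H\to N$ with $(b\bar b'X)\triangleright n=b(X\triangleright n)b'$; $X\triangleright1=\varepsilon(X)$; $X\triangleright(mn)=(X_{(1)}\triangleright m)(X_{(2)}\triangleright n)$; $\sigma(b\bar b'X,Y)=b\sigma(X,Y)b'$; $\sigma(X,1)=\sigma(1,X)=\varepsilon(X)$; $(X_{(1)}\triangleright b)\sigma(X_{(2)},Y)=\sigma(X,bY)$; $(X_{(1)}\triangleright\sigma(Y_{(1)},Z_{(1)}))\sigma(X_{(2)},Y_{(2)}Z_{(2)})=\sigma(X_{(1)},Y_{(1)})\sigma(X_{(2)}Y_{(2)},Z)$; $\sigma(X_{(1)},Y_{(1)})(X_{(2)}Y_{(2)}\triangleright n)=(X_{(1)}\triangleright(Y_{(1)}\triangleright n))\sigma(X_{(2)},Y_{(2)})$; $1\triangleright n=n$. It is invertible if there is $\sigma^{-1}:H\otimes_BH\to N$ with $\sigma^{-1}(b\bar b'X,Y)=b\sigma^{-1}(X,Y)b'$; $\sigma^{-1}(X_{(1)},Y)(X_{(2)}\triangleright b)=\sigma^{-1}(X,\bar bY)$; $\sigma(X_{(1)},Y_{(1)})\sigma^{-1}(X_{(2)},Y_{(2)})=X\triangleright(Y\triangleright1)$; $\sigma^{-1}(X_{(1)},Y_{(1)})\sigma(X_{(2)},Y_{(2)})=(XY)\triangleright1$.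 The crossed product $N\#_\sigma H$ is $N\otimes_BH$ with product $(n\otimes X)(m\otimes Y)=n(X_{(1)}\triangleright m)\sigma(X_{(2)},Y_{(1)})\otimes X_{(3)}Y_{(2)}$, containing $N$ via $n\mapsto n\otimes1$, with right $H$-coaction $n\otimes X\mapsto n\otimes X_{(1)}\otimes X_{(2)}$; $N$ is its subalgebra of coinvariants. Define $\tilde\rho,\rho:H\to N\#_\sigma H$ by $\tilde\rho(X)=1\otimes X$ and $\rho(X)=\sigma^{-1}(X_{(1)[+]},X_{(1)[-]})\otimes X_{(2)}$, and set, for $X\in H$, $n\in N$, $X\wedge n=\tilde\rho(X_+)\,n\,\tilde\rho(X_-)\in N$ and $X\vee n=\rho(X_+)\,n\,\rho(X_-)\in N$. *)

(* Defs.v *)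
From HB Require Import structures.
From mathcomp Require Import all_boot all_algebra.
From mathcomp Require Import boolp classical_sets.

Set Implicit Arguments.
Unset Strict Implicit.
Unset Printing Implicit Defensive.

Import GRing.Theory.
Local Open Scope ring_scope.
Local Open Scope quotient_scope.

Reserved Notation "x ⊗ y" (at level 45, left associativity).
Reserved Notation "'\sw_' ( x , y <- u ) e"
  (at level 49, x name, y name, u at level 200, e at level 49,
   format "'\sw_' ( x ,  y  <-  u )  e").

(* Unital associative k-algebra structures on a vector space V. MathComp's
   algType cannot be used: it requires 1 != 0, and so excludes the zero
   algebra. *)
Record algebra_on (k : fieldType) (V : lmodType k) := AlgebraOn {
  amul : V -> V -> V;
  aone : V;
  amulA : associative amul;
  amul1l : left_id aone amul;
  amul1r : right_id aone amul;
  amulDl : left_distributive amul +%R;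
  amulDr : right_distributive amul +%R;
  ascaleAl : forall (c : k) u v, c *: amul u v = amul (c *: u) v;
  ascaleAr : forall (c : k) u v, c *: amul u v = amul u (c *: v)
}.

Record algebra (k : fieldType) := Algebra {
  alg_space : lmodType k;
  alg_str : algebra_on alg_space
}.

Definition alg_sort (k : fieldType) (A : algebra k) : Type := alg_space A.
Coercion alg_sort : algebra >-> Sortclass.

Section AlgebraInstances.
Variables (k : fieldType) (A : algebra k).

HB.instance Definition _ := GRing.Lmodule.on (alg_sort A).
HB.instance Definition _ := GRing.Zmodule_isPzRing.Build (alg_sort A)
  (amulA (alg_str A)) (amul1l (alg_str A)) (amul1r (alg_str A))
  (amulDl (alg_str A)) (amulDr (alg_str A)).

Lemma alg_scalerAl (c : k) (u v : A) : c *: (u * v) = (c *: u) * v.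
Proof. exact: (ascaleAl (alg_str A)). Qed.

Lemma alg_scalerAr (c : k) (u v : A) : c *: (u * v) = u * (c *: v).
Proof. exact: (ascaleAr (alg_str A)). Qed.

End AlgebraInstances.

(* The quotient of M ⊗_k N by the subspace spanned by the elements
   r a m ⊗ n - m ⊗ l a n, for a : A, where r and l are the actions of A. Its
   elements are represented by finite formal sums of pairs. *)
Section Tensor.
Variables (k : fieldType) (M N : lmodType k) (A : Type).
Variables (r : A -> M -> M) (l : A -> N -> N).

Inductive teq : seq (M * N) -> seq (M * N) -> Prop :=
| teq_refl s : teq s s
| teq_sym s t : teq s t -> teq t s
| teq_trans s t u : teq s t -> teq t u -> teq s u
| teq_cat s s' t t' : teq s s' -> teq t t' -> teq (s ++ t) (s' ++ t')
| teq_catC s t : teq (s ++ t) (t ++ s)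
| teq_0l n : teq [:: (0, n)] [::]
| teq_Dl m m' n : teq [:: (m + m', n)] [:: (m, n); (m', n)]
| teq_Dr m n n' : teq [:: (m, n + n')] [:: (m, n); (m, n')]
| teq_Z (c : k) m n : teq [:: (c *: m, n)] [:: (m, c *: n)]
| teq_bal (c : k) a m n : teq [:: (c *: r a m, n)] [:: (c *: m, l a n)].

Definition teqb : rel (seq (M * N)) := fun s t => `[< teq s t >].

Lemma teqb_equiv : equiv_class_of teqb.
Proof.
split=> [s|s t|t s u].
- exact/asboolP/teq_refl.
- by apply/asboolP/asboolP; apply: teq_sym.
- by move=> /asboolP st /asboolP tu; apply/asboolP/(teq_trans st tu).
Qed.

Canonical teqb_equiv_rel := EquivRelPack teqb_equiv.

Definition tens := {eq_quot teqb}.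
HB.instance Definition _ := Choice.on tens.
HB.instance Definition _ := EqQuotient.on tens.

Definition pure (m : M) (n : N) : tens := \pi_tens [:: (m, n)].

Definition tadd (u v : tens) : tens := \pi_tens (repr u ++ repr v).
Definition tscale (c : k) (u : tens) : tens :=
  \pi_tens [seq (c *: p.1, p.2) | p <- repr u].

Lemma tens_ind (P : tens -> Prop) :
  (forall s, P (\pi_tens s)) -> forall u, P u.
Proof. by move=> Ps u; rewrite -[u]reprK; apply: Ps. Qed.

Lemma tens_piE s t : teq s t -> \pi_tens s = \pi_tens t :> tens.
Proof. by move=> st; apply/eqP; rewrite piE; apply/asboolP. Qed.

Lemma teq_repr s : teq (repr (\pi_tens s)) s.
Proof.
apply/asboolP; change (is_true (teqb (repr (\pi_tens s)) s)).
by have := @pi_eq_quot _ teqb tens (repr (\pi_tens s)) s; rewrite reprK eqxx => <-.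
Qed.

Lemma tadd_pi s t : tadd (\pi_tens s) (\pi_tens t) = \pi_tens (s ++ t).
Proof. by apply: tens_piE; apply: teq_cat; apply: teq_repr. Qed.

Lemma teq_scale c s t : teq s t ->
  teq [seq (c *: p.1, p.2) | p <- s] [seq (c *: p.1, p.2) | p <- t].
Proof.
elim=> {s t} /=.
- by move=> s; apply: teq_refl.
- by move=> s t _; apply: teq_sym.
- by move=> s t u _ st _; apply: teq_trans.
- by move=> s s' t t' _ ? _ ?; rewrite !map_cat; apply: teq_cat.
- by move=> s t; rewrite !map_cat; apply: teq_catC.
- by move=> n; rewrite scaler0; apply: teq_0l.
- by move=> m m' n; rewrite scalerDr; apply: teq_Dl.
- by move=> m n n'; apply: teq_Dr.
- by move=> d m n; rewrite scalerA mulrC -scalerA; apply: teq_Z.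
- by move=> d a m n; rewrite !scalerA; apply: teq_bal.
Qed.

Lemma tscale_pi c s :
  tscale c (\pi_tens s) = \pi_tens [seq (c *: p.1, p.2) | p <- s].
Proof. by apply/tens_piE/teq_scale/teq_repr. Qed.

Lemma taddA : associative tadd.
Proof.
move=> u v w; elim/tens_ind: u => s; elim/tens_ind: v => t.
by elim/tens_ind: w => u; rewrite !tadd_pi catA.
Qed.

Lemma taddC : commutative tadd.
Proof.
move=> u v; elim/tens_ind: u => s; elim/tens_ind: v => t; rewrite !tadd_pi.
exact/tens_piE/teq_catC.
Qed.

Lemma tadd0 : left_id (\pi_tens [::]) tadd.
Proof. by move=> u; elim/tens_ind: u => s; rewrite tadd_pi. Qed.

Lemma teq_scaleD (c d : k) s :
  teq [seq ((c + d) *: p.1, p.2) | p <- s]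
      ([seq (c *: p.1, p.2) | p <- s] ++ [seq (d *: p.1, p.2) | p <- s]).
Proof.
elim: s => [|[m n] s IHs] /=; first exact: teq_refl.
set u := [seq _ | _ <- s] in IHs *; set v := map _ s in IHs *.
set w := map _ s in IHs *.
apply: (@teq_trans _ ([:: (c *: m, n); (d *: m, n)] ++ (v ++ w))).
  rewrite -cat1s scalerDl; apply: teq_cat => //; exact: teq_Dl.
rewrite (_ : _ :: v ++ _ = [:: (c *: m, n)] ++ ((v ++ [:: (d *: m, n)]) ++ w));
  last by rewrite /= -catA.
rewrite (_ : _ ++ _ = [:: (c *: m, n)] ++ (([:: (d *: m, n)] ++ v) ++ w)) //.
apply: teq_cat; first exact: teq_refl.
by apply: teq_cat; [exact: teq_catC | exact: teq_refl].
Qed.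

Lemma teq_scale0 s : teq [seq (0 *: p.1, p.2) | p <- s] [::].
Proof.
elim: s => [|[m n] s IHs] /=; first exact: teq_refl.
rewrite -cat1s -[X in teq _ X](cats0 [::]); apply: teq_cat => //.
by rewrite scale0r; apply: teq_0l.
Qed.

Lemma taddN : left_inverse (\pi_tens [::]) (tscale (-1)) tadd.
Proof.
move=> u; elim/tens_ind: u => s; rewrite tscale_pi tadd_pi; apply: tens_piE.
have -> : s = [seq (1 *: p.1, p.2) | p <- s] :> seq (M * N).
  by rewrite -[LHS]map_id; apply: eq_map => -[m n] /=; rewrite scale1r.
rewrite -map_comp (eq_map (g := fun p : M * N => (-1 *: p.1, p.2)));
  last by move=> [m n] /=; rewrite scale1r.
apply: teq_trans (teq_scale0 s); apply: teq_sym.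
by rewrite -[0](addNr (1 : k)); apply: teq_scaleD.
Qed.

HB.instance Definition _ := GRing.isZmodule.Build tens taddA taddC tadd0 taddN.

Lemma tscaleA c d (u : tens) : tscale c (tscale d u) = tscale (c * d) u.
Proof.
elim/tens_ind: u => s; rewrite !tscale_pi -map_comp; congr (\pi_tens _).
by apply: eq_map => p /=; rewrite scalerA.
Qed.

Lemma tscale1 : left_id 1 tscale.
Proof.
move=> u; elim/tens_ind: u => s; rewrite tscale_pi; congr (\pi_tens _).
by rewrite -[RHS]map_id; apply: eq_map => -[m n] /=; rewrite scale1r.
Qed.

Lemma tscaleDr : right_distributive tscale +%R.
Proof.
move=> c u v; elim/tens_ind: u => s; elim/tens_ind: v => t.
rewrite [X in tscale c X]tadd_pi !tscale_pi [RHS]tadd_pi.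
by rewrite map_cat.
Qed.

Lemma tscaleDl (u : tens) : {morph tscale^~ u : c d / c + d}.
Proof.
move=> c d; elim/tens_ind: u => s; rewrite !tscale_pi [RHS]tadd_pi.
exact/tens_piE/teq_scaleD.
Qed.

HB.instance Definition _ :=
  GRing.Zmodule_isLmodule.Build k tens tscaleA tscale1 tscaleDr tscaleDl.

(* tlift u f is the sum of the f m n over a representative of u. It does not
   depend on the representative when f is bilinear and balanced, see
   tlift_pure and tlift_linear; it is then the image of u under the linear map
   induced by f. Sweedler sums are written in this way: X_(1), X_(2) are bound
   by \sw_(X1, X2 <- Delta X), and iterated coproducts by nesting. When several
   coproducts occur in a sum, it is the full sum, and not each of its terms,
   that is balanced in each of them, because Delta X lies in the Takeuchi
   product. *)
Definition tlift (V : nmodType) (u : tens) (f : M -> N -> V) : V :=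
  \sum_(p <- repr u) f p.1 p.2.

Definition balanced (V : lmodType k) (f : M -> N -> V) : Prop :=
  [/\ forall n, linear (f^~ n), forall m, linear (f m)
    & forall a m n, f (r a m) n = f m (l a n)].

Lemma teq_sum (V : lmodType k) (f : M -> N -> V) s t : balanced f ->
  teq s t -> \sum_(p <- s) f p.1 p.2 = \sum_(p <- t) f p.1 p.2.
Proof.
case=> fl fr fb.
have fZl c m n : f (c *: m) n = c *: f m n.
  have f0 : f 0 n = 0.
    have := fl n 1 0 0; rewrite !scale1r addr0 => /esym/eqP.
    by rewrite -subr_eq0 addrK => /eqP.
  by have := fl n c m 0; rewrite addr0 f0 addr0.
have fZr c m n : f m (c *: n) = c *: f m n.
  have f0 : f m 0 = 0.
    have := fr m 1 0 0; rewrite !scale1r addr0 => /esym/eqP.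
    by rewrite -subr_eq0 addrK => /eqP.
  by have := fr m c n 0; rewrite addr0 f0 addr0.
elim=> {s t} //=.
- by move=> s t u _ -> _ ->.
- by move=> s s' t t' _ es _ et; rewrite !big_cat /= es et.
- by move=> s t; rewrite !big_cat /= addrC.
- by move=> n; rewrite big_cons !big_nil addr0 -(scale0r 0) fZl scale0r.
- move=> m m' n; rewrite !big_cons !big_nil !addr0 /=.
  by have := fl n 1 m m'; rewrite !scale1r.
- move=> m n n'; rewrite !big_cons !big_nil !addr0 /=.
  by have := fr m 1 n n'; rewrite !scale1r.
- by move=> c m n; rewrite !big_cons !big_nil !addr0 /= fZl fZr.
- by move=> c a m n; rewrite !big_cons !big_nil !addr0 /= !fZl fb.
Qed.

Lemma tlift_pi (V : lmodType k) (f : M -> N -> V) s : balanced f ->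
  tlift (\pi_tens s) f = \sum_(p <- s) f p.1 p.2.
Proof. by move=> fb; apply: teq_sum => //; apply: teq_repr. Qed.

Lemma tlift_pure (V : lmodType k) (f : M -> N -> V) m n : balanced f ->
  tlift (pure m n) f = f m n.
Proof. by move=> fb; rewrite tlift_pi // big_seq1. Qed.

Lemma tlift_linear (V : lmodType k) (f : M -> N -> V) : balanced f ->
  linear (fun u => tlift u f).
Proof.
move=> fb c u v; elim/tens_ind: u => s; elim/tens_ind: v => t.
rewrite [c *: _]tscale_pi [_ + _]tadd_pi !tlift_pi // big_cat big_map /=.
congr (_ + _); rewrite scaler_sumr; apply: eq_bigr => p _.
have [fl _ _] := fb; have f0 : f 0 p.2 = 0.
  have := fl p.2 1 0 0; rewrite !scale1r addr0 => /esym/eqP.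
  by rewrite -subr_eq0 addrK => /eqP.
by have := fl p.2 c p.1 0; rewrite addr0 f0 addr0.
Qed.

Lemma pure_balanced : balanced pure.
Proof.
split=> [n c m m'|m c n n'|a m n].
- have -> : c *: pure m n = \pi_tens [:: (c *: m, n)] by exact: tscale_pi.
  by rewrite [RHS]tadd_pi; apply/tens_piE/teq_Dl.
- have -> : c *: pure m n = \pi_tens [:: (c *: m, n)] by exact: tscale_pi.
  rewrite [RHS]tadd_pi; apply: tens_piE; apply: teq_trans (teq_Dr _ _ _) _.
  apply: (@teq_cat [:: _] [:: _] [:: _] [:: _]); last exact: teq_refl.
  exact/teq_sym/teq_Z.
- by apply: tens_piE; have := teq_bal 1 a m n; rewrite !scale1r.
Qed.

Lemma tensE (u : tens) : u = \sum_(p <- repr u) pure p.1 p.2.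
Proof.
rewrite -[LHS]reprK; elim: (repr u) => [|[m n] s IHs]; first by rewrite big_nil.
by rewrite big_cons -IHs [RHS]tadd_pi.
Qed.

End Tensor.

Arguments pure {k M N A} r l & m n.
Notation "x ⊗ y" := (pure _ _ x y) : ring_scope.
Notation "'\sw_' ( x , y <- u ) e" := (tlift u (fun x y => e)) : ring_scope.

(* H with algebra maps s : B -> H and t : B^op -> H with commuting images. *)
Record base_ring (k : fieldType) (B H : algebra k) := BaseRing {
  src : {linear B -> H};
  tgt : {linear B -> H};
  src_morph : monoid_morphism src;
  tgt_morph : monoid_morphism (tgt : B^c -> H);
  src_tgt_comm : forall b c : B, src b * tgt c = tgt c * src b
}.

Section BaseRing.
Variables (k : fieldType) (B H : algebra k) (e : base_ring B H).

(* H ◇_B H *)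
Definition HdH : lmodType k :=
  tens (fun (b : B) (X : H) => tgt e b * X) (fun (b : B) (Y : H) => src e b * Y).

(* H ◇_B H ◇_B H = (H ◇_B H) ◇_B H *)
Definition HdHdH : lmodType k :=
  tens (fun (b : B) (u : HdH) => \sw_(X, Y <- u) (X ⊗ (tgt e b * Y) : HdH))
       (fun (b : B) (Z : H) => src e b * Z).

(* H ⊗_B H *)
Definition HoH : lmodType k :=
  tens (fun (b : B) (X : H) => X * src e b) (fun (b : B) (Y : H) => src e b * Y).

(* H ⊗_{B^op} H *)
Definition HobH : lmodType k :=
  tens (fun (b : B) (X : H) => X * tgt e b) (fun (b : B) (Y : H) => tgt e b * Y).

Definition takeuchi (u : HdH) : Prop := forall a : B,
  \sw_(X, Y <- u) (X * tgt e a ⊗ Y : HdH) =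
  \sw_(X, Y <- u) (X ⊗ Y * src e a : HdH).

(* The product of the algebra H ×_B H; it is independent of the choice of
   representatives if u is in H ×_B H. *)
Definition takeuchi_mul (u v : HdH) : HdH :=
  \sw_(X, Y <- u) \sw_(X', Y' <- v) (X * X' ⊗ Y * Y' : HdH).

End BaseRing.

Record left_bialgebroid (k : fieldType) (B H : algebra k) := LeftBialgebroid {
  lb_base :> base_ring B H;
  Delta : {linear H -> HdH lb_base};
  counit : {linear H -> B};
  Delta_takeuchi : forall X, takeuchi (Delta X);
  Delta1 : Delta 1 = 1 ⊗ 1;
  DeltaM : forall X Y, Delta (X * Y) = takeuchi_mul (Delta X) (Delta Y);
  Delta_coassoc : forall X,
    \sw_(X1, X2 <- Delta X) (Delta X1 ⊗ X2 : HdHdH lb_base) =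
    \sw_(X1, X' <- Delta X) \sw_(X2, X3 <- Delta X')
      ((X1 ⊗ X2 : HdH lb_base) ⊗ X3 : HdHdH lb_base);
  Delta_base : forall b c X, Delta (src lb_base b * tgt lb_base c * X) =
    \sw_(X1, X2 <- Delta X)
      (src lb_base b * X1 ⊗ tgt lb_base c * X2 : HdH lb_base);
  counit_base : forall b c X,
    counit (src lb_base b * tgt lb_base c * X) = b * counit X * c;
  counitl : forall X,
    \sw_(X1, X2 <- Delta X) (src lb_base (counit X1) * X2) = X;
  counitr : forall X,
    \sw_(X1, X2 <- Delta X) (tgt lb_base (counit X2) * X1) = X;
  counit1 : counit 1 = 1;
  counit_src : forall X Y, counit (X * src lb_base (counit Y)) = counit (X * Y);
  counit_tgt : forall X Y, counit (X * tgt lb_base (counit Y)) = counit (X * Y)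
}.

Section Galois.
Variables (k : fieldType) (B H : algebra k) (h : left_bialgebroid B H).

Definition lam (u : HobH h) : HdH h :=
  \sw_(X, Y <- u) \sw_(X1, X2 <- Delta h X) (X1 ⊗ X2 * Y : HdH h).

Definition mu (u : HoH h) : HdH h :=
  \sw_(X, Y <- u) \sw_(X1, X2 <- Delta h X) (X1 * Y ⊗ X2 : HdH h).

(* X_+ ⊗ X_- and X_[+] ⊗ X_[-]: the inverse images of X ⊗ 1 under lam, and of
   1 ⊗ X under mu. *)
Definition transl (X : H) : HobH h := xget 0 [set u | lam u = X ⊗ 1]%classic.
Definition translb (X : H) : HoH h := xget 0 [set u | mu u = 1 ⊗ X]%classic.

End Galois.

Record hopf_algebroid (k : fieldType) (B H : algebra k) := HopfAlgebroid {
  ha_bialgebroid :> left_bialgebroid B H;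
  lam_bij : bijective (@lam k B H ha_bialgebroid);
  mu_bij : bijective (@mu k B H ha_bialgebroid)
}.

(* An algebra N with an algebra map B -> N. *)
Record B_ring (k : fieldType) (B N : algebra k) := BRing {
  br_map :> {linear B -> N};
  br_morph : monoid_morphism br_map
}.

(* act X n is X ▷ n. *)
Record cocycle (k : fieldType) (B H N : algebra k)
    (h : left_bialgebroid B H) (i : B_ring B N) := Cocycle {
  act : {bilinear H -> N -> N};
  sigma : {linear HobH h -> N};
  act_base : forall b b' X n,
    act (src h b * tgt h b' * X) n = i b * act X n * i b';
  act_unit : forall X, act X 1 = i (counit h X);
  actM : forall X m n,
    act X (m * n) = \sw_(X1, X2 <- Delta h X) (act X1 m * act X2 n);
  sigma_base : forall b b' X Y,
    sigma (src h b * tgt h b' * X ⊗ Y) = i b * sigma (X ⊗ Y) * i b';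
  sigmaX1 : forall X, sigma (X ⊗ 1) = i (counit h X);
  sigma1X : forall X, sigma (1 ⊗ X) = i (counit h X);
  sigma_src : forall b X Y,
    \sw_(X1, X2 <- Delta h X) (act X1 (i b) * sigma (X2 ⊗ Y)) =
    sigma (X ⊗ src h b * Y);
  sigma_cocycle : forall X Y Z,
    \sw_(X1, X2 <- Delta h X) \sw_(Y1, Y2 <- Delta h Y)
    \sw_(Z1, Z2 <- Delta h Z)
      (act X1 (sigma (Y1 ⊗ Z1)) * sigma (X2 ⊗ Y2 * Z2)) =
    \sw_(X1, X2 <- Delta h X) \sw_(Y1, Y2 <- Delta h Y)
      (sigma (X1 ⊗ Y1) * sigma (X2 * Y2 ⊗ Z));
  sigma_act : forall X Y n,
    \sw_(X1, X2 <- Delta h X) \sw_(Y1, Y2 <- Delta h Y)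
      (sigma (X1 ⊗ Y1) * act (X2 * Y2) n) =
    \sw_(X1, X2 <- Delta h X) \sw_(Y1, Y2 <- Delta h Y)
      (act X1 (act Y1 n) * sigma (X2 ⊗ Y2));
  act1 : forall n, act 1 n = n
}.

Record cocycle_inverse (k : fieldType) (B H N : algebra k)
    (h : left_bialgebroid B H) (i : B_ring B N) (c : cocycle h i) :=
  CocycleInverse {
  sigmaV : {linear HoH h -> N};
  sigmaV_base : forall b b' X Y,
    sigmaV (src h b * tgt h b' * X ⊗ Y) = i b * sigmaV (X ⊗ Y) * i b';
  sigmaV_tgt : forall b X Y,
    \sw_(X1, X2 <- Delta h X) (sigmaV (X1 ⊗ Y) * act c X2 (i b)) =
    sigmaV (X ⊗ tgt h b * Y);
  sigmaK : forall X Y,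
    \sw_(X1, X2 <- Delta h X) \sw_(Y1, Y2 <- Delta h Y)
      (sigma c (X1 ⊗ Y1) * sigmaV (X2 ⊗ Y2)) = act c X (act c Y 1);
  sigmaVK : forall X Y,
    \sw_(X1, X2 <- Delta h X) \sw_(Y1, Y2 <- Delta h Y)
      (sigmaV (X1 ⊗ Y1) * sigma c (X2 ⊗ Y2)) = act c (X * Y) 1
}.

Section CrossedProduct.
Variables (k : fieldType) (B H N : algebra k).
Variables (h : left_bialgebroid B H) (i : B_ring B N).

(* N ⊗_B H, the underlying space of N #_σ H *)
Definition NoH : lmodType k :=
  tens (fun (b : B) (n : N) => n * i b) (fun (b : B) (X : H) => src h b * X).

(* N ⊗_B H ◇_B N *)
Definition NoHdN : lmodType k :=
  tens (fun (b : B) (u : NoH) => \sw_(n, X <- u) (n ⊗ tgt h b * X : NoH))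
       (fun (b : B) (m : N) => i b * m).

Definition tens3 (n : N) (X : H) (m : N) : NoHdN := (n ⊗ X : NoH) ⊗ m.

Variables (c : cocycle h i) (ci : cocycle_inverse c).

Definition cross_mul (u v : NoH) : NoH :=
  \sw_(n, X <- u) \sw_(m, Y <- v)
  \sw_(X1, X' <- Delta h X) \sw_(X2, X3 <- Delta h X')
  \sw_(Y1, Y2 <- Delta h Y)
    (n * act c X1 m * sigma c (X2 ⊗ Y1) ⊗ X3 * Y2 : NoH).

Definition rhot (X : H) : NoH := 1 ⊗ X.

Definition rho (X : H) : NoH :=
  \sw_(X1, X2 <- Delta h X) ((\sw_(Xp, Xm <- translb h X1) sigmaV ci (Xp ⊗ Xm)) ⊗ X2).

(* X ∧ n and X ∨ n: the products lie in the subalgebra N of N #_σ H, and are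
   read back along n' |-> n' ⊗ 1, which is injective since n' ⊗ X |->
   n' ε(X) is a left inverse. *)
Definition wedge (X : H) (n : N) : N :=
  xget 0 [set n' | (n' ⊗ 1 : NoH) =
    \sw_(Xp, Xm <- transl h X) cross_mul (cross_mul (rhot Xp) (n ⊗ 1)) (rhot Xm)
  ]%classic.

Definition vee (X : H) (n : N) : N :=
  xget 0 [set n' | (n' ⊗ 1 : NoH) =
    \sw_(Xp, Xm <- transl h X) cross_mul (cross_mul (rho Xp) (n ⊗ 1)) (rho Xm)
  ]%classic.

End CrossedProduct.

(* Main.v *)
(* Equalities in balanced tensor products are tested on all balanced maps. The
   co-opposite Hopf algebroid, over the opposite of N, exchanges X_+ ⊗ X_- with
   X_[+] ⊗ X_[-], σ with σ^-1 and ∧ with ∨, so that each identity has a dual.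

   A twisted module is an N-bimodule with operators X ▶ u, compatible with ▷, such
   that X ▶ (Y ▶ u) = σ(X_1, Y_1) (X_2 Y_2 ▶ u) σ^-1(X_3, Y_3). The bimodule
   L = N ⊗ H ◇ N, with X ▶ (1 ⊗ Y ⊗ 1) = σ(X_1, Y_1) ⊗ X_2 Y_2 ⊗ σ^-1(X_3, Y_3),
   is the free twisted module on one generator: an element w of a twisted module
   gives the map n ⊗ X ⊗ m |-> n (X ▶ w) m. For w in L this map is the product
   (n ⊗ X ⊗ m) w, its associativity is the twisted module law of L, and the
   counit is the case of w = 1 in N.

   Put X ∧ u = (X_1 ▶ u) (X_2 ∧ 1) and X ∨ u = (X_1 ∨ 1) (X_2 ▶ u). From
   X_+ ∧ (X_- ▶ u) = (X ∧ 1) u and X_+ ∧ (X_- ∨ u) = (X ▷ 1) u, and their duals,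
   one reads off the inverses of the two Galois maps of L. These identities are
   proved for u in N, and follow for u in L over the square zero extension of N
   by L. *)
Require Import Defs.
From HB Require Import structures.
From mathcomp Require Import all_boot all_algebra.
From mathcomp Require Import boolp classical_sets.

Set Implicit Arguments.
Unset Strict Implicit.
Unset Printing Implicit Defensive.

Import GRing.Theory.
Local Open Scope ring_scope.

Reserved Notation "'\S_' ( x , y <- u ) e"
  (at level 49, x name, y name, u at level 200, e at level 49,
   format "'\S_' ( x ,  y  <-  u )  e").

(** A single term of a Sweedler sum is not well defined, only the full sum is, so every regrouping
    of coproducts owes a balancing condition over the base. Two devices keep these under control. In
    [hopf_calculus] the base is a bare index set, so that the co-opposite lives in the same type.
    And maps of two variables carry a class recording how they are balanced, which turns convolution
    into composition in a category with two objects, whose identities X ▷ (Y ▷ 1) and (X Y) ▷ 1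
    differ. Duality is not free either: an invertible cocycle comes with laws for σ, and before σ^-1
    can be the cocycle of the dual situation, its normalisation, its intertwining law and its own
    cocycle identity have to be derived from the two products of σ and σ^-1. The inverses of the
    Galois maps of L are written down on generators, with ∧ and ∨ given by closed formulas in σ,
    σ^-1 and the translation maps of H. That these formulas agree with products in N #_σ H is shown
    separately, and enters only in the final translation formulas. *)

Section Linear.
Variable k : fieldType.

(** A bare predicate: linearity is asked of explicit Sweedler expressions in one chosen variable,
    where it can be established from the shape of the expression. *)
Definition lin (V W : lmodType k) (f : V -> W) :=
  forall (c : k) u v, f (c *: u + v) = c *: f u + f v.

Definition bilin (U V W : lmodType k) (f : U -> V -> W) :=
  (forall y, lin (fun x => f x y)) /\ (forall x, lin (f x)).

Definition trilin (U V W X : lmodType k) (f : U -> V -> W -> X) :=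
  [/\ forall y z, lin (fun x => f x y z), forall x z, lin (fun y => f x y z)
    & forall x y, lin (f x y)].

Lemma lin0 (V W : lmodType k) (f : V -> W) : lin f -> f 0 = 0.
Proof.
move=> fl; have := fl 1 0 0; rewrite !scale1r addr0 => /esym/eqP.
by rewrite -subr_eq0 addrK => /eqP.
Qed.

Lemma linD (V W : lmodType k) (f : V -> W) :
  lin f -> forall u v, f (u + v) = f u + f v.
Proof. by move=> fl u v; have := fl 1 u v; rewrite !scale1r. Qed.

Lemma linZ (V W : lmodType k) (f : V -> W) :
  lin f -> forall c u, f (c *: u) = c *: f u.
Proof. by move=> fl c u; have := fl c u 0; rewrite !addr0 lin0 // addr0. Qed.

Lemma lin_sum (V W : lmodType k) (f : V -> W) I (r : seq I) (F : I -> V) :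
  lin f -> f (\sum_(i <- r) F i) = \sum_(i <- r) f (F i).
Proof. by move=> fl; apply: big_morph; [exact: linD | exact: lin0]. Qed.

Lemma lin_id (V : lmodType k) : lin (fun x : V => x).
Proof. by []. Qed.

Lemma lin_ap (U V W : lmodType k) (f : V -> W) (E : U -> V) :
  lin f -> lin E -> lin (fun x => f (E x)).
Proof. by move=> fl El c u v; rewrite El fl. Qed.

Lemma lin_mull (V : lmodType k) (A : algebra k) (E : V -> A) (y : A) :
  lin E -> lin (fun x => E x * y).
Proof. by move=> El c u v; rewrite El mulrDl -alg_scalerAl. Qed.

Lemma lin_mulr (V : lmodType k) (A : algebra k) (E : V -> A) (y : A) :
  lin E -> lin (fun x => y * E x).
Proof. by move=> El c u v; rewrite El mulrDr -alg_scalerAr. Qed.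

End Linear.

(** * Finite Sweedler sums as operators on maps of two variables *)

Section SumOperators.
Variables (k : fieldType) (M : Type).

(* A finite formal sum of pairs, seen as the operator which sends f to the sum
   of the values of f. Exchanging the members of the pairs and the coproduct of
   the co-opposite bialgebroid are then definitional. *)
Record sumop := Sumop {
  so : forall V : lmodType k, (M -> M -> V) -> V;
  so_repr : exists u : seq (M * M),
    forall (V : lmodType k) (f : M -> M -> V), so f = \sum_(p <- u) f p.1 p.2
}.

End SumOperators.

Notation "'\S_' ( x , y <- u ) e" := (so u (fun x y => e)) : ring_scope.

Section SumOperatorTheory.
Variables (k : fieldType) (M : Type).
Implicit Types (V W : lmodType k) (a : sumop k M).

Fact flip_repr a : exists u : seq (M * M),
  forall V (f : M -> M -> V), \S_(x, y <- a) f y x = \sum_(p <- u) f p.1 p.2.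
Proof.
have [u au] := so_repr a; exists [seq (p.2, p.1) | p <- u] => V f.
by rewrite au big_map.
Qed.

Definition flip a : sumop k M := Sumop (flip_repr a).

Lemma so_ext V a (f g : M -> M -> V) :
  (forall x y, f x y = g x y) -> so a f = so a g.
Proof. by have [u au] := so_repr a; move=> fg; rewrite !au; apply: eq_bigr. Qed.

Lemma so_lin V W (phi : V -> W) a (f : M -> M -> V) : lin phi ->
  phi (\S_(x, y <- a) f x y) = \S_(x, y <- a) phi (f x y).
Proof. by have [u au] := so_repr a; move=> pl; rewrite !au lin_sum. Qed.

Lemma lin_so V W a (F : W -> M -> M -> V) :
  (forall x y, lin (fun z => F z x y)) -> lin (fun z => \S_(x, y <- a) F z x y).
Proof.
have [u au] := so_repr a; move=> Fl c z z'; rewrite !au scaler_sumr -big_split.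
by apply: eq_bigr => p _; apply: Fl.
Qed.

Lemma so_mulrl (A : algebra k) a (f : M -> M -> A) n :
  (so a f) * n = \S_(x, y <- a) (f x y * n).
Proof. by apply: (so_lin (phi := fun z : A => z * n)); apply/lin_mull/lin_id. Qed.

Lemma so_mulrr (A : algebra k) a (f : M -> M -> A) n :
  n * (so a f) = \S_(x, y <- a) (n * f x y).
Proof. by apply: (so_lin (phi := fun z : A => n * z)); apply/lin_mulr/lin_id. Qed.

End SumOperatorTheory.

Lemma so_swap (k : fieldType) (M M' : Type) (V : lmodType k)
    (a : sumop k M) (b : sumop k M') (f : M -> M -> M' -> M' -> V) :
  \S_(x, y <- a) \S_(z, w <- b) f x y z w =
  \S_(z, w <- b) \S_(x, y <- a) f x y z w.
Proof.
have [u au] := so_repr a; have [v bv] := so_repr b; rewrite au bv.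
under eq_bigr => p _ do rewrite bv.
by under [RHS]eq_bigr => p _ do rewrite au; rewrite exchange_big.
Qed.

(** * Sweedler calculus in a Hopf algebroid *)

Section HopfCalculus.
Variables (k : fieldType) (H : algebra k) (B : Type).

(* The balancing conditions over the images of s and t for maps on H ◇ H and on
   H ⊗ H over the opposite base. *)
Definition dbalanced (s t : B -> H) (V : lmodType k) (f : H -> H -> V) :=
  bilin f /\ forall b x y, f (t b * x) y = f x (s b * y).

Definition obalanced (t : B -> H) (V : lmodType k) (f : H -> H -> V) :=
  bilin f /\ forall b x y, f (x * t b) y = f x (t b * y).

(* A Hopf algebroid, with equalities in balanced tensor products replaced by
   equalities of the values of all balanced maps. cop, tr and trb are
   X_(1) ⊗ X_(2), X_+ ⊗ X_- and X_[+] ⊗ X_[-]. *)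
Record hopf_calculus := HopfCalculus {
  hs : B -> H;
  ht : B -> H;
  hep : H -> B;
  cop : H -> sumop k H;
  tr : H -> sumop k H;
  trb : H -> sumop k H;
  hst : forall b c, hs b * ht c = ht c * hs b;
  lin_hep_s : lin (fun X => hs (hep X));
  lin_hep_t : lin (fun X => ht (hep X));
  cop_lin : forall (V : lmodType k) (f : H -> H -> V), dbalanced hs ht f ->
    lin (fun X => so (cop X) f);
  cop_1 : forall (V : lmodType k) (f : H -> H -> V), dbalanced hs ht f ->
    so (cop 1) f = f 1 1;
  cop_s : forall (V : lmodType k) (f : H -> H -> V) b X, dbalanced hs ht f ->
    so (cop (hs b * X)) f = \S_(x, y <- cop X) f (hs b * x) y;
  cop_t : forall (V : lmodType k) (f : H -> H -> V) b X, dbalanced hs ht f ->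
    so (cop (ht b * X)) f = \S_(x, y <- cop X) f x (ht b * y);
  cop_mul : forall (V : lmodType k) (f : H -> H -> V) X Y, dbalanced hs ht f ->
    so (cop (X * Y)) f =
    \S_(y, y' <- cop Y) \S_(x, x' <- cop X) f (x * y) (x' * y');
  cop_tak : forall (V : lmodType k) (f : H -> H -> V) b X, dbalanced hs ht f ->
    \S_(x, y <- cop X) f (x * ht b) y = \S_(x, y <- cop X) f x (y * hs b);
  copA : forall (V : lmodType k) (f : H -> H -> H -> V) X, trilin f ->
    (forall b x y z, f (ht b * x) y z = f x (hs b * y) z) ->
    (forall b x y z, f x (ht b * y) z = f x y (hs b * z)) ->
    \S_(x, x' <- cop X) \S_(y, z <- cop x) f y z x' =
    \S_(x, x' <- cop X) \S_(y, z <- cop x') f x y z;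
  cop_counitl : forall X, \S_(x, y <- cop X) (hs (hep x) * y) = X;
  cop_counitr : forall X, \S_(x, y <- cop X) (ht (hep y) * x) = X;
  tr_lin : forall (V : lmodType k) (f : H -> H -> V), obalanced ht f ->
    lin (fun X => so (tr X) f);
  tr_t : forall (V : lmodType k) (f : H -> H -> V) b X, obalanced ht f ->
    so (tr (ht b * X)) f = \S_(x, y <- tr X) f x (y * hs b);
  trK : forall (V : lmodType k) (f : H -> H -> V) X, dbalanced hs ht f ->
    \S_(x, y <- tr X) \S_(x1, x2 <- cop x) f x1 (x2 * y) = f X 1;
  copK : forall (V : lmodType k) (f : H -> H -> V) X, obalanced ht f ->
    \S_(x, y <- cop X) \S_(x1, x2 <- tr x) f x1 (x2 * y) = f X 1;
  trb_lin : forall (V : lmodType k) (f : H -> H -> V), obalanced hs f ->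
    lin (fun X => so (trb X) f);
  trb_s : forall (V : lmodType k) (f : H -> H -> V) b X, obalanced hs f ->
    so (trb (hs b * X)) f = \S_(x, y <- trb X) f x (y * ht b);
  trbK : forall (V : lmodType k) (f : H -> H -> V) X, dbalanced ht hs f ->
    \S_(x, y <- trb X) \S_(x1, x2 <- cop x) f x2 (x1 * y) = f X 1;
  copbK : forall (V : lmodType k) (f : H -> H -> V) X, obalanced hs f ->
    \S_(x, y <- cop X) \S_(y1, y2 <- trb y) f y1 (y2 * x) = f X 1
}.

Lemma dia_flip s t (V : lmodType k) (f : H -> H -> V) :
  dbalanced t s f -> dbalanced s t (fun x y => f y x).
Proof. by case=> -[fl fr] fb; split=> [|b x y]; [split | rewrite fb]. Qed.

(* The co-opposite Hopf algebroid: applied to coopp S, a statement about tr is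
   one about trb. *)
Definition coopp (S : hopf_calculus) : hopf_calculus.
Proof.
refine (@HopfCalculus (ht S) (hs S) (hep S)
  (fun X => flip (cop S X)) (trb S) (tr S) _ _ _ _ _ _ _ _ _ _ _ _ _ _ _ _ _ _ _ _).
- by move=> b c; rewrite hst.
- exact: lin_hep_t.
- exact: lin_hep_s.
- by move=> V f /dia_flip; apply: cop_lin.
- by move=> V f /dia_flip fd; rewrite /= cop_1.
- by move=> V f b X /dia_flip fd; rewrite /= cop_t.
- by move=> V f b X /dia_flip fd; rewrite /= cop_s.
- by move=> V f X Y /dia_flip fd; rewrite /= cop_mul.
- move=> V f b X /dia_flip fd; exact/esym/(cop_tak b X fd).
- move=> V f X [f1 f2 f3] fb fb' /=; apply/esym.
  exact: (copA (f := fun x y z => f z y x) X).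
- exact: cop_counitr.
- exact: cop_counitl.
- exact: trb_lin.
- exact: trb_s.
- exact: trbK.
- exact: copbK.
- exact: tr_lin.
- exact: tr_t.
- exact: trK.
- exact: copK.
Defined.

End HopfCalculus.

Ltac lin_op := fail.

Ltac lin_eta :=
  cbv beta;
  lazymatch goal with
  | |- lin (fun x => _) => idtac
  | |- lin ?f => change (lin (fun x => f x))
  end.

Ltac lin1 :=
  lin_eta;
  match goal with
  | |- lin (fun x => x) => exact: lin_id
  | HH : lin ?f |- lin (fun x => ?f (@?E x)) => refine (lin_ap HH _)
  | HH : bilin ?f |- lin (fun x => ?f (@?E x) ?a) => refine (lin_ap (HH.1 a) _)
  | HH : bilin ?f |- lin (fun x => ?f ?a (@?E x)) => refine (lin_ap (HH.2 a) _)
  | HH : trilin ?f |- lin (fun x => ?f (@?E x) ?a ?b) =>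
      let h := fresh in case: (HH) => h _ _; refine (lin_ap (h a b) _); clear h
  | HH : trilin ?f |- lin (fun x => ?f ?a (@?E x) ?b) =>
      let h := fresh in case: (HH) => _ h _; refine (lin_ap (h a b) _); clear h
  | HH : trilin ?f |- lin (fun x => ?f ?a ?b (@?E x)) =>
      let h := fresh in case: (HH) => _ _ h; refine (lin_ap (h a b) _); clear h
  | |- lin (fun x => so ?a (@?F x)) => apply: lin_so => ? ?
  | |- lin (fun x => so (cop ?S (@?E x)) ?f) => refine (lin_ap (cop_lin (f := f) _) _)
  | |- lin (fun x => so (tr ?S (@?E x)) ?f) => refine (lin_ap (tr_lin (f := f) _) _)
  | |- lin (fun x => so (trb ?S (@?E x)) ?f) => refine (lin_ap (trb_lin (f := f) _) _)
  | |- lin (fun x => (@?E x) * ?y) => apply: lin_mull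
  | |- lin (fun x => ?y * (@?E x)) => apply: lin_mulr
  | _ => lin_op
  end.

(** Linearity is settled by the shape of the expression, so [bal] normally leaves a single goal, the
    equation that moves an element of the base across. *)
Ltac bal1 :=
  match goal with
  | |- lin _ => lin1
  | |- bilin _ => split => ?
  | |- trilin _ => split => ? ?
  | HH : forall _, dbalanced _ _ _ |- dbalanced _ _ _ => exact (HH _)
  | HH : forall _ _, dbalanced _ _ _ |- dbalanced _ _ _ => exact (HH _ _)
  | HH : dbalanced _ _ _ |- dbalanced _ _ _ => exact HH
  | HH : forall _, obalanced _ _ |- obalanced _ _ => exact (HH _)
  | HH : forall _ _, obalanced _ _ |- obalanced _ _ => exact (HH _ _)
  | HH : obalanced _ _ |- obalanced _ _ => exact HH
  | |- dbalanced _ _ _ => split; [|move=> ? ? ?; cbv beta]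
  | |- obalanced _ _ => split; [|move=> ? ? ?; cbv beta]
  end.

Ltac bal := repeat bal1.

Section HopfIdentities.
Variables (k : fieldType) (H : algebra k) (B : Type) (S : hopf_calculus H B).
Variable W : lmodType k.
Local Notation s := (hs S).
Local Notation t := (ht S).
Local Notation D := (cop S).
Local Notation P := (tr S).
Implicit Types (b : B) (X Y : H).

Lemma dia_mul (f : H -> H -> W) y y' : dbalanced s t f ->
  dbalanced s t (fun x x' => f (x * y) (x' * y')).
Proof. by case=> fl fb; bal; rewrite -!mulrA fb. Qed.

Lemma dia_mulr (f : H -> H -> W) y : dbalanced s t f ->
  dbalanced s t (fun x x' => f x (x' * y)).
Proof. by case=> fl fb; bal; rewrite fb mulrA. Qed.

(** The terms of the inner sum are not balanced in Y one by one: t(b) behind X_(1) becomes s(b)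
    behind X_(2) only in the full sum, by the Takeuchi condition on the coproduct of X. *)
Lemma dia_cop_mul (f : H -> H -> W) X : dbalanced s t f ->
  dbalanced s t (fun y y' => \S_(x, x' <- D X) f (x * y) (x' * y')).
Proof.
move=> fd; have [fl fb] := fd; bal.
under so_ext => ? ? do rewrite mulrA.
rewrite (cop_tak (f := fun x x' => f (x * _) (x' * _))); last exact: dia_mul.
by under so_ext => ? ? do rewrite -mulrA.
Qed.

Lemma dia_s (f : H -> H -> W) b : dbalanced s t f ->
  dbalanced s t (fun x y => f (s b * x) y).
Proof. by case=> fl fb; bal; rewrite mulrA hst -mulrA fb. Qed.

Lemma dia_t (f : H -> H -> W) b : dbalanced s t f ->
  dbalanced s t (fun x y => f x (t b * y)).
Proof. by case=> fl fb; bal; rewrite mulrA -hst -mulrA fb. Qed.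

Lemma cop_sr (f : H -> H -> W) b X : dbalanced s t f ->
  so (D (X * s b)) f = \S_(x, y <- D X) f (x * s b) y.
Proof.
move=> fd; rewrite cop_mul // -[s b]mulr1 cop_s; last exact: dia_cop_mul.
rewrite cop_1; last exact: (dia_s b (dia_cop_mul X fd)).
by apply: so_ext => x y; rewrite mulr1 mulr1.
Qed.

Lemma cop_tr (f : H -> H -> W) b X : dbalanced s t f ->
  so (D (X * t b)) f = \S_(x, y <- D X) f x (y * t b).
Proof.
move=> fd; rewrite cop_mul // -[t b]mulr1 cop_t; last exact: dia_cop_mul.
rewrite cop_1; last exact: (dia_t b (dia_cop_mul X fd)).
by apply: so_ext => x y; rewrite mulr1 mulr1.
Qed.

(* The value of f at the preimage of X ⊗ Y under the Galois map. *)
Definition galV (f : H -> H -> W) X Y := \S_(x, y <- P X) f x (y * Y).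

Lemma obal_mul (f : H -> H -> W) Y : obalanced t f -> obalanced t (fun x y => f x (y * Y)).
Proof. by case=> fl fb; bal; rewrite fb mulrA. Qed.

Lemma dia_galV (f : H -> H -> W) : obalanced t f -> dbalanced s t (galV f).
Proof.
move=> fo; have [fl fb] := fo; rewrite /galV; bal; first by rewrite fb mulrA.
rewrite (tr_t _ _ (obal_mul _ fo)).
by apply: so_ext => x y; rewrite mulrA.
Qed.

Lemma galV1 (f : H -> H -> W) X : galV f X 1 = so (P X) f.
Proof. by apply: so_ext => x y; rewrite mulr1. Qed.

(** The form in which [copK] is used from here on: a balanced [f] factors through the Galois map, so
    rules for the coproduct can be pulled back to the translation map. *)
Lemma gal_cop (f : H -> H -> W) X Y : obalanced t f ->
  \S_(x, y <- D X) galV f x (y * Y) = f X Y.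
Proof.
move=> fo; rewrite -[RHS](congr1 (f X) (mul1r Y)) -(copK X (obal_mul Y fo)).
by apply: so_ext => x y; apply: so_ext => x' y'; rewrite mulrA.
Qed.

(** The pattern for the rules of X_+ ⊗ X_-: express [f] by [galV f] and the Galois map, apply the
    corresponding rule of the coproduct to X_+, and cancel with [trK]. *)
Lemma tr_s (f : H -> H -> W) b X : obalanced t f ->
  so (P (s b * X)) f = \S_(x, y <- P X) f (s b * x) y.
Proof.
move=> fo; have gd := dia_galV fo; rewrite -galV1.
rewrite -(trK X (dia_s b gd)).
apply: so_ext => x y; rewrite -gal_cop //.
by rewrite (cop_s b x (dia_mulr y gd)).
Qed.

Lemma tr_tr (f : H -> H -> W) b X : obalanced t f ->
  so (P (X * t b)) f = \S_(x, y <- P X) f x (s b * y).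
Proof.
move=> fo; have gd := dia_galV fo; rewrite -galV1.
have gd' : dbalanced s t (fun x y => galV f (x * t b) y).
  by case: gd => gl gb; bal; rewrite -mulrA gb.
rewrite -(trK X gd'); apply: so_ext => x y; rewrite -gal_cop //.
rewrite (cop_tak b x (dia_mulr y gd)).
by apply: so_ext => x1 x2; rewrite mulrA.
Qed.

Lemma tr_tak (f : H -> H -> W) b X : obalanced t f ->
  \S_(x, y <- P X) f (t b * x) y = \S_(x, y <- P X) f x (y * t b).
Proof.
move=> fo; have gd := dia_galV fo; have [gl gb] := gd.
transitivity (galV f X (t b)); last by [].
rewrite -[in RHS](mulr1 (t b)) -(trK X (dia_t b gd)); apply: so_ext => x y.
rewrite -gal_cop // (cop_t b x (dia_mulr y gd)).
by apply: so_ext => x1 x2; rewrite mulrA.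
Qed.

Section Trilinear.
Variable f : H -> H -> H -> W.
Hypothesis fl : trilin f.

(** Coassociativity, pulled back along the Galois map in the last two of the three legs. *)
Lemma tr_copl X : (forall b x y z, f (t b * x) y z = f x (s b * y) z) ->
  (forall b x y z, f x (y * t b) z = f x y (t b * z)) ->
  \S_(x, z <- P X) \S_(x1, x2 <- D x) f x1 x2 z =
  \S_(x, y <- D X) \S_(y1, y2 <- P y) f x y1 y2.
Proof.
move=> fb fb'; have fo x : obalanced t (f x) by bal.
pose G x y := \S_(x1, x2 <- D x) galV (f x1) x2 y.
have dg y : dbalanced s t (fun x1 x2 => galV (f x1) x2 y).
  rewrite /galV; bal; rewrite ?fb' ?mulrA // (tr_s _ _ (obal_mul _ (fo _))).
  by apply: so_ext => x1 x2; rewrite fb.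
have Gd : dbalanced s t G.
  rewrite /G /galV; bal.
  rewrite (cop_t _ _ (dg _)); apply: so_ext => x1 x2.
  by have [_ ->] := dia_galV (fo x1).
transitivity (G X 1); last by apply: so_ext => x y; rewrite galV1.
rewrite -(trK X Gd); apply: so_ext => x z.
under [LHS]so_ext => x1 x2 do rewrite -(gal_cop x2 z (fo x1)).
rewrite -(copA (f := fun x y y' => galV (f x) y (y' * z))) //.
- by rewrite /galV; bal; rewrite fb' mulrA.
- by move=> b x1 x2 x3; have [_ ->] := dg (x3 * z).
- by move=> b x1 x2 x3; have [_ ->] := dia_galV (fo x1); rewrite mulrA.
Qed.

(** [F] evaluates [f] at the preimage of its arguments under X ⊗ Y ⊗ Z |-> X_(1) ⊗ X_(2) Y ⊗ X_(3)
    Z, as [FE] shows by using [copK] twice. Both sides of the claim are the value of [f] at the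
    preimage of X ⊗ 1 ⊗ 1. *)
Lemma tr_copr X : (forall b x y z, f (x * t b) y z = f x y (t b * z)) ->
  (forall b x y z, f x (t b * y) z = f x y (s b * z)) ->
  \S_(x, y <- P X) \S_(y1, y2 <- D y) f x y1 y2 =
  \S_(x, y <- P X) \S_(x1, x2 <- P x) f x1 y x2.
Proof.
move=> fb fb'.
pose F x y z := \S_(x1, y1 <- P x) \S_(x2, z1 <- P x1) f x2 (y1 * y) (z1 * z).
have fd x : dbalanced s t (f x) by bal.
have fo y z : obalanced t (fun x1 z1 => f x1 y (z1 * z)) by bal; rewrite fb mulrA.
have Fo y z : obalanced t (fun x1 y1 => \S_(x2, z1 <- P x1) f x2 (y1 * y) (z1 * z)).
  bal; rewrite ?fb ?mulrA //.
  rewrite (tr_tr _ _ (fo _ _)); apply: so_ext => x2 z1.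
  by rewrite -!mulrA fb' mulrA.
have Fl : trilin F by rewrite /F; bal.
have Ft b x y z : F (t b * x) y z = F x (s b * y) z.
  rewrite /F (tr_t _ _ (Fo _ _)); apply: so_ext => x1 y1.
  by apply: so_ext => x2 z1; rewrite mulrA.
have Ft' b x y z : F x (t b * y) z = F x y (s b * z).
  transitivity (\S_(x1, y1 <- P x) \S_(x2, z1 <- P x1) f x2 (y1 * t b * y) (z1 * z)).
    by apply: so_ext => ? ?; apply: so_ext => ? ?; rewrite mulrA.
  rewrite -(tr_tak _ _ (Fo y z)); apply: so_ext => x1 y1.
  rewrite (tr_t _ _ (fo _ z)); apply: so_ext => x2 z1; by rewrite mulrA.
have Fd x : dbalanced s t (F x) by bal.
have FE x y z :
    \S_(x1, x' <- D x) \S_(x2, x3 <- D x') F x1 (x2 * y) (x3 * z) = f x y z.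
  rewrite -(copA (f := fun x1 x2 x3 => F x1 (x2 * y) (x3 * z))).
  - rewrite -[in RHS](mul1r z) -(copK _ (fo y z)); apply: so_ext => x1 x2.
    transitivity (\S_(x1, y1 <- P x1) f x1 (1 * y) (y1 * (x2 * z))).
      rewrite -(copK _ (Fo y (x2 * z))); apply: so_ext => x3 x4.
      by apply: so_ext => ? ?; apply: so_ext => ? ?; rewrite !mulrA.
    by apply: so_ext => ? ?; rewrite mul1r mulrA.
  - by bal.
  - by move=> *; rewrite Ft mulrA.
  - by move=> *; rewrite -mulrA Ft' mulrA.
pose G x y := \S_(y1, y2 <- D y) F x y1 y2.
have Gd : dbalanced s t G.
  by rewrite /G; bal; rewrite (cop_s _ _ (Fd _)); apply: so_ext => ? ?.
transitivity (G X 1); last first.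
  rewrite /G (cop_1 (Fd X)); apply: so_ext => ? ?; apply: so_ext => ? ?.
  by rewrite !mulr1.
rewrite -(trK X Gd); apply: so_ext => x y.
under [LHS]so_ext => y1 y2 do rewrite -FE.
rewrite so_swap; apply: so_ext => x1 x2.
by rewrite /G cop_mul.
Qed.

End Trilinear.

(** By [tr_copr] the second leg of X_- may be replaced by X_+-, and X_++(1) ⊗ X_++(2) X_+- = X_+ ⊗
    1. *)
Lemma tr_cop_mul (f : H -> H -> H -> W) X : trilin f ->
  (forall b x y z, f (t b * x) y z = f x y (s b * z)) ->
  (forall b x y z, f (x * t b) y z = f x (t b * y) z) ->
  \S_(x, y <- P X) \S_(x1, x2 <- D x) \S_(y1, y2 <- D y) f x1 y1 (x2 * y2) =
  \S_(x, y <- P X) f x y 1.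
Proof.
move=> fl fb fb'.
have fd y z : dbalanced s t (fun x1 x2 => f x1 y (x2 * z)) by bal; rewrite fb mulrA.
have fd1 y : dbalanced s t (fun x1 x2 => f x1 y x2) by bal.
pose g x y z := \S_(x1, x2 <- D x) f x1 y (x2 * z).
transitivity (\S_(x, y <- P X) \S_(y1, y2 <- D y) g x y1 y2).
  by apply: so_ext => x y; rewrite so_swap.
rewrite tr_copr; last first.
- move=> b x y z; rewrite /g; under [LHS]so_ext => x1 x2 do rewrite -fb'.
  rewrite (cop_tak _ _ (fd _ _)).
  by apply: so_ext => ? ?; rewrite mulrA.
- move=> b x y z; rewrite /g (cop_tr _ _ (fd _ _)).
  by apply: so_ext => ? ?; rewrite mulrA.
- by rewrite /g; bal.
by apply: so_ext => x y; rewrite (trK x (fd1 y)).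
Qed.

End HopfIdentities.

Section MixedIdentity.
Variables (k : fieldType) (H : algebra k) (B : Type) (S : hopf_calculus H B).
Variable W : lmodType k.
Local Notation s := (hs S).
Local Notation t := (ht S).
Local Notation D := (cop S).
Local Notation P := (tr S).
Local Notation Q := (trb S).

(** The link between the two translation maps. Inserting X ⊗ 1 = X_(1)+ ⊗ X_(1)- X_(2) on the left
    ([copK]), and writing [f] on the right through the other Galois map ([fE]), leaves an instance
    of [tr_copr]. *)
Lemma tr_trb (f : H -> H -> H -> W) X : trilin f ->
  (forall b x y z, f (x * t b) y z = f x (t b * y) z) ->
  (forall b x y z, f x (y * s b) z = f x y (s b * z)) ->
  \S_(x, y <- P X) \S_(y1, y2 <- Q y) f x y1 y2 =
  \S_(x, x' <- D X) \S_(x1, x2 <- P x) f x1 x2 x'.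
Proof.
move=> fl fb fb'; have fo x : obalanced s (f x) by bal.
pose g x y z := \S_(y1, y2 <- Q y) f x y1 (y2 * z).
have go x z : obalanced s (fun y1 y2 => f x y1 (y2 * z)) by bal; rewrite fb' mulrA.
have gt b x y z : g (x * t b) y z = g x (t b * y) z.
  rewrite /g (tr_s (S := coopp S) _ _ (go _ _)).
  by apply: so_ext => ? ?; rewrite fb.
have gd x : dbalanced t s (g x) := dia_galV (S := coopp S) (fo x).
have gl : trilin g by rewrite /g; bal.
have hP y : obalanced t (fun x x' => g x x' y) by bal.
have ho : obalanced t (fun x y => \S_(x1, x2 <- P x) g x1 x2 y).
  bal; rewrite (tr_tr _ _ (hP _)); apply: so_ext => x1 x2.
  by have [_ ->] := gd x1.
transitivity (\S_(x1, x2 <- P X) g x1 x2 1).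
  by apply: so_ext => x y; apply: so_ext => ? ?; rewrite mulr1.
rewrite -(copK _ ho); apply: so_ext => x x'.
have fE x1 x2 : \S_(z, y <- D x2) g x1 y (z * x') = f x1 x2 x'.
  exact: (gal_cop (S := coopp S) x2 x' (fo x1)).
under [RHS]so_ext => x1 x2 do rewrite -fE.
rewrite (tr_copr (f := fun x y z => g x z (y * x'))) //; first by bal.
by move=> b x1 y z; rewrite -mulrA; have [_ ->] := gd x1.
Qed.

End MixedIdentity.

(** * Convolution of balanced maps *)

Section BaseMeasuring.
Variables (k : fieldType) (H A : algebra k) (B : Type) (S : hopf_calculus H B).

(* mi and mt are b |-> b and (X, b) |-> X ▷ b, with values in A. *)
Record bmeas := Bmeas {
  mi : B -> A;
  mt : H -> B -> A;
  mt_lin : forall b, lin (mt^~ b);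
  mt_s : forall b X c, mt (hs S b * X) c = mi b * mt X c;
  mt_t : forall b X c, mt (ht S b * X) c = mt X c * mi b
}.

End BaseMeasuring.

Ltac lin_meas :=
  match goal with
  | |- lin (fun x => mt ?T (@?E x) ?b) => refine (lin_ap (mt_lin T b) _)
  end.

Ltac lin_op ::= lin_meas.

Lemma eq2_fun (U V W : Type) (f f' : U -> V -> W) :
  (forall x y, f x y = f' x y) -> f = f'.
Proof. by move=> ff'; apply/funext => x; apply/funext => y. Qed.

Section Convolution.
Variables (k : fieldType) (H N : algebra k) (B : Type) (S : hopf_calculus H B).
Variable T : bmeas N S.
Local Notation s := (hs S).
Local Notation t := (ht S).
Local Notation D := (cop S).
Local Notation a := (mt T).
Local Notation i := (mi T).
Implicit Types F G K : H -> H -> N.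

(* The two ways in which a map of X and Y can be balanced on one side: as
   X ▷ (Y ▷ n), for true, or as (X Y) ▷ n, for false. A map of class p q is a
   morphism from p to q for the convolution product, σ is a map of class
   true false and σ^-1 is its inverse. *)
Definition balL (p : bool) F := forall b X Y, F X (s b * Y) =
  if p then \S_(x, x' <- D X) (a x b * F x' Y) else F (X * s b) Y.

Definition balR (p : bool) F := forall b X Y, F X (t b * Y) =
  if p then \S_(x, x' <- D X) (F x Y * a x' b) else F (X * t b) Y.

Record conv_class (p q : bool) F := Cls {
  cls_lin : bilin F;
  cls_s : forall b X Y, F (s b * X) Y = i b * F X Y;
  cls_t : forall b X Y, F (t b * X) Y = F X Y * i b;
  cls_L : balL p F;
  cls_R : balR q F
}.

Definition convol F G X Y :=
  \S_(y, y' <- D Y) \S_(x, x' <- D X) (F x y * G x' y').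

End Convolution.

Ltac lin_cls :=
  lin_eta;
  match goal with
  | HH : conv_class _ _ _ ?F |- lin (fun x => ?F (@?E x) ?y) =>
    refine (lin_ap ((cls_lin HH).1 y) _)
  | HH : conv_class _ _ _ ?F |- lin (fun x => ?F ?y (@?E x)) =>
    refine (lin_ap ((cls_lin HH).2 y) _)
  | |- lin _ => lin_op
  end.

Ltac balc := repeat (first [bal1 | lin_cls]).

Section ConvolutionTheory.
Variables (k : fieldType) (H N : algebra k) (B : Type) (S : hopf_calculus H B).
Variable T : bmeas N S.
Local Notation s := (hs S).
Local Notation t := (ht S).
Local Notation D := (cop S).
Local Notation a := (mt T).
Local Notation cls := (conv_class T).
Implicit Types F G K : H -> H -> N.

Lemma dia_conv p q q' r F G y y' : cls p q F -> cls q' r G ->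
  dbalanced s t (fun x x' => F x y * G x' y').
Proof. by move=> cF cG; balc; rewrite (cls_t cF) (cls_s cG) mulrA. Qed.

(** Sharing the class q makes F and G composable: what t(b) contributes on the right of F is what
    s(b) contributes on the left of G. For true this is an extra factor X_(2) ▷ b between them,
    shifted by coassociativity; for false it is the Takeuchi condition. *)
Lemma conv_bal p q r F G b X Y Y' : cls p q F -> cls q r G ->
  \S_(x, x' <- D X) (F x (t b * Y) * G x' Y') =
  \S_(x, x' <- D X) (F x Y * G x' (s b * Y')).
Proof.
move=> cF cG; case: q cF cG => cF cG; last first.
  under so_ext => x x' do rewrite (cls_R cF).
  rewrite (cop_tak _ _ (dia_conv Y Y' cF cG)).
  by apply: so_ext => x x'; rewrite (cls_L cG).
under so_ext => x x' do rewrite (cls_R cF) so_mulrl.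
rewrite (copA (f := fun x y z => F x Y * a y b * G z Y')).
- apply: so_ext => x x'; rewrite (cls_L cG) so_mulrr.
  by apply: so_ext => ? ?; rewrite mulrA.
- by balc.
- by move=> *; rewrite (cls_t cF) mt_s !mulrA.
- by move=> *; rewrite mt_t (cls_s cG) !mulrA.
Qed.

Lemma dia_conv2 p q r F G X : cls p q F -> cls q r G ->
  dbalanced s t (fun y y' => \S_(x, x' <- D X) (F x y * G x' y')).
Proof. move=> cF cG; balc; exact: (conv_bal _ _ _ _ cF cG). Qed.

Lemma cls_conv p q r F G : cls p q F -> cls q r G -> cls p r (convol S F G).
Proof.
move=> cF cG; have dx y y' := dia_conv y y' cF cG.
have dy X := dia_conv2 X cF cG; rewrite /convol; split.
- by balc.
- move=> b X Y; rewrite so_mulrr; apply: so_ext => y y'.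
  rewrite (cop_s _ _ (dx _ _)) so_mulrr; apply: so_ext => x x'.
  by rewrite (cls_s cF) mulrA.
- move=> b X Y; rewrite so_mulrl; apply: so_ext => y y'.
  rewrite (cop_t _ _ (dx _ _)) so_mulrl; apply: so_ext => x x'.
  by rewrite (cls_t cG) mulrA.
- move=> b X Y; rewrite (cop_s _ _ (dy _)); case: p cF => cF.
    under [RHS]so_ext => ? ? do rewrite so_mulrr.
    rewrite [RHS]so_swap; apply: so_ext => y y'.
    under [RHS]so_ext => ? ? do rewrite so_mulrr.
    rewrite -(copA (f := fun x x' x'' => a x b * (F x' y * G x'' y'))).
    - apply: so_ext => x x'; rewrite (cls_L cF) so_mulrl.
      by apply: so_ext => *; rewrite mulrA.
    - by balc.
    - by move=> *; rewrite mt_t (cls_s cF) !mulrA.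
    - by move=> *; rewrite (cls_t cF) (cls_s cG) !mulrA.
  apply: so_ext => y y'; rewrite (cop_sr _ _ (dx _ _)).
  by apply: so_ext => x x'; rewrite (cls_L cF).
- move=> b X Y; rewrite (cop_t _ _ (dy _)); case: r cG => cG.
    under [RHS]so_ext => ? ? do rewrite so_mulrl.
    rewrite [RHS]so_swap; apply: so_ext => y y'.
    under [RHS]so_ext => ? ? do rewrite so_mulrl.
    rewrite (copA (f := fun x x' x'' => F x y * G x' y' * a x'' b)).
    - apply: so_ext => x x'; rewrite (cls_R cG) so_mulrr.
      by apply: so_ext => *; rewrite mulrA.
    - by balc.
    - by move=> *; rewrite (cls_t cF) (cls_s cG) !mulrA.
    - by move=> *; rewrite (cls_t cG) mt_s !mulrA.
  apply: so_ext => y y'; rewrite (cop_tr _ _ (dx _ _)).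
  by apply: so_ext => x x'; rewrite (cls_R cG).
Qed.

Lemma convA p q r u F G K : cls p q F -> cls q r G -> cls r u K ->
  convol S (convol S F G) K = convol S F (convol S G K).
Proof.
move=> cF cG cK; apply: eq2_fun => X Y; rewrite /convol.
have tx y1 y2 y3 : \S_(x, x' <- D X) \S_(x1, x2 <- D x) (F x1 y1 * G x2 y2 * K x' y3)
   = \S_(x, x' <- D X) \S_(x1, x2 <- D x') (F x y1 * G x1 y2 * K x2 y3).
  rewrite (copA (f := fun x x' x'' => F x y1 * G x' y2 * K x'' y3)) //.
  - by balc.
  - by move=> *; rewrite (cls_t cF) (cls_s cG) !mulrA.
  - by move=> *; rewrite (cls_t cG) (cls_s cK) !mulrA.
transitivity (\S_(y, y' <- D Y) \S_(y1, y2 <- D y)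
    \S_(x, x' <- D X) \S_(x1, x2 <- D x) (F x1 y1 * G x2 y2 * K x' y')).
  apply: so_ext => y y'; rewrite so_swap; apply: so_ext => x x'.
  by rewrite so_mulrl; apply: so_ext => y1 y2; rewrite so_mulrl.
rewrite (copA (f := fun y1 y2 y3 =>
    \S_(x, x' <- D X) \S_(x1, x2 <- D x) (F x1 y1 * G x2 y2 * K x' y3))).
- apply: so_ext => y y'; under so_ext => y1 y2 do rewrite tx.
  rewrite so_swap; apply: so_ext => x x'; rewrite so_mulrr.
  apply: so_ext => y1 y2; rewrite so_mulrr.
  by apply: so_ext => *; rewrite mulrA.
- by balc.
- move=> b y1 y2 y3; apply: so_ext => x x'; rewrite -!so_mulrl.
  by rewrite (conv_bal _ _ _ _ cF cG).
- move=> b y1 y2 y3; rewrite !tx; apply: so_ext => x x'.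
  under so_ext => ? ? do rewrite -mulrA; rewrite -so_mulrr.
  rewrite (conv_bal _ _ _ _ cG cK) so_mulrr.
  by apply: so_ext => *; rewrite mulrA.
Qed.

End ConvolutionTheory.

Section ConvolutionSums.
Variables (k : fieldType) (H N : algebra k) (B : Type) (S : hopf_calculus H B).
Variable T : bmeas N S.
Local Notation s := (hs S).
Local Notation t := (ht S).
Local Notation D := (cop S).
Local Notation i := (mi T).
Local Notation cls := (conv_class T).
Local Notation conv := (convol S).
Implicit Types (X Y Z : H).

Definition bimod_map (f : H -> N) :=
  [/\ lin f, forall b X, f (s b * X) = i b * f X
    & forall b X, f (t b * X) = f X * i b].

Lemma bim_mulr f Z : bimod_map f -> bimod_map (fun X => f (X * Z)).
Proof.
by case=> fl fs ft; split; [bal | move=> b X; rewrite -mulrA fs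
  | move=> b X; rewrite -mulrA ft].
Qed.

Lemma dia_bim f f' : bimod_map f -> bimod_map f' -> dbalanced s t (fun x y => f x * f' y).
Proof. by move=> [fl _ ft] [fl' fs' _]; bal; rewrite ft fs' mulrA. Qed.

Lemma cls_mulr p q F Z : cls p q F -> cls p q (fun X Y => F X (Y * Z)).
Proof.
case=> Fl Fs Ft FL FR; split=> //; first by bal.
- move=> b X Y; rewrite -mulrA FL.
  by case: p {FL}.
- move=> b X Y; rewrite -mulrA FR.
  by case: q {FR}.
Qed.

Lemma cls_mul f : bimod_map f -> cls false false (fun X Y => f (X * Y)).
Proof.
case=> fl fs ft; split; first by bal.
- by move=> b X Y; rewrite -mulrA fs.
- by move=> b X Y; rewrite -mulrA ft.
- by move=> b X Y; rewrite mulrA.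
- by move=> b X Y; rewrite mulrA.
Qed.

Lemma conv_mul f f' : bimod_map f -> bimod_map f' ->
  conv (fun X Y => f (X * Y)) (fun X Y => f' (X * Y)) =
  fun X Y => \S_(x, y <- D (X * Y)) (f x * f' y).
Proof.
by move=> fb fb'; apply: eq2_fun => X Y; rewrite cop_mul //; apply: dia_bim.
Qed.

(** Convolution in three variables with the third one as a parameter: for fixed legs of Z the theory
    in X and Y applies, and only the balancing in Z is new. *)
Definition convolz (F G : H -> H -> H -> N) Z : H -> H -> N :=
  fun X Y => \S_(z, z' <- D Z) conv (F z) (G z') X Y.

Definition zlinear (F : H -> H -> H -> N) := forall X Y, lin (fun z => F z X Y).

Definition zbalanced (F G : H -> H -> H -> N) :=
  forall b z z', conv (F (t b * z)) (G z') = conv (F z) (G (s b * z')).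

Lemma zlin_convl F G : zlinear F -> zlinear (fun z => conv (F z) G).
Proof. by move=> Fl X Y; rewrite /conv; balc; apply: Fl. Qed.

Lemma zlin_convr F G : zlinear G -> zlinear (fun z => conv F (G z)).
Proof. by move=> Fl X Y; rewrite /conv; balc; apply: Fl. Qed.

Lemma conv_suml (r : sumop k H) (F : H -> H -> H -> H -> N) G :
  conv (fun X Y => \S_(z, z' <- r) F z z' X Y) G =
  fun X Y => \S_(z, z' <- r) conv (F z z') G X Y.
Proof.
apply: eq2_fun => X Y; rewrite so_swap; apply: so_ext => y y'.
by rewrite so_swap; apply: so_ext => x x'; rewrite so_mulrl.
Qed.

Lemma conv_sumr (r : sumop k H) (F : H -> H -> H -> H -> N) G :
  conv G (fun X Y => \S_(z, z' <- r) F z z' X Y) =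
  fun X Y => \S_(z, z' <- r) conv G (F z z') X Y.
Proof.
apply: eq2_fun => X Y; rewrite so_swap; apply: so_ext => y y'.
by rewrite so_swap; apply: so_ext => x x'; rewrite so_mulrr.
Qed.

Lemma convzA p q r u F G K : (forall z, cls p q (F z)) ->
  (forall z, cls q r (G z)) -> (forall z, cls r u (K z)) ->
  zlinear F -> zlinear G -> zlinear K -> zbalanced F G -> zbalanced G K ->
  convolz (convolz F G) K = convolz F (convolz G K).
Proof.
move=> cF cG cK Fl Gl Kl FG GK; apply/funext => Z; apply: eq2_fun => X Y.
rewrite /convolz; under so_ext => z z' do rewrite conv_suml.
under [RHS]so_ext => z z' do rewrite conv_sumr.
rewrite (copA (f := fun x y z => conv (conv (F x) (G y)) (K z) X Y)).
- by apply: so_ext => z z'; apply: so_ext => z1 z2; rewrite (convA (cF _) (cG _) (cK _)).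
- split=> z z'; first by do 2!apply: zlin_convl.
    by apply: zlin_convl => ? ?; apply: zlin_convr.
  exact: zlin_convr.
- by move=> b x y z; rewrite FG.
- by move=> b x y z; rewrite !(convA (cF _) (cG _) (cK _)) GK.
Qed.

Lemma conv_convz p q r u F G K : cls p q F ->
  (forall z, cls q r (G z)) -> (forall z, cls r u (K z)) ->
  convolz (fun z => conv F (G z)) K = fun Z => conv F (convolz G K Z).
Proof.
move=> cF cG cK; apply/funext => Z; rewrite conv_sumr; apply: eq2_fun => X Y.
by apply: so_ext => z z'; rewrite (convA cF (cG _) (cK _)).
Qed.

Lemma convz_conv p q r u F G K : (forall z, cls p q (F z)) ->
  (forall z, cls q r (G z)) -> cls r u K ->
  convolz F (fun z => conv (G z) K) = fun Z => conv (convolz F G Z) K.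
Proof.
move=> cF cG cK; apply/funext => Z; rewrite conv_suml; apply: eq2_fun => X Y.
by apply: so_ext => z z'; rewrite (convA (cF _) (cG _) cK).
Qed.

(** Here b is handed over from Z to the right of Y, where it crosses the convolution by the Takeuchi
    condition. *)
Lemma zbal_false p q r F G : (forall z, cls p q (F z)) -> (forall z, cls q r (G z)) ->
  (forall b z X Y, F (t b * z) X Y = F z X (Y * t b)) ->
  (forall b z X Y, G (s b * z) X Y = G z X (Y * s b)) -> zbalanced F G.
Proof.
move=> cF cG FR GL b z z'; apply: eq2_fun => X Y.
transitivity (\S_(y, y' <- D Y) \S_(x, x' <- D X) (F z x (y * t b) * G z' x' y')).
  by apply: so_ext => y y'; apply: so_ext => x x'; rewrite FR.
rewrite (cop_tak _ _ (dia_conv2 X (cF z) (cG z'))).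
by apply: so_ext => y y'; apply: so_ext => x x'; rewrite GL.
Qed.

(** Here b comes out as a factor of its own, in practice X ▷ (Y ▷ b), and crosses by
    associativity. *)
Lemma zbal_true p r F G (K : B -> H -> H -> N) :
  (forall b, cls true true (K b)) -> (forall z, cls p true (F z)) ->
  (forall z, cls true r (G z)) ->
  (forall b z, F (t b * z) = conv (F z) (K b)) ->
  (forall b z, G (s b * z) = conv (K b) (G z)) -> zbalanced F G.
Proof.
by move=> cK cF cG FR GL b z z'; rewrite FR GL (convA (cF z) (cK b) (cG z')).
Qed.

End ConvolutionSums.

(** * Invertible cocycles *)

Section Twist.
Variables (k : fieldType) (H N : algebra k) (B : Type) (S : hopf_calculus H B).

(* An invertible 2-cocycle: ta, tg, tv and tb are ▷, σ, σ^-1 and B -> N. *)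
Record twist := Twist {
  ta : H -> N -> N;
  tg : H -> H -> N;
  tv : H -> H -> N;
  tb : B -> N;
  ta_lin : bilin ta;
  tg_lin : bilin tg;
  tv_lin : bilin tv;
  ta_s : forall b X n, ta (hs S b * X) n = tb b * ta X n;
  ta_t : forall b X n, ta (ht S b * X) n = ta X n * tb b;
  ta_unit : forall X, ta X 1 = tb (hep S X);
  ta_1 : forall n, ta 1 n = n;
  ta_mul : forall X m n,
    ta X (m * n) = \S_(x, x' <- cop S X) (ta x m * ta x' n);
  tg_s : forall b X Y, tg (hs S b * X) Y = tb b * tg X Y;
  tg_t : forall b X Y, tg (ht S b * X) Y = tg X Y * tb b;
  tg_bal : forall b X Y, tg (X * ht S b) Y = tg X (ht S b * Y);
  tg_X1 : forall X, tg X 1 = ta X 1;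
  tg_1X : forall X, tg 1 X = ta X 1;
  tg_src : forall b X Y,
    tg X (hs S b * Y) = \S_(x, x' <- cop S X) (ta x (tb b) * tg x' Y);
  tv_s : forall b X Y, tv (hs S b * X) Y = tb b * tv X Y;
  tv_t : forall b X Y, tv (ht S b * X) Y = tv X Y * tb b;
  tv_bal : forall b X Y, tv (X * hs S b) Y = tv X (hs S b * Y);
  tv_tgt : forall b X Y,
    tv X (ht S b * Y) = \S_(x, x' <- cop S X) (tv x Y * ta x' (tb b));
  tg_tv : forall X Y, \S_(y, y' <- cop S Y) \S_(x, x' <- cop S X)
    (tg x y * tv x' y') = ta X (ta Y 1);
  tv_tg : forall X Y, \S_(y, y' <- cop S Y) \S_(x, x' <- cop S X)
    (tv x y * tg x' y') = ta (X * Y) 1;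
  tg_cocycle : forall X Y Z,
    \S_(z, z' <- cop S Z) \S_(y, y' <- cop S Y) \S_(x, x' <- cop S X)
      (ta x (tg y z) * tg x' (y' * z')) =
    \S_(y, y' <- cop S Y) \S_(x, x' <- cop S X) (tg x y * tg (x' * y') Z);
  tg_act : forall X Y n,
    \S_(y, y' <- cop S Y) \S_(x, x' <- cop S X) (tg x y * ta (x' * y') n) =
    \S_(y, y' <- cop S Y) \S_(x, x' <- cop S X) (ta x (ta y n) * tg x' y')
}.


Variable T : twist.

Fact twist_mt_lin b : lin (fun X => ta T X (tb T b)).
Proof. exact: (ta_lin T).1. Qed.

Definition twist_bmeas : bmeas N S :=
  Bmeas twist_mt_lin (fun b X c => ta_s T b X (tb T c))
    (fun b X c => ta_t T b X (tb T c)).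

End Twist.

Ltac lin_twist :=
  match goal with
  | |- lin (fun x => ta ?T (@?E x) ?n) => refine (lin_ap ((ta_lin T).1 n) _)
  | |- lin (fun x => ta ?T ?X (@?E x)) => refine (lin_ap ((ta_lin T).2 X) _)
  | |- lin (fun x => tg ?T (@?E x) ?n) => refine (lin_ap ((tg_lin T).1 n) _)
  | |- lin (fun x => tg ?T ?X (@?E x)) => refine (lin_ap ((tg_lin T).2 X) _)
  | |- lin (fun x => tv ?T (@?E x) ?n) => refine (lin_ap ((tv_lin T).1 n) _)
  | |- lin (fun x => tv ?T ?X (@?E x)) => refine (lin_ap ((tv_lin T).2 X) _)
  end.

Ltac lin_op ::= first [lin_meas | lin_twist].

Section TwistTheory.
Variables (k : fieldType) (H N : algebra k) (B : Type) (S : hopf_calculus H B).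
Variable T : twist N S.
Local Notation s := (hs S).
Local Notation t := (ht S).
Local Notation D := (cop S).
Local Notation a := (ta T).
Local Notation g := (tg T).
Local Notation v := (tv T).
Local Notation i := (tb T).
Local Notation cls := (conv_class (twist_bmeas T)).
Local Notation conv := (convol S).
Local Notation convz := (convolz S).
Local Notation zbal := (zbalanced S).
Local Notation bim := (bimod_map (twist_bmeas T)).
Implicit Types (X Y Z : H) (n : N).

Lemma cop_epl (W : lmodType k) (f : H -> W) X : lin f ->
  \S_(x, y <- D X) f (s (hep S x) * y) = f X.
Proof. by move=> fl; rewrite -so_lin // cop_counitl. Qed.

Lemma cop_epr (W : lmodType k) (f : H -> W) X : lin f ->
  \S_(x, y <- D X) f (t (hep S y) * x) = f X.
Proof. by move=> fl; rewrite -so_lin // cop_counitr. Qed.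

Lemma bim_a n : bim (a^~ n).
Proof. by split; [bal | move=> b X; rewrite ta_s | move=> b X; rewrite ta_t]. Qed.

Lemma bim_g Z : bim (g^~ Z).
Proof. by split; [bal | move=> b X; rewrite tg_s | move=> b X; rewrite tg_t]. Qed.

Lemma bim_v Z : bim (v^~ Z).
Proof. by split; [bal | move=> b X; rewrite tv_s | move=> b X; rewrite tv_t]. Qed.

Lemma cls_g : cls true false g.
Proof.
split; [exact: tg_lin | exact: tg_s | exact: tg_t | exact: tg_src |].
by move=> b X Y; rewrite tg_bal.
Qed.

Lemma cls_v : cls false true v.
Proof.
split; [exact: tv_lin | exact: tv_s | exact: tv_t | | exact: tv_tgt].
by move=> b X Y; rewrite tv_bal.
Qed.

Lemma cls_act f : bim f -> cls true true (fun X Y => a X (f Y)).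
Proof.
case=> fl fs ft; split; first by bal.
- by move=> b X Y; rewrite ta_s.
- by move=> b X Y; rewrite ta_t.
- by move=> b X Y; rewrite fs ta_mul.
- by move=> b X Y; rewrite ft ta_mul.
Qed.

Lemma conv_act (f f' : H -> N) :
  conv (fun X Y => a X (f Y)) (fun X Y => a X (f' Y)) =
  fun X Y => a X (\S_(x, y <- D Y) (f x * f' y)).
Proof.
apply: eq2_fun => X Y; rewrite so_lin; last by bal.
by apply: so_ext => y y'; rewrite ta_mul.
Qed.

Lemma tg_actE n : conv g (fun X Y => a (X * Y) n) = conv (fun X Y => a X (a Y n)) g.
Proof. by apply: eq2_fun => X Y; apply: tg_act. Qed.

Lemma ta_unitl f X : bim f -> \S_(x, x' <- D X) (a x 1 * f x') = f X.
Proof.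
case=> fl fs _; rewrite -[RHS](cop_epl X fl); apply: so_ext => x x'.
by rewrite fs ta_unit.
Qed.

Lemma ta_unitr f X : bim f -> \S_(x, x' <- D X) (f x * a x' 1) = f X.
Proof.
case=> fl _ ft; rewrite -[RHS](cop_epr X fl); apply: so_ext => x x'.
by rewrite ft ta_unit.
Qed.

Lemma conv_v1 : conv v (fun X Y => a X (a Y 1)) = v.
Proof.
apply: eq2_fun => X Y; rewrite -[RHS](cop_epr Y ((tv_lin T).2 X)).
by apply: so_ext => y y'; rewrite tv_tgt ta_unit.
Qed.

(** The law [tg_actE] conjugated by σ^-1. The local units X ▷ (Y ▷ 1), which is σ times σ^-1, and (X
    Y) ▷ 1, which is σ^-1 times σ, are inserted and absorbed. *)
Lemma tv_actE n :
  conv v (fun X Y => a X (a Y n)) = conv (fun X Y => a (X * Y) n) v.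
Proof.
have cA m := cls_act (bim_a m); have cT m := cls_mul (bim_a m).
have gv : (fun X Y => a X (a Y 1)) = conv g v.
  by apply: eq2_fun => X Y; rewrite -tg_tv.
have vg : (fun X Y => a (X * Y) 1) = conv v g.
  by apply: eq2_fun => X Y; rewrite -tv_tg.
have AA : (fun X Y => a X (a Y n)) =
    conv (fun X Y => a X (a Y n)) (fun X Y => a X (a Y 1)).
  by rewrite conv_act; apply: eq2_fun => X Y; rewrite ta_unitr //; apply: bim_a.
rewrite AA gv -(convA (cA n) cls_g cls_v) -tg_actE (convA cls_g (cT n) cls_v).
rewrite -(convA cls_v cls_g (cls_conv (cT n) cls_v)) -vg.
rewrite -(convA (cT 1) (cT n) cls_v) (conv_mul (bim_a 1) (bim_a n)).
by congr (conv _ _); apply: eq2_fun => X Y; rewrite -ta_mul mul1r.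
Qed.

Lemma conv_T1v : conv (fun X Y => a (X * Y) 1) v = v.
Proof. by rewrite -tv_actE conv_v1. Qed.


(** The normalisation of σ^-1 is read off from the product of σ and σ^-1 at Y = 1, where σ is itself
    trivial. *)
Lemma tv_X1 X : v X 1 = a X 1.
Proof.
have := tg_tv T X 1; rewrite (cop_1 (dia_conv2 X cls_g cls_v)) ta_1 => <-.
by under [RHS]so_ext => ? ? do rewrite tg_X1; rewrite (ta_unitl X (bim_v 1)).
Qed.

Lemma tv_1X X : v 1 X = a X 1.
Proof.
have := tg_tv T 1 X; rewrite [RHS]ta_1 => <-.
rewrite -[LHS](cop_epl X ((tv_lin T).2 1)); apply: so_ext => x x'.
rewrite cop_1; last exact: dia_conv cls_g cls_v.
by rewrite tg_1X ta_unit -tv_bal mul1r -[s _]mulr1 tv_s.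
Qed.

Let aV z X Y := a X (v Y z).
Let aG z X Y := a X (g Y z).
Let aT z X Y := a X (a (Y * z) 1).
Let gR z X Y := g X (Y * z).
Let vR z X Y := v X (Y * z).
Let gM z X Y := g (X * Y) z.
Let vM z X Y := v (X * Y) z.

Let caV z : cls true true (aV z) := cls_act (bim_v z).
Let caG z : cls true true (aG z) := cls_act (bim_g z).
Let cgR z : cls true false (gR z) := cls_mulr z cls_g.
Let cvR z : cls false true (vR z) := cls_mulr z cls_v.
Let cgM z : cls false false (gM z) := cls_mul (bim_g z).
Let cvM z : cls false false (vM z) := cls_mul (bim_v z).

Fact tg_absorb : convz aT gR = gR.
Proof.
apply/funext => Z; apply: eq2_fun => X Y.
transitivity (\S_(w, w' <- D (Y * Z)) \S_(x, x' <- D X) (a x (a w 1) * g x' w')).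
  by rewrite cop_mul //; apply: dia_conv2 (cls_act (bim_a 1)) cls_g.
rewrite -[RHS](cop_epl (Y * Z) ((tg_lin T).2 X)); apply: so_ext => w w'.
by rewrite tg_src ta_unit.
Qed.

(** The cocycle identity multiplied by X ▷ σ^-1(Y, Z) on the left and by σ^-1(X Y, Z) on the right.
    What the cancellation on the right leaves, (X Y) ▷ (Z ▷ 1), is carried through σ by [tg_actE]
    and absorbed in X ▷ σ^-1(Y, Z). *)
Lemma tv_tg_cocycle : convz gR vM = fun Z => conv (aV Z) g.
Proof.
have aTE : aT = convz aV aG.
  apply/funext => Z; apply: eq2_fun => X Y.
  rewrite /aT -tv_tg so_lin; last by bal.
  by apply: so_ext => z z'; rewrite [RHS](congr1 (fun F => F X Y) (conv_act _ _)).
pose K z := conv g (gM z).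
have cK z : cls true false (K z) := cls_conv cls_g (cgM z).
have aGgR : convz aG gR = K.
  by apply/funext => Z; apply: eq2_fun => X Y; apply: tg_cocycle.
have aV_R b z : aV (t b * z) = conv (aV z) (fun X Y => a X (a Y (i b))).
  by rewrite conv_act; apply: eq2_fun => X Y; rewrite /aV tv_tgt.
have aG_L b z : aG (s b * z) = conv (fun X Y => a X (a Y (i b))) (aG z).
  by rewrite conv_act; apply: eq2_fun => X Y; rewrite /aG tg_src.
have aVG : zbal aV aG by apply: (zbal_true (fun b => cls_act (bim_a (i b)))).
have aGR : zbal aG gR.
  by apply: zbal_false => // b z X Y; rewrite /aG /gR ?tg_bal ?mulrA.
have K_L b z : K (s b * z) = conv (fun X Y => a X (a Y (i b))) (K z).
  rewrite /K -(convA (cls_act (bim_a (i b))) cls_g (cgM z)) -tg_actE.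
  rewrite (convA cls_g (cls_mul (bim_a (i b))) (cgM z)); congr (conv _ _).
  rewrite (conv_mul (bim_a _) (bim_g _)).
  by apply: eq2_fun => X Y; rewrite /gM tg_src.
have aVK : zbal aV K by apply: (zbal_true (fun b => cls_act (bim_a (i b)))).
have KvM : zbal K vM.
  apply: (zbal_false cK cvM) => b z X Y; last by rewrite /vM mulrA tv_bal.
  rewrite /K /conv (cop_tr _ _ (dia_conv2 X cls_g (cgM z))).
  apply: so_ext => y y'; apply: so_ext => x x'.
  by rewrite /gM mulrA tg_bal.
have zaV : zlinear aV by move=> X Y; rewrite /aV; bal.
have zaG : zlinear aG by move=> X Y; rewrite /aG; bal.
have zgR : zlinear gR by move=> X Y; rewrite /gR; bal.
have zvM : zlinear vM by move=> X Y; rewrite /vM; bal.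
have zgM : zlinear gM by move=> X Y; rewrite /gM; bal.
have zK : zlinear K by apply: zlin_convr.
rewrite -tg_absorb aTE (convzA caV caG cgR) // aGgR (convzA caV cK cvM) //.
rewrite (conv_convz cls_g cgM cvM).
have -> : convz gM vM = fun Z => fun X Y => a (X * Y) (a Z 1).
  apply/funext => Z; apply: eq2_fun => X Y; rewrite -tg_tv.
  apply: so_ext => z z'; rewrite cop_mul //.
  exact: dia_bim (bim_g _) (bim_v _).
under eq_fun => Z do rewrite tg_actE.
rewrite (convz_conv caV (fun z => cls_act (bim_a (a z 1))) cls_g).
apply/funext => Z; congr (conv _ _); apply: eq2_fun => X Y.
transitivity (\S_(z, z' <- D Z) a X (v Y (t (hep S z') * z))).
  apply: so_ext => z z'; rewrite [LHS](congr1 (fun F => F X Y) (conv_act _ _)).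
  by rewrite tv_tgt ta_unit.
by rewrite (cop_epr (f := fun z => a X (v Y z))) //; bal.
Qed.

(** The mixed identity [tv_tg_cocycle] multiplied by σ^-1(X, Y Z) on the left and by σ^-1(X, Y) on
    the right. It makes σ^-1 a cocycle of the co-opposite over the opposite of N. *)
Lemma tv_cocycle : convz vR aV = fun Z => conv (vM Z) v.
Proof.
have aVE : aV = fun z => conv (conv (aV z) g) v.
  apply/funext => z; rewrite (convA (caV z) cls_g cls_v).
  have -> : conv g v = fun X Y => a X (a Y 1).
    by apply: eq2_fun => X Y; apply: tg_tv.
  rewrite conv_act; apply: eq2_fun => X Y.
  by rewrite ta_unitr //; apply: bim_v.
have zgR : zlinear gR by move=> X Y; rewrite /gR; bal.
have zvR : zlinear vR by move=> X Y; rewrite /vR; bal.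
have zvM : zlinear vM by move=> X Y; rewrite /vM; bal.
have vgR : zbal vR gR.
  by apply: (zbal_false cvR cgR) => b z X Y; rewrite /vR /gR mulrA.
have gRM : zbal gR vM.
  by apply: (zbal_false cgR cvM) => b z X Y; rewrite /gR /vM mulrA ?tv_bal.
rewrite {1}aVE (convz_conv cvR (fun z => cls_conv (caV z) cls_g) cls_v).
rewrite -tv_tg_cocycle -(convzA cvR cgR cvM) //.
apply/funext => Z; congr (conv _ _); apply: eq2_fun => X Y.
transitivity (\S_(z, z' <- D Z) \S_(x, x' <- D (X * Y)) (a (x * z) 1 * v x' z')).
  apply: so_ext => z z'; rewrite cop_mul; last first.
    exact: dia_bim (bim_mulr _ (bim_a _)) (bim_v _).
  apply: so_ext => y y'; apply: so_ext => x x'; congr (_ * _).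
  rewrite -mulrA -tv_tg cop_mul //.
  exact: dia_conv2 cls_v cls_g.
exact: (congr1 (fun F => F (X * Y) Z) conv_T1v).
Qed.


End TwistTheory.

(** * The maps X ∧ n and X ∨ n *)

Section Opposite.
Variables (k : fieldType) (N : algebra k).

Definition alg_op : algebra k.
Proof.
refine (@Algebra k (alg_space N) (@AlgebraOn k (alg_space N)
  (fun x y : N => (y * x : N)) (1 : N) _ _ _ _ _ _ _)).
- by move=> x y z; rewrite mulrA.
- by move=> x; exact: (mulr1 (x : N)).
- by move=> x; exact: (mul1r (x : N)).
- by move=> x y z; exact: (mulrDr (z : N)).
- by move=> x y z; exact: (mulrDl _ _ (x : N)).
- by move=> c u v; exact: (alg_scalerAr c (v : N) u).
- by move=> c u v; exact: (alg_scalerAl c (v : N) u).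
Defined.

End Opposite.

Section TwistOpposite.
Variables (k : fieldType) (H N : algebra k) (B : Type) (S : hopf_calculus H B).
Variable T : twist N S.

(* The inverse cocycle, over the opposite algebra and for the co-opposite
   Hopf algebroid. *)
Definition twist_op : twist (alg_op N) (coopp S).
Proof.
refine (@Twist k H (alg_op N) B (coopp S) (ta T) (tv T) (tg T) (tb T)
  _ _ _ _ _ _ _ _ _ _ _ _ _ _ _ _ _ _ _ _ _ _).
- exact: (ta_lin T).
- exact: (tv_lin T).
- exact: (tg_lin T).
- exact: (ta_t T).
- exact: (ta_s T).
- exact: (ta_unit T).
- exact: (ta_1 T).
- by move=> X m n; exact: (ta_mul T X n m).
- exact: (tv_t T).
- exact: (tv_s T).
- exact: (tv_bal T).
- exact: (tv_X1 T).
- exact: (tv_1X T).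
- exact: (tv_tgt T).
- exact: (tg_t T).
- exact: (tg_s T).
- exact: (tg_bal T).
- exact: (tg_src T).
- exact: (tg_tv T).
- exact: (tv_tg T).
- by move=> X Y Z; exact: (congr1 (fun F => F Z X Y) (tv_cocycle T)).
- by move=> X Y n; exact: (esym (congr1 (fun F => F X Y) (tv_actE T n))).
Defined.

End TwistOpposite.

Section Wedge.
Variables (k : fieldType) (H N : algebra k) (B : Type) (S : hopf_calculus H B).
Variable T : twist N S.
Local Notation s := (hs S).
Local Notation t := (ht S).
Local Notation D := (cop S).
Local Notation a := (ta T).
Local Notation g := (tg T).
Local Notation v := (tv T).
Local Notation i := (tb T).
Implicit Types (X Y Z : H) (m n : N).

(* In lemma names, these are om, nu, up and dn. *)
Definition twist_wedge1 X : N := \S_(x, y <- tr S X) g x y.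
Definition twist_vee1 X : N := \S_(x, y <- trb S X) v x y.
Definition twist_wedge X n : N := \S_(x, y <- D X) (a x n * twist_wedge1 y).
Definition twist_vee X n : N := \S_(x, y <- D X) (twist_vee1 x * a y n).

Lemma obal_g : obalanced t g.
Proof. by bal; rewrite tg_bal. Qed.

Lemma om_lin : lin twist_wedge1.
Proof. exact: tr_lin obal_g. Qed.

Lemma om_s b X : twist_wedge1 (s b * X) = i b * twist_wedge1 X.
Proof.
rewrite /twist_wedge1 (tr_s _ _ obal_g) so_mulrr.
by apply: so_ext => x y; rewrite tg_s.
Qed.

Lemma dia_up n : dbalanced s t (fun x y => a x n * twist_wedge1 y).
Proof.
split; first by split=> ?; [bal | apply/lin_mulr/om_lin].
by move=> b x y; rewrite ta_t om_s mulrA.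
Qed.

(** The element s(b) that reaches X_- leaves σ as X_+(1) ▷ b, which [tr_copl] gathers as X_(1) ▷ b.
    This rule balances sums over X_+ ⊗ X_- in which ∧ is applied to X_+. *)
Lemma om_tr b X : twist_wedge1 (X * t b) = twist_wedge X (i b).
Proof.
rewrite /twist_wedge1 (tr_tr _ _ obal_g) /twist_wedge.
under so_ext => x y do rewrite tg_src.
rewrite (tr_copl (f := fun x y z => a x (i b) * g y z)).
- by apply: so_ext => x y; rewrite -so_mulrr.
- by bal.
- by move=> *; rewrite ta_t tg_s mulrA.
- by move=> *; rewrite tg_bal.
Qed.

Lemma up_lin : bilin twist_wedge.
Proof.
split=> [n|X]; first exact: cop_lin (dia_up n).
by rewrite /twist_wedge; bal.
Qed.

Lemma up_s b X n : twist_wedge (s b * X) n = i b * twist_wedge X n.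
Proof.
rewrite /twist_wedge (cop_s _ _ (dia_up n)) so_mulrr.
by apply: so_ext => x y; rewrite ta_s mulrA.
Qed.

Lemma up_mul X m n : twist_wedge X (m * n) = \S_(x, y <- D X) (a x m * twist_wedge y n).
Proof.
rewrite /twist_wedge; under so_ext => x y do rewrite ta_mul so_mulrl.
rewrite (copA (f := fun x y z => a x m * a y n * twist_wedge1 z)).
- apply: so_ext => x y; rewrite so_mulrr.
  by apply: so_ext => *; rewrite mulrA.
- by split=> ? ?; [bal | bal | apply/lin_mulr/om_lin].
- by move=> *; rewrite ta_t ta_s !mulrA.
- by move=> *; rewrite ta_t om_s !mulrA.
Qed.

Lemma up_tr b X n : twist_wedge (X * t b) n = twist_wedge X (n * i b).
Proof.
rewrite up_mul /twist_wedge (cop_tr _ _ (dia_up n)).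
by apply: so_ext => x y; rewrite om_tr.
Qed.

Lemma up_1 X : twist_wedge X 1 = twist_wedge1 X.
Proof.
rewrite /twist_wedge -[RHS](cop_epl S X om_lin); apply: so_ext => x y.
by rewrite om_s ta_unit.
Qed.

End Wedge.

Lemma tv_tg_mul (k : fieldType) (H N : algebra k) (B : Type)
    (S : hopf_calculus H B) (T : twist N S) X Y Z :
  \S_(z, z' <- cop S Z) \S_(y, y' <- cop S Y) \S_(x, x' <- cop S X)
    (tg T x (y * z) * tv T (x' * y') z') =
  \S_(y, y' <- cop S Y) \S_(x, x' <- cop S X) (ta T x (tv T y Z) * tg T x' y').
Proof. exact: (congr1 (fun F => F Z X Y) (tv_tg_cocycle T)). Qed.

Section VeeRules.
Variables (k : fieldType) (H N : algebra k) (B : Type) (S : hopf_calculus H B).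
Variable T : twist N S.
Local Notation s := (hs S).
Local Notation t := (ht S).
Local Notation i := (tb T).

(** From here to [dn_1], each rule for ∨ is the rule for ∧ of [twist_op], up to conversion. *)
Lemma nu_lin : lin (twist_vee1 T).
Proof. exact: (om_lin (twist_op T)). Qed.

Lemma nu_t b X : twist_vee1 T (t b * X) = twist_vee1 T X * i b.
Proof. exact: (om_s (twist_op T)). Qed.

Lemma nu_sr b X : twist_vee1 T (X * s b) = twist_vee T X (i b).
Proof. exact: (om_tr (twist_op T)). Qed.

Lemma dn_lin : bilin (twist_vee T).
Proof. exact: (up_lin (twist_op T)). Qed.

Lemma dn_t b X n : twist_vee T (t b * X) n = twist_vee T X n * i b.
Proof. exact: (up_s (twist_op T)). Qed.

Lemma dn_mul X m n : twist_vee T X (m * n) = \S_(x, y <- cop S X) (twist_vee T x m * ta T y n).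
Proof. exact: (up_mul (twist_op T) X n m). Qed.

Lemma dn_sr b X n : twist_vee T (X * s b) n = twist_vee T X (i b * n).
Proof. exact: (up_tr (twist_op T)). Qed.

Lemma dn_1 X : twist_vee T X 1 = twist_vee1 T X.
Proof. exact: (up_1 (twist_op T)). Qed.

End VeeRules.

Ltac lin_wedge :=
  match goal with
  | |- lin (fun x => twist_wedge1 ?T (@?E x)) => refine (lin_ap (om_lin T) _)
  | |- lin (fun x => twist_vee1 ?T (@?E x)) => refine (lin_ap (nu_lin T) _)
  | |- lin (fun x => twist_wedge ?T (@?E x) ?n) => refine (lin_ap ((up_lin T).1 n) _)
  | |- lin (fun x => twist_wedge ?T ?X (@?E x)) => refine (lin_ap ((up_lin T).2 X) _)
  | |- lin (fun x => twist_vee ?T (@?E x) ?n) => refine (lin_ap ((dn_lin T).1 n) _)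
  | |- lin (fun x => twist_vee ?T ?X (@?E x)) => refine (lin_ap ((dn_lin T).2 X) _)
  end.

Ltac lin_op ::= first [lin_meas | lin_twist | lin_wedge].

Section WedgeTranslation.
Variables (k : fieldType) (H N : algebra k) (B : Type) (S : hopf_calculus H B).
Variable T : twist N S.
Local Notation t := (ht S).
Local Notation D := (cop S).
Local Notation P := (tr S).
Local Notation a := (ta T).
Local Notation g := (tg T).
Local Notation v := (tv T).
Local Notation om := (twist_wedge1 T).
Local Notation nu := (twist_vee1 T).
Local Notation up := (twist_wedge T).
Local Notation dn := (twist_vee T).
Local Notation cls := (conv_class (twist_bmeas T)).
Implicit Types (X Y Z : H) (m n : N).

(** Trades X_+(2) ∧ 1 for a factor σ(X_+(2), X_-(2)), so that the sum becomes the convolution of F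
    with σ at X_+, X_- and the laws of σ apply. *)
Lemma tr_om p (F : H -> H -> N) X : cls p true F ->
  \S_(x, y <- P X) \S_(x1, x2 <- D x) (F x1 y * om x2) =
  \S_(x, y <- P X) \S_(y1, y2 <- D y) \S_(x1, x2 <- D x) (F x1 y1 * g x2 y2).
Proof.
move=> cF; have dF y w := dia_conv y w cF (cls_g T).
rewrite (tr_copr (f := fun x y z => \S_(x1, x2 <- D x) (F x1 y * g x2 z))).
- apply: so_ext => x y.
  transitivity (\S_(x1, x2 <- D x) \S_(u, w <- P x2) (F x1 y * g u w)).
    by apply: so_ext => x1 x2; rewrite -so_mulrr.
  rewrite -(tr_copl (f := fun u u' w => F u y * g u' w)) //; first by balc.
  - by move=> *; rewrite (cls_t cF) tg_s mulrA.
  - by move=> *; rewrite tg_bal.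
- by balc.
- move=> b x y z; rewrite (cop_tr _ _ (dF _ _)).
  by apply: so_ext => *; rewrite tg_bal.
- by move=> b x y z; apply: (conv_bal _ _ _ _ cF (cls_g T)).
Qed.

(** By [tg_act] the sum is σ(X_+(1), X_-(1)) (X_+(2) X_-(2) ▷ n), and X_+(2) X_-(2) collapses to
    1. *)
Lemma tr_up_act X n : \S_(x, y <- P X) up x (a y n) = om X * n.
Proof.
rewrite /up (tr_om _ (cls_act (bim_a T n))).
under so_ext => x y do rewrite -tg_act so_swap.
rewrite (tr_cop_mul (f := fun x y z => g x y * a z n)).
- rewrite /om so_mulrl; apply: so_ext => x y.
  by rewrite ta_1.
- by balc.
- by move=> *; rewrite tg_t ta_s mulrA.
- by move=> *; rewrite tg_bal.
Qed.

(** The collapse of [tr_up_act], with the mixed identity [tv_tg_mul] in place of [tg_act]; what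
    remains of σ^-1 is σ^-1(1, Z_(2)), a counit. *)
Lemma tr_up_tv X Z : \S_(x, y <- P X) up x (v y Z) = \S_(x, y <- P X) g x (y * Z).
Proof.
have og Z' : obalanced t (fun x y => g x (y * Z')).
  by bal; rewrite tg_bal mulrA.
rewrite /up (tr_om _ (cls_act (bim_v T Z))).
under so_ext => x y do rewrite -tv_tg_mul.
rewrite so_swap.
transitivity (\S_(z, z' <- D Z) \S_(x, y <- P X) (g x (y * (t (hep S z') * z)))).
  apply: so_ext => z z'; under so_ext => x y do rewrite so_swap.
  rewrite (tr_cop_mul (f := fun x y w => g x (y * z) * v w z')).
  - transitivity (\S_(x, y <- P X) g (t (hep S z') * x) (y * z)).
      by apply: so_ext => x y; rewrite tg_t tv_1X ta_unit.
    by rewrite (tr_tak _ _ (og z)); apply: so_ext => x y; rewrite mulrA.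
  - by balc.
  - by move=> *; rewrite tg_t tv_s mulrA.
  - by move=> *; rewrite tg_bal mulrA.
rewrite so_swap; apply: so_ext => x y.
by rewrite (cop_epr S (f := fun z => g x (y * z))) //; bal.
Qed.

(** X_- ∨ 1 involves the other translation map. [tr_trb] trades X_-[+] ⊗ X_-[-] for X_(1)- ⊗ X_(2),
    after which [tr_up_tv] and [copK] leave σ(X, 1). *)
Lemma tr_up_nu X : \S_(x, y <- P X) up x (nu y) = a X 1.
Proof.
under so_ext => x y do rewrite (so_lin _ _ ((up_lin T).2 x)).
rewrite (tr_trb (f := fun x y z => up x (v y z))).
- under so_ext => x x' do rewrite tr_up_tv.
  by rewrite copK ?tg_X1 //; apply: obal_g.
- by balc.
- by move=> *; rewrite up_tr tv_t.
- by move=> *; rewrite tv_bal.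
Qed.

(** The factor n is split off: [tr_copr] and [up_mul] isolate a sum of the form X_+ ∧ (X_- ▷ n),
    which [tr_up_act] evaluates, and the rest is the case n = 1. *)
Lemma tr_up_dn X n : \S_(x, y <- P X) up x (dn y n) = a X 1 * n.
Proof.
under so_ext => x y do rewrite (so_lin _ _ ((up_lin T).2 x)).
rewrite (tr_copr (f := fun x y z => up x (nu y * a z n))); first last.
- by move=> *; rewrite nu_t ta_s mulrA.
- by move=> *; rewrite up_tr ta_t mulrA.
- by balc.
rewrite -tr_up_nu so_mulrl; apply: so_ext => x y.
under so_ext => u w do rewrite up_mul.
rewrite (tr_copl (f := fun x z w => a x (nu y) * up z (a w n))); first last.
- by move=> *; rewrite up_tr ta_t.
- by move=> *; rewrite ta_t up_s mulrA.
- by balc.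
rewrite {2}/up so_mulrl; apply: so_ext => x1 x2.
by rewrite -so_mulrr tr_up_act mulrA.
Qed.

End WedgeTranslation.

(** * Both composites with the Galois maps, tested on balanced maps *)

Section Galois.
Variables (k : fieldType) (H N : algebra k) (B : Type) (S : hopf_calculus H B).
Variable T : twist N S.
Local Notation s := (hs S).
Local Notation t := (ht S).
Local Notation D := (cop S).
Local Notation P := (tr S).
Local Notation Q := (trb S).
Local Notation a := (ta T).
Local Notation i := (tb T).
Local Notation om := (twist_wedge1 T).
Local Notation nu := (twist_vee1 T).
Local Notation up := (twist_wedge T).
Local Notation dn := (twist_vee T).
Implicit Types (X Y Z : H) (m n : N).

Lemma trb_dn_act X n : \S_(x, y <- Q X) dn x (a y n) = n * nu X.
Proof. exact: (tr_up_act (twist_op T) X n). Qed.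

Variable W : lmodType k.

Lemma galois_surj (f : H -> N -> W) X n : bilin f ->
  (forall b x m, f (t b * x) m = f x (i b * m)) ->
  \S_(x, y <- P X) \S_(x1, x2 <- D x) f x1 (up x2 (dn y n)) = f X n.
Proof.
move=> fl fb; rewrite (tr_copl (f := fun x y z => f x (up y (dn z n)))).
- under so_ext => x y do rewrite -(so_lin _ _ (fl.2 x)) tr_up_dn ta_unit -fb.
  by rewrite (cop_epr S (f := fun x => f x n)) //; bal.
- by balc.
- by move=> *; rewrite fb up_s.
- by move=> *; rewrite up_tr dn_t.
Qed.

Section Injectivity.
(** [N0] stands for the copy of the base inside a square zero extension by L. The maps [f] in view
    are balanced over that base alone, in the sense of [f_mul], while their last argument runs over
    the extension. *)
Variables (N0 : N -> Prop) (f : H -> N -> N -> W).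
Hypothesis N0_base : forall b, N0 (i b).
Hypothesis N0_act : forall X m, N0 m -> N0 (a X m).
Hypothesis N0_nu : forall X, N0 (nu X).
Hypothesis fl : trilin f.
Hypothesis fb : forall b X m n, f (t b * X) m n = f X (i b * m) n.
Hypothesis f_mul : forall X m n n', N0 n' ->
  f X m (n * n') = \S_(x, y <- D X) f x (a y n' * m) n.

Let dia_f m n : dbalanced s t (fun x x' => f x (om x' * m) n).
Proof. by balc; rewrite fb om_s mulrA. Qed.

Lemma f_om_mul X m n n' : N0 n' ->
  \S_(x, x' <- D X) f x (om x' * m) (n * n') =
  \S_(x, x' <- D X) f x (up x' n' * m) n.
Proof.
move=> n'0; under so_ext => x x' do rewrite f_mul //.
rewrite (copA (f := fun x y z => f x (a y n' * (om z * m)) n)).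
- have fr x : lin (fun u : N => f x (u * m) n) by bal.
  apply: so_ext => x x'; rewrite /up (so_lin _ _ (fr x)).
  by apply: so_ext => y z; rewrite mulrA.
- by balc.
- by move=> *; rewrite fb ta_s mulrA.
- by move=> *; rewrite ta_t om_s !mulrA.
Qed.

(** Moves m out of the argument of ∨: X_- ∨ (w m) = (X_-(1) ∨ w) (X_-(2) ▷ m), the second factor
    crosses by [f_mul], and X_+(2) ∧ (X_-(2) ▷ m) sums to (X_+(2) ∧ 1) m by [tr_up_act]. *)
Lemma tr_f_mul X m n w : N0 m ->
  \S_(x, y <- P X) \S_(x1, x2 <- D x) f x1 (om x2) (dn y (w * m)) =
  \S_(x, y <- P X) \S_(x1, x2 <- D x) f x1 (om x2 * m) (dn y w).
Proof.
move=> m0.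
transitivity (\S_(x, y <- P X) \S_(y1, y2 <- D y) \S_(x1, x2 <- D x)
    f x1 (up x2 (a y2 m)) (dn y1 w)).
  apply: so_ext => x y.
  transitivity (\S_(x1, x2 <- D x) \S_(y1, y2 <- D y)
      f x1 (om x2 * 1) (dn y1 w * a y2 m)).
    have fr x1 x2 : lin (f x1 (om x2 * 1)) by bal.
    apply: so_ext => x1 x2; rewrite dn_mul -[in LHS](mulr1 (om x2)).
    exact: (so_lin _ _ (fr x1 x2)).
  rewrite so_swap; apply: so_ext => y1 y2.
  rewrite f_om_mul; last exact: N0_act.
  by apply: so_ext => x1 x2; rewrite mulr1.
rewrite (tr_copr (f := fun x y z =>
    \S_(x1, x2 <- D x) f x1 (up x2 (a z m)) (dn y w))).
- apply: so_ext => x y.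
  rewrite (tr_copl (f := fun x1 x2 z => f x1 (up x2 (a z m)) (dn y w))).
  + have fr x1 : lin (fun u : N => f x1 u (dn y w)) by bal.
    by apply: so_ext => x1 x2; rewrite -(so_lin _ _ (fr x1)) tr_up_act.
  + by balc.
  + by move=> *; rewrite fb up_s.
  + by move=> *; rewrite up_tr ta_t.
- balc.
- by rewrite fb up_s.
- move=> b x y z; rewrite cop_tr; last by balc; rewrite fb up_s.
  by apply: so_ext => x1 x2; rewrite up_tr ta_t.
- move=> b x y z.
  transitivity (\S_(x1, x2 <- D x) \S_(u, u' <- D x2)
      f x1 (a u (i b) * up u' (a z m)) (dn y w)).
    rewrite -(copA (f := fun x1 u u' => f x1 (a u (i b) * up u' (a z m)) (dn y w))).
    + by apply: so_ext => x1 x2; rewrite dn_t f_mul.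
    + by balc.
    + by move=> *; rewrite fb ta_s mulrA.
    + by move=> *; rewrite ta_t up_s mulrA.
  have fr x1 : lin (fun u : N => f x1 u (dn y w)) by bal.
  by apply: so_ext => x1 x2; rewrite ta_s up_mul (so_lin _ _ (fr x1)).
Qed.

(** With m moved away, [tr_trb] read backwards turns X_(1)- ∨ (X_(2) ▷ n) into X_-[+] ∨ (X_-[-] ▷
    n), which is n (X_- ∨ 1). The factor X_- ∨ 1 crosses by [f_mul], and X_+(2) ∧ (X_- ∨ 1) sums to
    a counit by [tr_up_nu]. *)
Lemma galois_inj X m n : N0 m ->
  \S_(x, x' <- D X) \S_(y, z <- P x) \S_(y1, y2 <- D y)
    f y1 (om y2) (dn z (a x' n * m)) = f X m n.
Proof.
move=> m0; under so_ext => x x' do rewrite tr_f_mul //.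
rewrite -(tr_trb (f := fun x y z => \S_(x1, x2 <- D x) f x1 (om x2 * m) (dn y (a z n)))).
- transitivity (\S_(x, y <- P X) \S_(x1, x2 <- D x) f x1 (om x2 * m) (n * nu y)).
    apply: so_ext => x y; rewrite so_swap; apply: so_ext => x1 x2.
    have fr : lin (f x1 (om x2 * m)) by bal.
    by rewrite -(so_lin _ _ fr) trb_dn_act.
  under so_ext => x y do rewrite f_om_mul //.
  rewrite (tr_copl (f := fun x1 x2 y => f x1 (up x2 (nu y) * m) n)).
  + transitivity (\S_(x, x' <- D X) f (t (hep S x') * x) m n).
      apply: so_ext => x x'; have fr : lin (fun u : N => f x (u * m) n) by bal.
      by rewrite -(so_lin _ _ fr) tr_up_nu ta_unit fb.
    by rewrite (cop_epr S (f := fun x => f x m n)) //; bal.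
  + by balc.
  + by move=> *; rewrite fb up_s mulrA.
  + by move=> *; rewrite up_tr nu_t.
- balc; exact: (dia_f _ _).2.
- move=> b x y z; rewrite (cop_tr _ _ (dia_f _ _)).
  transitivity (\S_(x1, x2 <- D x) f x1 (up x2 (i b) * m) (dn y (a z n))).
    by apply: so_ext => x1 x2; rewrite om_tr.
  by rewrite -f_om_mul //; apply: so_ext => x1 x2; rewrite dn_t.
- by move=> b x y z; apply: so_ext => x1 x2; rewrite dn_sr ta_s.
Qed.

End Injectivity.

End Galois.

(** * Twisted modules *)

Section SquareZero.
Variables (k : fieldType) (N : algebra k) (L : lmodType k).

Record bimodule := Bimodule {
  bml : N -> L -> L;
  bmr : L -> N -> L;
  bml_lin : bilin bml;
  bmr_lin : bilin bmr;
  nlA : forall m n u, bml m (bml n u) = bml (m * n) u;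
  nrA : forall m n u, bmr (bmr u m) n = bmr u (m * n);
  nlr : forall m n u, bml m (bmr u n) = bmr (bml m u) n;
  nl1 : forall u, bml 1 u = u;
  nr1 : forall u, bmr u 1 = u
}.

Variable M : bimodule.
Local Notation nl := (bml M).
Local Notation nr := (bmr M).

Let nll x u v : nl x (u + v) = nl x u + nl x v := linD ((bml_lin M).2 x) u v.
Let nlr' u x y : nl (x + y) u = nl x u + nl y u := linD ((bml_lin M).1 u) x y.
Let nrl x u v : nr (u + v) x = nr u x + nr v x := linD ((bmr_lin M).1 x) u v.
Let nrr u x y : nr u (x + y) = nr u x + nr u y := linD ((bmr_lin M).2 u) x y.

Definition sqz_mul (x y : (N * L)%type) : (N * L)%type :=
  (x.1 * y.1, nl x.1 y.2 + nr x.2 y.1).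

(* The square zero extension of N by L. A twisted module is a cocycle over it, so
   identities for elements of N also hold for those of L. *)
Definition sqz : algebra k.
Proof.
refine (@Algebra k (N * L)%type (@AlgebraOn k (N * L)%type sqz_mul (1, 0)
  _ _ _ _ _ _ _)); rewrite /sqz_mul.
- move=> x y z /=; rewrite mulrA nll nrl nlA nrA nlr addrA //.
- by case=> x u; rewrite /= mul1r nl1 (lin0 ((bmr_lin M).1 x)) addr0.
- by case=> x u; rewrite /= mulr1 nr1 (lin0 ((bml_lin M).2 x)) add0r.
- move=> x y z; congr pair; first exact: mulrDl.
  by rewrite /= nlr' nrl addrACA.
- move=> x y z; congr pair; first exact: mulrDr.
  by rewrite /= nll nrr addrACA.
- move=> c x y; congr pair; first exact: alg_scalerAl.
  by rewrite /= (linZ ((bml_lin M).1 _)) (linZ ((bmr_lin M).1 _)) scalerDr.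
- move=> c x y; congr pair; first exact: alg_scalerAr.
  by rewrite /= (linZ ((bml_lin M).2 _)) (linZ ((bmr_lin M).2 _)) scalerDr.
Defined.

Definition inN (n : N) : sqz := ((n, 0 : L) : (N * L)%type).
Definition inL (u : L) : sqz := ((0 : N, u) : (N * L)%type).
Definition prN (x : sqz) : N := (x : (N * L)%type).1.
Definition prL (x : sqz) : L := (x : (N * L)%type).2.

Lemma inN_lin : lin inN.
Proof. by move=> c x y; congr pair; rewrite /= scaler0 addr0. Qed.

Lemma inL_lin : lin inL.
Proof. by move=> c x y; congr pair; rewrite /= scaler0 addr0. Qed.

Lemma prN_lin : lin prN. Proof. by []. Qed.
Lemma prL_lin : lin prL. Proof. by []. Qed.

Lemma inNM m n : inN (m * n) = inN m * inN n.
Proof.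
congr pair; rewrite /= (lin0 ((bml_lin M).2 m)) (lin0 ((bmr_lin M).1 n)).
by rewrite addr0.
Qed.

Lemma inN_inL n u : inN n * inL u = inL (nl n u).
Proof.
by congr pair; [exact: mulr0 | rewrite /= (lin0 ((bmr_lin M).1 0)) addr0].
Qed.

Lemma inL_inN n u : inL u * inN n = inL (nr u n).
Proof.
by congr pair; [exact: mul0r | rewrite /= (lin0 ((bml_lin M).1 0)) add0r].
Qed.

Lemma prLM x y : prL (x * y) = nl (prN x) (prL y) + nr (prL x) (prN y).
Proof. by []. Qed.

Lemma prNM x y : prN (x * y) = prN x * prN y.
Proof. by []. Qed.

Lemma prL_inN n x : prL (inN n * x) = nl n (prL x).
Proof. by rewrite prLM (lin0 ((bmr_lin M).1 _)) addr0. Qed.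

Lemma prL_inNr n x : prL (x * inN n) = nr (prL x) n.
Proof. by rewrite prLM (lin0 ((bml_lin M).2 _)) add0r. Qed.

Lemma sqzP (x y : sqz) : prN x = prN y -> prL x = prL y -> x = y.
Proof. by case: x y => [x u] [y w] /= -> ->. Qed.

End SquareZero.

Section TwistedModule.
Variables (k : fieldType) (H N : algebra k) (B : Type) (S : hopf_calculus H B).
Variables (T : twist N S) (L : lmodType k).
Local Notation s := (hs S).
Local Notation t := (ht S).
Local Notation D := (cop S).
Local Notation a := (ta T).
Local Notation g := (tg T).
Local Notation v := (tv T).
Local Notation i := (tb T).

(* va_g says that X ▶ (Y ▶ u) is X Y ▶ u conjugated by σ. *)
Record tmod := Tmod {
  tm_bimod :> bimodule N L;
  tva : H -> L -> L;
  tva_lin : bilin tva;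
  va_s : forall b X u, tva (s b * X) u = bml tm_bimod (i b) (tva X u);
  va_t : forall b X u, tva (t b * X) u = bmr tm_bimod (tva X u) (i b);
  va_1 : forall u, tva 1 u = u;
  va_l : forall X n u, tva X (bml tm_bimod n u) =
    \S_(x, y <- D X) bml tm_bimod (a x n) (tva y u);
  va_r : forall X n u, tva X (bmr tm_bimod u n) =
    \S_(x, y <- D X) bmr tm_bimod (tva x u) (a y n);
  va_g : forall X Y u, \S_(y, y' <- D Y) \S_(x, x' <- D X)
      bml tm_bimod (g x y) (tva (x' * y') u) =
    \S_(y, y' <- D Y) \S_(x, x' <- D X) bmr tm_bimod (tva x (tva y u)) (g x' y')
}.

Variable M : tmod.
Local Notation E := (sqz M).
Local Notation nl := (bml M).
Local Notation nr := (bmr M).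
Local Notation va := (tva M).

Definition sqz_act X (x : E) : E := ((a X (prN x), va X (prL x)) : (N * L)%type).

Lemma so_prN (K : Type) (r : sumop k K) (f : K -> K -> E) :
  prN (\S_(x, y <- r) f x y) = \S_(x, y <- r) prN (f x y).
Proof. exact: so_lin (@prN_lin k N L M). Qed.

Lemma so_prL (K : Type) (r : sumop k K) (f : K -> K -> E) :
  prL (\S_(x, y <- r) f x y) = \S_(x, y <- r) prL (f x y).
Proof. exact: so_lin (@prL_lin k N L M). Qed.

Lemma so_prN2 (K K' : Type) (r : sumop k K) (r' : sumop k K')
    (f : K -> K -> K' -> K' -> E) :
  prN (\S_(x, y <- r) \S_(z, w <- r') f x y z w) =
  \S_(x, y <- r) \S_(z, w <- r') prN (f x y z w).
Proof. by rewrite so_prN; apply: so_ext => x y; rewrite so_prN. Qed.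

Lemma so_prL2 (K K' : Type) (r : sumop k K) (r' : sumop k K')
    (f : K -> K -> K' -> K' -> E) :
  prL (\S_(x, y <- r) \S_(z, w <- r') f x y z w) =
  \S_(x, y <- r) \S_(z, w <- r') prL (f x y z w).
Proof. by rewrite so_prL; apply: so_ext => x y; rewrite so_prL. Qed.

Lemma so_inN (K : Type) (r : sumop k K) (f : K -> K -> N) :
  inN M (\S_(x, y <- r) f x y) = \S_(x, y <- r) inN M (f x y).
Proof. exact: so_lin (@inN_lin k N L M). Qed.

Let sum0 (r : sumop k H) : (\S_(x, y <- r) (0 : L)) = 0.
Proof. by have [u ->] := so_repr r; rewrite big1. Qed.

Let va0 X : va X 0 = 0 := lin0 ((tva_lin M).2 X).

(** σ and σ^-1 take values in N, so their own axioms have no L-component; the L-components of the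
    axioms for ▷ and of [tg_act] are the axioms of a twisted module. *)
Definition sqz_twist : twist E S.
Proof.
refine (@Twist k H E B S sqz_act (fun X Y => inN M (g X Y))
  (fun X Y => inN M (v X Y)) (fun b => inN M (i b))
  _ _ _ _ _ _ _ _ _ _ _ _ _ _ _ _ _ _ _ _ _ _); rewrite /sqz_act.
- by split=> [x|X] c u w; congr pair;
    [exact: (ta_lin T).1|exact: (tva_lin M).1|exact: (ta_lin T).2|exact: (tva_lin M).2].
- by split=> [x|X] c u w; rewrite -inN_lin; congr (inN M _);
    [exact: (tg_lin T).1|exact: (tg_lin T).2].
- by split=> [x|X] c u w; rewrite -inN_lin; congr (inN M _);
    [exact: (tv_lin T).1|exact: (tv_lin T).2].
- move=> b X x; apply: sqzP; first exact: ta_s.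
  by rewrite prLM /= va_s (lin0 ((bmr_lin M).1 _)) addr0.
- move=> b X x; apply: sqzP; first exact: ta_t.
  by rewrite prLM /= va_t (lin0 ((bml_lin M).2 _)) add0r.
- by move=> X; apply: sqzP; [exact: ta_unit | exact: va0].
- by move=> x; apply: sqzP; [exact: ta_1 | exact: va_1].
- move=> X x y; apply: sqzP; first by rewrite so_prN; apply: ta_mul.
  rewrite so_prL /= (linD ((tva_lin M).2 X)) va_l va_r.
  by have [u uE] := so_repr (D X); rewrite !uE -big_split.
- by move=> b X Y; rewrite tg_s inNM.
- by move=> b X Y; rewrite tg_t inNM.
- by move=> b X Y; rewrite tg_bal.
- by move=> X; apply: sqzP; [exact: tg_X1 | rewrite /= va0].
- by move=> X; apply: sqzP; [exact: tg_1X | rewrite /= va0].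
- move=> b X Y; rewrite tg_src so_inN; apply: so_ext => x x'.
  by rewrite inNM; congr (_ * _); rewrite /inN /= va0.
- by move=> b X Y; rewrite tv_s inNM.
- by move=> b X Y; rewrite tv_t inNM.
- by move=> b X Y; rewrite tv_bal.
- move=> b X Y; rewrite tv_tgt so_inN; apply: so_ext => x x'.
  by rewrite inNM; congr (_ * _); rewrite /inN /= va0.
- move=> X Y; apply: sqzP; last first.
    rewrite so_prL /= va0 va0 -[RHS](sum0 (D Y)); apply: so_ext => y y'.
    rewrite so_prL -[RHS](sum0 (D X)); apply: so_ext => x x'.
    by rewrite -inNM.
  rewrite so_prN -[RHS]tg_tv; apply: so_ext => y y'.
  by rewrite so_prN.
- move=> X Y; apply: sqzP; last first.
    rewrite so_prL /= va0 -[RHS](sum0 (D Y)); apply: so_ext => y y'.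
    rewrite so_prL -[RHS](sum0 (D X)); apply: so_ext => x x'.
    by rewrite -inNM.
  rewrite so_prN -[RHS]tv_tg; apply: so_ext => y y'.
  by rewrite so_prN.
- move=> X Y Z; transitivity (inN M (\S_(y, y' <- D Y) \S_(x, x' <- D X)
      (g x y * g (x' * y') Z))).
    rewrite -tg_cocycle so_inN; apply: so_ext => z z'.
    rewrite so_inN; apply: so_ext => y y'; rewrite so_inN; apply: so_ext => x x'.
    by rewrite inNM; congr (_ * _); rewrite /inN /= va0.
  rewrite so_inN; apply: so_ext => y y'; rewrite so_inN; apply: so_ext => x x'.
  by rewrite inNM.
- move=> X Y x; apply: sqzP; first by rewrite !so_prN2; apply: tg_act.
  transitivity (\S_(y, y' <- D Y) \S_(x1, x2 <- D X)
      nl (g x1 y) (va (x2 * y') (prL x))).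
    rewrite so_prL2; apply: so_ext => y y'; apply: so_ext => x1 x2.
    exact: prL_inN.
  rewrite va_g so_prL2; apply: so_ext => y y'; apply: so_ext => x1 x2.
  exact/esym/prL_inNr.
Defined.

Definition tmod_wedge X u := \S_(x, y <- D X) nr (va x u) (twist_wedge1 T y).
Definition tmod_vee X u := \S_(x, y <- D X) nl (twist_vee1 T x) (va y u).

Lemma om_sqz X : twist_wedge1 sqz_twist X = inN M (twist_wedge1 T X).
Proof. by rewrite /twist_wedge1 so_inN. Qed.

Lemma nu_sqz X : twist_vee1 sqz_twist X = inN M (twist_vee1 T X).
Proof. by rewrite /twist_vee1 so_inN. Qed.

Lemma prL_up X x : prL (twist_wedge sqz_twist X x) = tmod_wedge X (prL x).
Proof.
by rewrite so_prL; apply: so_ext => y y'; rewrite om_sqz prL_inNr.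
Qed.

Lemma prL_dn X x : prL (twist_vee sqz_twist X x) = tmod_vee X (prL x).
Proof.
by rewrite so_prL; apply: so_ext => y y'; rewrite nu_sqz prL_inN.
Qed.

End TwistedModule.

Section TwistedModuleGalois.
Variables (k : fieldType) (H N : algebra k) (B : Type) (S : hopf_calculus H B).
Variables (T : twist N S) (L : lmodType k) (M : tmod T L) (W : lmodType k).
Local Notation s := (hs S).
Local Notation t := (ht S).
Local Notation D := (cop S).
Local Notation P := (tr S).
Local Notation Q := (trb S).
Local Notation a := (ta T).
Local Notation i := (tb T).
Local Notation om := (twist_wedge1 T).
Local Notation nu := (twist_vee1 T).
Local Notation E := (sqz M).
Local Notation nl := (bml M).
Local Notation nr := (bmr M).
Local Notation va := (tva M).
Local Notation vup := (tmod_wedge M).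
Local Notation vdn := (tmod_vee M).

Let bilin_prL (f : H -> L -> W) : bilin f -> bilin (fun X (x : E) => f X (prL x)).
Proof.
by move=> fl; split=> [x|X]; [exact: (fl.1 (prL x)) | move=> c x y; exact: (fl.2 X)].
Qed.

Let trilin_pr (f : H -> N -> L -> W) :
  trilin f -> trilin (fun X (m x : E) => f X (prN m) (prL x)).
Proof.
move=> [f1 f2 f3]; split=> x y; [exact: f1 | move=> c m m'; exact: (f2 x (prL y))
  | move=> c u w; exact: (f3 x (prN y))].
Qed.

Lemma vgalois_surj (f : H -> L -> W) X u : bilin f ->
  (forall b x w, f (t b * x) w = f x (nl (i b) w)) ->
  \S_(x, y <- P X) \S_(x1, x2 <- D x) f x1 (vup x2 (vdn y u)) = f X u.
Proof.
move=> /bilin_prL fl fb.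
have := galois_surj (T := sqz_twist M) X (inL M u) fl; rewrite /= => <-.
  by apply: so_ext => x y; apply: so_ext => x1 x2; rewrite prL_up prL_dn.
by move=> b x w; rewrite fb; congr f; exact/esym/prL_inN.
Qed.

Lemma vgaloisb_surj (f : H -> L -> W) X u : bilin f ->
  (forall b x w, f (s b * x) w = f x (nr w (i b))) ->
  \S_(x, y <- Q X) \S_(x1, x2 <- D x) f x2 (vdn x1 (vup y u)) = f X u.
Proof.
move=> /bilin_prL fl fb.
have := galois_surj (T := twist_op (sqz_twist M)) X (inL M u) fl; rewrite /= => <-.
  apply: so_ext => x y; apply: so_ext => x1 x2.
  by congr f; rewrite -[u in LHS]/(prL (inL M u)) -prL_up -prL_dn.
by move=> b x w; rewrite fb; congr f; exact/esym/prL_inNr.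
Qed.

Lemma vgalois_inj (f : H -> N -> L -> W) X m u : trilin f ->
  (forall b x n w, f (t b * x) n w = f x (i b * n) w) ->
  (forall x n w n', f x n (nr w n') = \S_(x1, x2 <- D x) f x1 (a x2 n' * n) w) ->
  \S_(x, x' <- D X) \S_(y, z <- P x) \S_(y1, y2 <- D y)
    f y1 (om y2) (vdn z (nr (va x' u) m)) = f X m u.
Proof.
move=> /trilin_pr fl fb fm.
(* [N0] is the copy of N in the extension, the kernel of [prL]. *)
have := galois_inj (T := sqz_twist M) (N0 := fun x => prL x = 0) _ _ _ fl _ _ X
  (m := inN M m) (inL M u).
move=> /= <- //.
- apply: so_ext => x x'; apply: so_ext => y z; apply: so_ext => y1 y2.
  by rewrite om_sqz prL_dn prL_inNr.
- by move=> Y y ->; apply: (lin0 ((tva_lin M).2 Y)).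
- by move=> Y; rewrite nu_sqz.
- by move=> x n w n' n'0; rewrite [n'.2]n'0 (lin0 ((bml_lin M).2 _)) add0r fm.
Qed.

Lemma vgaloisb_inj (f : H -> N -> L -> W) X m u : trilin f ->
  (forall b x n w, f (s b * x) n w = f x (n * i b) w) ->
  (forall x n w n', f x n (nl n' w) = \S_(x1, x2 <- D x) f x2 (n * a x1 n') w) ->
  \S_(x', x <- D X) \S_(y, z <- Q x) \S_(y1, y2 <- D y)
    f y2 (nu y1) (vup z (nl m (va x' u))) = f X m u.
Proof.
move=> /trilin_pr fl fb fm.
have := galois_inj (T := twist_op (sqz_twist M)) (N0 := fun x => prL (x : E) = 0)
  _ _ _ fl _ _ X (m := inN M m) (inL M u).
move=> /= <- //.
- apply: so_ext => x x'; apply: so_ext => y z; apply: so_ext => y1 y2.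
  congr f; first exact: (congr1 (@prN _ _ _ M) (esym (nu_sqz M y1))).
  have dn_op z' (e : E) :
      twist_vee (twist_op (sqz_twist M)) z' e = twist_wedge (sqz_twist M) z' e.
    by [].
  rewrite dn_op prL_up; congr vup.
  exact: (esym (prL_inN m (sqz_act x (inL M u)))).
- by move=> Y y ->; apply: (lin0 ((tva_lin M).2 Y)).
- by move=> Y; exact: (congr1 (@prL _ _ _ M) (om_sqz M Y)).
- by move=> x n w n' n'0; rewrite [n'.2]n'0 (lin0 ((bmr_lin M).1 _)) addr0 fm.
Qed.

End TwistedModuleGalois.

(** * Convolution with a parameter, and with values in algebras that receive N *)

Section ParametricConvolution.
Variables (k : fieldType) (H N : algebra k) (B : Type) (S : hopf_calculus H B).
Variable T : bmeas N S.
Local Notation s := (hs S).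
Local Notation t := (ht S).
Local Notation D := (cop S).
Local Notation cls := (conv_class T).
Local Notation conv := (convol S).
Local Notation convz := (convolz S).
Local Notation zbal := (zbalanced S).

Lemma cls_convz p q r (F G : H -> H -> H -> N) Z : (forall z, cls p q (F z)) ->
  (forall z, cls q r (G z)) -> cls p r (convz F G Z).
Proof.
move=> cF cG; have c z z' := cls_conv (cF z) (cG z'); rewrite /convz.
split.
- by split=> ?; apply: lin_so => z z';
  [exact: (cls_lin (c z z')).1 | exact: (cls_lin (c z z')).2].
- by move=> b X Y; rewrite so_mulrr; apply: so_ext => z z'; rewrite (cls_s (c z z')).
- by move=> b X Y; rewrite so_mulrl; apply: so_ext => z z'; rewrite (cls_t (c z z')).
- move=> b X Y; case: p {cF} c => c.
    under [RHS]so_ext => x x' do rewrite so_mulrr.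
    by rewrite so_swap; apply: so_ext => z z'; rewrite (cls_L (c z z')).
  by apply: so_ext => z z'; rewrite (cls_L (c z z')).
- move=> b X Y; case: r {cG} c => c.
    under [RHS]so_ext => x x' do rewrite so_mulrl.
    by rewrite so_swap; apply: so_ext => z z'; rewrite (cls_R (c z z')).
  by apply: so_ext => z z'; rewrite (cls_R (c z z')).
Qed.

(** Multiplicativity of the coproduct: the legs of Y Z are products of legs of Y and of Z. [gQ_th]
    expands a triple convolution at (X, Y Z) in this way. *)
Lemma conv_mulr p q r (F G : H -> H -> N) : cls p q F -> cls q r G ->
  (fun Z X Y => conv F G X (Y * Z)) =
  convz (fun Z X Y => F X (Y * Z)) (fun Z X Y => G X (Y * Z)).
Proof.
move=> cF cG; apply/funext => Z; apply: eq2_fun => X Y.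
by rewrite {1}/conv cop_mul //; apply: dia_conv2 cF cG.
Qed.

Lemma conv_mull p q r (F G : H -> H -> N) : cls p q F -> cls q r G ->
  (fun Z X Y => conv F G (X * Y) Z) =
  convz (fun Z X Y => F (X * Y) Z) (fun Z X Y => G (X * Y) Z).
Proof.
move=> cF cG; apply/funext => Z; apply: eq2_fun => X Y; apply: so_ext => z z'.
by rewrite cop_mul //; apply: dia_conv cF cG.
Qed.

Definition convol1 (f f' : H -> N) X := \S_(x, x' <- D X) (f x * f' x').

Lemma bim_conv1 (f f' : H -> N) : bimod_map T f -> bimod_map T f' -> bimod_map T (convol1 f f').
Proof.
move=> bf bf'; have d := dia_bim bf bf'.
split; first exact: cop_lin d.
- move=> b X; rewrite /convol1 (cop_s _ _ d) so_mulrr; apply: so_ext => x x'.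
  by case: bf => _ -> _; rewrite mulrA.
- move=> b X; rewrite /convol1 (cop_t _ _ d) so_mulrl; apply: so_ext => x x'.
  by case: bf' => _ _ ->; rewrite mulrA.
Qed.

Lemma conv1A (f f' f'' : H -> N) : bimod_map T f -> bimod_map T f' -> bimod_map T f'' ->
  convol1 (convol1 f f') f'' = convol1 f (convol1 f' f'').
Proof.
move=> [fl fs ft] [fl' fs' ft'] [fl'' fs'' ft'']; apply/funext => X.
transitivity (\S_(x, x' <- D X) \S_(x1, x2 <- D x) (f x1 * f' x2 * f'' x')).
  by apply: so_ext => x x'; rewrite so_mulrl.
rewrite (copA (f := fun x y z => f x * f' y * f'' z)).
- apply: so_ext => x x'; rewrite so_mulrr.
  by apply: so_ext => *; rewrite mulrA.
- by bal.
- by move=> *; rewrite ft fs' !mulrA.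
- by move=> *; rewrite ft' fs'' !mulrA.
Qed.

Lemma dia_z (F G : H -> H -> H -> N) X Y : zlinear F -> zlinear G -> zbal F G ->
  dbalanced s t (fun z z' => conv (F z) (G z') X Y).
Proof.
move=> Fl Gl FG; split; last by move=> b z z'; rewrite FG.
by split=> z; [exact: zlin_convl | exact: zlin_convr].
Qed.

Lemma zlin_convz (F G : H -> H -> H -> N) : zlinear F -> zlinear G -> zbal F G ->
  zlinear (convz F G).
Proof. by move=> Fl Gl FG X Y; apply: cop_lin; apply: dia_z. Qed.

Lemma zbal_convzl p q r u (F G K : H -> H -> H -> N) : (forall z, cls p q (F z)) ->
  (forall z, cls q r (G z)) -> (forall z, cls r u (K z)) ->
  zlinear F -> zlinear G -> zbal F G -> zbal G K -> zbal (convz F G) K.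
Proof.
move=> cF cG cK Fl Gl FG GK b z z'.
have -> : convz F G (t b * z) =
    fun X Y => \S_(z1, z2 <- D z) conv (F z1) (G (t b * z2)) X Y.
  by apply: eq2_fun => X Y; rewrite /convz cop_t //; apply: dia_z.
rewrite !conv_suml; apply: eq2_fun => X Y; apply: so_ext => z1 z2.
by rewrite !(convA (cF _) (cG _) (cK _)) GK.
Qed.

Lemma zbal_convzr p q r u (F G K : H -> H -> H -> N) : (forall z, cls p q (F z)) ->
  (forall z, cls q r (G z)) -> (forall z, cls r u (K z)) ->
  zlinear G -> zlinear K -> zbal G K -> zbal F G -> zbal F (convz G K).
Proof.
move=> cF cG cK Gl Kl GK FG b z z'.
have -> : convz G K (s b * z') =
    fun X Y => \S_(z1, z2 <- D z') conv (G (s b * z1)) (K z2) X Y.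
  by apply: eq2_fun => X Y; rewrite /convz cop_s //; apply: dia_z.
rewrite !conv_sumr; apply: eq2_fun => X Y; apply: so_ext => z1 z2.
by rewrite -!(convA (cF _) (cG _) (cK _)) FG.
Qed.

End ParametricConvolution.

Section AlgebraMaps.
Variables (k : fieldType) (H N A : algebra k) (B : Type) (S : hopf_calculus H B).
Variables (T : twist N S) (j : N -> A).
Hypothesis j_lin : lin j.
Hypothesis jM : forall m n, j (m * n) = j m * j n.
Local Notation s := (hs S).
Local Notation t := (ht S).
Local Notation a := (ta T).
Local Notation i := (tb T).
Local Notation conv := (convol S).
Local Notation convz := (convolz S).

Fact map_mt_lin b : lin (fun X => j (a X (i b))).
Proof. exact: (lin_ap j_lin ((ta_lin T).1 _)). Qed.

Fact map_mt_s b X c : j (a (s b * X) (i c)) = j (i b) * j (a X (i c)).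
Proof. by rewrite ta_s jM. Qed.

Fact map_mt_t b X c : j (a (t b * X) (i c)) = j (a X (i c)) * j (i b).
Proof. by rewrite ta_t jM. Qed.

(** With values in a larger algebra, elements of N and of a bimodule become factors of one product,
    and a single associativity of convolution regroups both. *)
Definition map_bmeas : bmeas A S := Bmeas map_mt_lin map_mt_s map_mt_t.

Lemma map_so (K : Type) (r : sumop k K) (f : K -> K -> N) :
  j (\S_(x, y <- r) f x y) = \S_(x, y <- r) j (f x y).
Proof. exact: so_lin j_lin. Qed.

Lemma bim_map (f : H -> N) :
  bimod_map (twist_bmeas T) f -> bimod_map map_bmeas (fun X => j (f X)).
Proof.
case=> fl fs ft; split=> [|b X|b X]; first exact: lin_ap j_lin fl.
  by rewrite fs jM.
by rewrite ft jM.
Qed.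

Lemma cls_map p q (F : H -> H -> N) :
  conv_class (twist_bmeas T) p q F -> conv_class map_bmeas p q (fun X Y => j (F X Y)).
Proof.
case=> [[F1 F2] Fs Ft FL FR]; split.
- by split=> x; apply: (lin_ap j_lin).
- by move=> b X Y; rewrite Fs jM.
- by move=> b X Y; rewrite Ft jM.
- move=> b X Y; rewrite FL; case: p {FL} => //.
  by rewrite map_so; apply: so_ext => x y; rewrite jM.
- move=> b X Y; rewrite FR; case: q {FR} => //.
  by rewrite map_so; apply: so_ext => x y; rewrite jM.
Qed.

Lemma conv_map (F G : H -> H -> N) :
  conv (fun X Y => j (F X Y)) (fun X Y => j (G X Y)) =
  fun X Y => j (conv F G X Y).
Proof.
apply: eq2_fun => X Y; rewrite map_so; apply: so_ext => y y'.
by rewrite map_so; apply: so_ext => x x'; rewrite jM.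
Qed.

Lemma convz_map (F G : H -> H -> H -> N) :
  convz (fun Z X Y => j (F Z X Y)) (fun Z X Y => j (G Z X Y)) =
  fun Z X Y => j (convz F G Z X Y).
Proof.
apply/funext => Z; apply: eq2_fun => X Y; rewrite map_so.
by apply: so_ext => z z'; rewrite conv_map.
Qed.

Lemma conv1_1r (f : H -> A) X :
  bimod_map map_bmeas f -> convol1 S f (fun X => j (a X 1)) X = f X.
Proof.
case=> fl _ ft; rewrite -[RHS](cop_epr S X fl).
by apply: so_ext => x y; rewrite ft ta_unit.
Qed.

Lemma conv1_1l (f : H -> A) X :
  bimod_map map_bmeas f -> convol1 S (fun X => j (a X 1)) f X = f X.
Proof.
case=> fl fs _; rewrite -[RHS](cop_epl S X fl).
by apply: so_ext => x y; rewrite fs ta_unit.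
Qed.

Lemma conv_1r (f : H -> A) : bimod_map map_bmeas f ->
  conv (fun X Y => f (X * Y)) (fun X Y => j (a (X * Y) 1)) = fun X Y => f (X * Y).
Proof.
move=> fb; rewrite (conv_mul fb (bim_map (bim_a T 1))); apply: eq2_fun => X Y.
exact: conv1_1r.
Qed.

Lemma conv_1l (f : H -> A) : bimod_map map_bmeas f ->
  conv (fun X Y => j (a (X * Y) 1)) (fun X Y => f (X * Y)) = fun X Y => f (X * Y).
Proof.
move=> fb; rewrite (conv_mul (bim_map (bim_a T 1)) fb); apply: eq2_fun => X Y.
exact: conv1_1l.
Qed.

End AlgebraMaps.

Section SqzConvolution.
Variables (k : fieldType) (H N : algebra k) (B : Type) (S : hopf_calculus H B).
Variables (T : twist N S) (L : lmodType k) (M : bimodule N L).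
Local Notation iN := (@inN _ _ _ M).
Local Notation iL := (@inL _ _ _ M).

Definition sqz_bmeas : bmeas (sqz M) S :=
  map_bmeas T (@inN_lin _ _ _ M) (@inNM _ _ _ M).

Lemma inN_so (K : Type) (r : sumop k K) (f : K -> K -> N) :
  iN (\S_(x, y <- r) f x y) = \S_(x, y <- r) iN (f x y).
Proof. exact: so_lin (@inN_lin _ _ _ M). Qed.

Lemma inL_so (K : Type) (r : sumop k K) (f : K -> K -> L) :
  iL (\S_(x, y <- r) f x y) = \S_(x, y <- r) iL (f x y).
Proof. exact: so_lin (@inL_lin _ _ _ M). Qed.

Lemma prL_so (K : Type) (r : sumop k K) (f : K -> K -> sqz M) :
  prL (\S_(x, y <- r) f x y) = \S_(x, y <- r) prL (f x y).
Proof. exact: so_lin (@prL_lin _ _ _ M). Qed.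

Lemma cls_inN p q (F : H -> H -> N) : conv_class (twist_bmeas T) p q F ->
  conv_class sqz_bmeas p q (fun X Y => iN (F X Y)).
Proof. exact: cls_map. Qed.

Lemma conv_inN (F G : H -> H -> N) :
  convol S (fun X Y => iN (F X Y)) (fun X Y => iN (G X Y)) =
  fun X Y => iN (convol S F G X Y).
Proof. exact: conv_map (@inN_lin _ _ _ M) (@inNM _ _ _ M) F G. Qed.

Lemma convz_inN (F G : H -> H -> H -> N) :
  convolz S (fun Z X Y => iN (F Z X Y)) (fun Z X Y => iN (G Z X Y)) =
  fun Z X Y => iN (convolz S F G Z X Y).
Proof. exact: convz_map (@inN_lin _ _ _ M) (@inNM _ _ _ M) F G. Qed.

End SqzConvolution.

Section TwistedModuleTheory.
Variables (k : fieldType) (H N : algebra k) (B : Type) (S : hopf_calculus H B).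
Variables (T : twist N S) (L : lmodType k) (M : tmod T L).
Local Notation D := (cop S).
Local Notation a := (ta T).
Local Notation g := (tg T).
Local Notation v := (tv T).
Local Notation nl := (bml M).
Local Notation nr := (bmr M).
Local Notation va := (tva M).
Local Notation iN := (@inN _ _ _ M).
Local Notation iL := (@inL _ _ _ M).
Local Notation conv := (convol S).
Local Notation cls := (conv_class (sqz_bmeas T M)).

Lemma cls_va2 u : cls true true (fun X Y => iL (va X (va Y u))).
Proof.
split.
- split=> x; apply: (lin_ap (@inL_lin _ _ _ M)); first exact: (tva_lin M).1.
  exact: (lin_ap ((tva_lin M).2 x) ((tva_lin M).1 u)).
- by move=> b X Y; rewrite va_s -inN_inL.
- by move=> b X Y; rewrite va_t -inL_inN.
- by move=> b X Y; rewrite va_s va_l inL_so; apply: so_ext => x y; rewrite -inN_inL.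
- by move=> b X Y; rewrite va_t va_r inL_so; apply: so_ext => x y; rewrite -inL_inN.
Qed.

Lemma va_gE u :
  conv (fun X Y => iN (g X Y)) (fun X Y => iL (va (X * Y) u)) =
  conv (fun X Y => iL (va X (va Y u))) (fun X Y => iN (g X Y)).
Proof.
apply: eq2_fun => X Y.
transitivity (iL (\S_(y, y' <- D Y) \S_(x, x' <- D X) nl (g x y) (va (x' * y') u))).
  rewrite inL_so; apply: so_ext => y y'; rewrite inL_so; apply: so_ext => x x'.
  by rewrite inN_inL.
rewrite va_g inL_so; apply: so_ext => y y'; rewrite inL_so; apply: so_ext => x x'.
by rewrite inL_inN.
Qed.

(** [va_g] convolved with σ^-1 on the right; the local unit X ▷ (Y ▷ 1) is absorbed because u is u
    times 1. *)
Lemma va_vaE u : (fun X Y => iL (va X (va Y u))) =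
  conv (conv (fun X Y => iN (g X Y)) (fun X Y => iL (va (X * Y) u)))
       (fun X Y => iN (v X Y)).
Proof.
have cg := cls_inN M (cls_g T); have cv := cls_inN M (cls_v T).
rewrite va_gE (convA (cls_va2 u) cg cv) conv_inN; apply: eq2_fun => X Y.
transitivity (iL (va X (\S_(y, y' <- D Y) nr (va y u) (a y' 1)))).
  by rewrite -va_r nr1.
rewrite (so_lin _ _ ((tva_lin M).2 X)) inL_so; apply: so_ext => y y'.
rewrite va_r inL_so; apply: so_ext => x x'.
by rewrite -inL_inN -tg_tv.
Qed.

End TwistedModuleTheory.

(** * The free twisted module *)

Section FreeBimodule.
Variables (k : fieldType) (H N : algebra k) (B : Type) (S : hopf_calculus H B).
Variables (T : twist N S) (L : lmodType k).
Local Notation s := (hs S).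
Local Notation t := (ht S).
Local Notation i := (tb T).

Definition bal3 (W : lmodType k) (f : N -> H -> N -> W) :=
  [/\ trilin f, forall b n X m, f (n * i b) X m = f n (s b * X) m
    & forall b n X m, f n (t b * X) m = f n X (i b * m)].

(* The universal property of N ⊗_B H ◇_B N. *)
Record free_bimod := FreeBimod {
  fm_bimod :> bimodule N L;
  fm_th : H -> L;
  fm_th_lin : lin fm_th;
  fm_th_s : forall b X, fm_th (s b * X) = bml fm_bimod (i b) (fm_th X);
  fm_th_t : forall b X, fm_th (t b * X) = bmr fm_bimod (fm_th X) (i b);
  fm_lift : forall (W : lmodType k) (f : N -> H -> N -> W), bal3 f ->
    {phi : L -> W | lin phi &
      forall n X m, phi (bml fm_bimod n (bmr fm_bimod (fm_th X) m)) = f n X m};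
  fm_ext : forall (W : lmodType k) (phi psi : L -> W), lin phi -> lin psi ->
    (forall n X m, phi (bml fm_bimod n (bmr fm_bimod (fm_th X) m)) =
                   psi (bml fm_bimod n (bmr fm_bimod (fm_th X) m))) ->
    forall u, phi u = psi u
}.

End FreeBimodule.

Ltac lin_bimod :=
  match goal with
  | |- lin (fun x => tva ?T (@?E x) ?n) => refine (lin_ap ((tva_lin T).1 n) _)
  | |- lin (fun x => tva ?T ?X (@?E x)) => refine (lin_ap ((tva_lin T).2 X) _)
  | |- lin (fun x => bml ?T (@?E x) ?n) => refine (lin_ap ((bml_lin T).1 n) _)
  | |- lin (fun x => bml ?T ?X (@?E x)) => refine (lin_ap ((bml_lin T).2 X) _)
  | |- lin (fun x => bmr ?T (@?E x) ?n) => refine (lin_ap ((bmr_lin T).1 n) _)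
  | |- lin (fun x => bmr ?T ?X (@?E x)) => refine (lin_ap ((bmr_lin T).2 X) _)
  | |- lin (fun x => fm_th ?T (@?E x)) => refine (lin_ap (fm_th_lin T) _)
  end.

Ltac lin_op ::= first [lin_meas | lin_twist | lin_wedge | lin_bimod].

Section FreeAction.
Variables (k : fieldType) (H N : algebra k) (B : Type) (S : hopf_calculus H B).
Variables (T : twist N S) (L : lmodType k) (F : free_bimod T L).
Local Notation D := (cop S).
Local Notation a := (ta T).
Local Notation g := (tg T).
Local Notation v := (tv T).
Local Notation nl := (bml F).
Local Notation nr := (bmr F).
Local Notation th := (fm_th F).

(* The action of X on the generator 1 ⊗ Y ⊗ 1. *)
Definition gen_act X Y : L :=
  \S_(y, y' <- D Y) \S_(x, x' <- D X) \S_(y1, y2 <- D y) \S_(x1, x2 <- D x)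
    nl (g x1 y1) (nr (th (x2 * y2)) (v x' y')).

(** The value that [va_l] and [va_r] force once the action on the generator is given. *)
Definition mon_act X n Z m : L :=
  \S_(x, x3 <- D X) \S_(x1, x2 <- D x) nl (a x1 n) (nr (gen_act x2 Z) (a x3 m)).

Variables (A : algebra k) (jN : N -> A).
Variables (P : lmodType k) (M : bimodule N P) (phi : L -> P) (jP : P -> A).
Hypothesis phi_lin : lin phi.
Hypothesis phi_l : forall n u, phi (nl n u) = bml M n (phi u).
Hypothesis phi_r : forall n u, phi (nr u n) = bmr M (phi u) n.
Hypothesis jP_lin : lin jP.
Hypothesis jP_l : forall n u, jN n * jP u = jP (bml M n u).
Hypothesis jP_r : forall n u, jP u * jN n = jP (bmr M u n).

Let j_lin : lin (fun u => jP (phi u)) := lin_ap jP_lin phi_lin.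

Let j_mon m n u : jP (phi (nl m (nr u n))) = jN m * jP (phi u) * jN n.
Proof. by rewrite phi_l phi_r jP_l jP_r nlr. Qed.

(** Stated along a bimodule map [phi] for two purposes: with the identity, to see the action on L as
    a convolution, and with the coproduct, to compute the coproduct of X ▶ u. *)
Lemma gact_map : (fun X Y => jP (phi (gen_act X Y))) =
  convol S (convol S (fun X Y => jN (g X Y)) (fun X Y => jP (phi (th (X * Y)))))
    (fun X Y => jN (v X Y)).
Proof.
apply: eq2_fun => X Y; rewrite (so_lin _ _ j_lin); apply: so_ext => y y'.
rewrite (so_lin _ _ j_lin); apply: so_ext => x x'.
rewrite (so_lin _ _ j_lin) so_mulrl; apply: so_ext => y1 y2.
rewrite (so_lin _ _ j_lin) so_mulrl; apply: so_ext => x1 x2.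
exact: j_mon.
Qed.

Lemma free_act_map X n Z m : jP (phi (mon_act X n Z m)) =
  convol1 S (convol1 S (fun x => jN (a x n)) (fun x => jP (phi (gen_act x Z))))
    (fun x => jN (a x m)) X.
Proof.
rewrite (so_lin _ _ j_lin); apply: so_ext => x x3.
rewrite (so_lin _ _ j_lin) so_mulrl; apply: so_ext => x1 x2.
exact: j_mon.
Qed.

End FreeAction.

Section FreeTwistedModule.
Variables (k : fieldType) (H N : algebra k) (B : Type) (S : hopf_calculus H B).
Variables (T : twist N S) (L : lmodType k) (F : free_bimod T L).
Local Notation s := (hs S).
Local Notation t := (ht S).
Local Notation D := (cop S).
Local Notation a := (ta T).
Local Notation g := (tg T).
Local Notation v := (tv T).
Local Notation i := (tb T).
Local Notation nl := (bml F).
Local Notation nr := (bmr F).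
Local Notation th := (fm_th F).
Local Notation iN := (@inN _ _ _ F).
Local Notation iL := (@inL _ _ _ F).
Local Notation conv := (convol S).
Local Notation convz := (convolz S).
Local Notation cls := (conv_class (sqz_bmeas T F)).

Local Notation gact := (gen_act F).
Local Notation free_act := (mon_act F).

Let ig X Y := iN (g X Y).
Let iv X Y := iN (v X Y).
Let ith X Y := iL (th (X * Y)).
Let cig : cls true false ig := cls_inN F (cls_g T).
Let civ : cls false true iv := cls_inN F (cls_v T).

Let bth : bimod_map (sqz_bmeas T F) (fun X => iL (th X)).
Proof.
split; first exact: (lin_ap (@inL_lin _ _ _ F) (fm_th_lin F)).
  by move=> b X; rewrite fm_th_s -inN_inL.
by move=> b X; rewrite fm_th_t -inL_inN.
Qed.

Let cith : cls false false ith := cls_mul bth.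

Lemma gactE : (fun X Y => iL (gact X Y)) = conv (conv ig ith) iv.
Proof.
exact: (gact_map (M := F) (phi := id) (@lin_id _ _) (fun n u => erefl)
  (fun n u => erefl) (@inL_lin _ _ _ F) (@inN_inL _ _ _ F) (@inL_inN _ _ _ F)).
Qed.

(** σ leads from class true to false, the generator at X Y stays in false, and σ^-1 leads back. All
    balancing properties of the action on generators are contained in this. *)
Lemma cls_gact : cls true true (fun X Y => iL (gact X Y)).
Proof. rewrite gactE; exact: cls_conv (cls_conv cig cith) civ. Qed.

Lemma iL_inj : injective iL.
Proof. by move=> u w [->]. Qed.

Lemma gact_lin : bilin gact.
Proof.
have [l1 l2] := cls_lin cls_gact.
by split=> x; [apply: (lin_ap (@prL_lin _ _ _ F) (l1 x))
  | apply: (lin_ap (@prL_lin _ _ _ F) (l2 x))].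
Qed.

Lemma gact_s b X Y : gact (s b * X) Y = nl (i b) (gact X Y).
Proof. by apply: iL_inj; rewrite (cls_s cls_gact) -inN_inL. Qed.

Lemma gact_t b X Y : gact (t b * X) Y = nr (gact X Y) (i b).
Proof. by apply: iL_inj; rewrite (cls_t cls_gact) -inL_inN. Qed.

Lemma gact_L b X Y :
  gact X (s b * Y) = \S_(x, x' <- D X) nl (a x (i b)) (gact x' Y).
Proof.
apply: iL_inj; rewrite (cls_L cls_gact) inL_so.
by apply: so_ext => x y; rewrite -inN_inL.
Qed.

Lemma gact_R b X Y :
  gact X (t b * Y) = \S_(x, x' <- D X) nr (gact x Y) (a x' (i b)).
Proof.
apply: iL_inj; rewrite (cls_R cls_gact) inL_so.
by apply: so_ext => x y; rewrite -inL_inN.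
Qed.


Let A n X := iN (a X n).
Let G Z X := iL (gact X Z).

Let bA n : bimod_map (sqz_bmeas T F) (A n).
Proof.
split=> [|b X|b X]; first by apply: (lin_ap (@inN_lin _ _ _ F)); bal.
  by rewrite /A ta_s inNM.
by rewrite /A ta_t inNM.
Qed.

Let bG Z : bimod_map (sqz_bmeas T F) (G Z).
Proof.
split=> [|b X|b X]; first exact: (cls_lin cls_gact).1.
  exact: (cls_s cls_gact).
exact: (cls_t cls_gact).
Qed.

Let AM m n : A (m * n) = convol1 S (A m) (A n).
Proof.
apply/funext => X; rewrite /A ta_mul inN_so; apply: so_ext => x x'.
by rewrite inNM.
Qed.

Lemma free_actE X n Z m :
  iL (free_act X n Z m) = convol1 S (convol1 S (A n) (G Z)) (A m) X.
Proof.
exact: (free_act_map (M := F) (phi := id) (@lin_id _ _) (fun n u => erefl)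
  (fun n u => erefl) (@inL_lin _ _ _ F) (@inN_inL _ _ _ F) (@inL_inN _ _ _ F)).
Qed.

(** An element b in front of Z comes out of [gen_act] as a factor X ▷ b, on the side of X_(1) ▷ n
    for s(b) and of X_(3) ▷ m for t(b), where multiplicativity of ▷ absorbs it. *)
Lemma bal3_free_act X : bal3 T (free_act X).
Proof.
have il := @prL_lin _ _ _ F; split.
- rewrite /free_act; split=> ? ?; bal; exact: lin_ap (gact_lin.2 _) _.
- move=> b n Z m; apply: iL_inj; rewrite !free_actE AM.
  rewrite (conv1A (bA _) (bA _) (bG _)); congr (convol1 S (convol1 S _ _) _ X).
  by apply/funext => x; rewrite /G gact_L inL_so; apply: so_ext => *; rewrite -inN_inL.
- move=> b n Z m; apply: iL_inj; rewrite !free_actE AM.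
  rewrite -(conv1A (bim_conv1 (bA _) (bG _)) (bA _) (bA _)).
  congr (convol1 S _ _ X); rewrite (conv1A (bA _) (bG _) (bA _)); congr (convol1 S _ _).
  by apply/funext => x; rewrite /G gact_R inL_so; apply: so_ext => *; rewrite -inL_inN.
Qed.

Definition free_tact X : L -> L := s2val (fm_lift F (bal3_free_act X)).

Lemma fva_lin2 X : lin (free_tact X).
Proof. exact: (s2valP (fm_lift F (bal3_free_act X))). Qed.

Lemma fva_mon X n Z m : free_tact X (nl n (nr (th Z) m)) = free_act X n Z m.
Proof. exact: (s2valP' (fm_lift F (bal3_free_act X))). Qed.

Lemma fva_monE X n Z m :
  iL (free_tact X (nl n (nr (th Z) m))) = convol1 S (convol1 S (A n) (G Z)) (A m) X.
Proof. by rewrite fva_mon free_actE. Qed.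

Lemma nl_mon m n Z m' : nl m (nl n (nr (th Z) m')) = nl (m * n) (nr (th Z) m').
Proof. by rewrite nlA. Qed.

Lemma nr_mon m n Z m' : nr (nl n (nr (th Z) m')) m = nl n (nr (th Z) (m' * m)).
Proof. by rewrite -nlr nrA. Qed.

Lemma fva_l X n u : free_tact X (nl n u) = \S_(x, y <- D X) nl (a x n) (free_tact y u).
Proof.
move: u; apply: (@fm_ext _ _ _ _ _ _ _ F).
- exact: lin_ap (fva_lin2 X) ((bml_lin F).2 n).
- apply: lin_so => x y; exact: lin_ap ((bml_lin F).2 _) (fva_lin2 y).
move=> n' Z m; apply: iL_inj; rewrite nl_mon fva_monE inL_so AM.
rewrite (conv1A (bA _) (bA _) (bG _)) (conv1A (bA _) (bim_conv1 (bA _) (bG _)) (bA _)).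
by apply: so_ext => x y; rewrite -inN_inL fva_monE.
Qed.

Lemma fva_r X n u : free_tact X (nr u n) = \S_(x, y <- D X) nr (free_tact x u) (a y n).
Proof.
move: u; apply: (@fm_ext _ _ _ _ _ _ _ F).
- exact: lin_ap (fva_lin2 X) ((bmr_lin F).1 n).
- apply: lin_so => x y; exact: lin_ap ((bmr_lin F).1 _) (fva_lin2 x).
move=> n' Z m; apply: iL_inj; rewrite nr_mon fva_monE inL_so AM.
rewrite -(conv1A (bim_conv1 (bA _) (bG _)) (bA _) (bA _)).
by apply: so_ext => x y; rewrite -inL_inN fva_monE.
Qed.

Let bFA n Z m : bimod_map (sqz_bmeas T F) (convol1 S (convol1 S (A n) (G Z)) (A m)) :=
  bim_conv1 (bim_conv1 (bA n) (bG Z)) (bA m).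

Lemma fva_lin : bilin free_tact.
Proof.
split=> [u c X Y|X]; last exact: fva_lin2.
move: u; apply: (@fm_ext _ _ _ _ _ _ _ F); first exact: fva_lin2.
  by move=> d u w; rewrite !fva_lin2 !scalerDr !scalerA (mulrC c) addrACA.
move=> n Z m; apply: iL_inj; rewrite inL_lin !fva_monE.
by case: (bFA n Z m).
Qed.

Lemma fva_s b X u : free_tact (s b * X) u = nl (i b) (free_tact X u).
Proof.
move: u; apply: (@fm_ext _ _ _ _ _ _ _ F); first exact: fva_lin2.
  exact: lin_ap ((bml_lin F).2 _) (fva_lin2 X).
move=> n Z m; apply: iL_inj; rewrite -inN_inL !fva_monE.
by case: (bFA n Z m).
Qed.

Lemma fva_t b X u : free_tact (t b * X) u = nr (free_tact X u) (i b).
Proof.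
move: u; apply: (@fm_ext _ _ _ _ _ _ _ F); first exact: fva_lin2.
  exact: lin_ap ((bmr_lin F).1 _) (fva_lin2 X).
move=> n Z m; apply: iL_inj; rewrite -inL_inN !fva_monE.
by case: (bFA n Z m).
Qed.

Lemma fva_so (K : Type) X (r : sumop k K) (f : K -> K -> L) :
  free_tact X (\S_(x, y <- r) f x y) = \S_(x, y <- r) free_tact X (f x y).
Proof. exact: so_lin (fva_lin2 X). Qed.

Lemma gact_1 Z : gact 1 Z = th Z.
Proof.
rewrite -[RHS](cop_epr S Z (fm_th_lin F)); apply: so_ext => z z'.
have d := dia_conv z z' (cls_conv cig cith) civ.
transitivity (\S_(z1, z2 <- D z) th (t (hep S z') * (s (hep S z1) * z2))); last first.
  apply: (cop_epl S z (f := fun z => th (t (hep S z') * z))).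
  by apply: lin_ap (fm_th_lin F) _; bal.
apply: iL_inj; rewrite !inL_so.
transitivity (\S_(x, x' <- D 1) (conv ig ith x z * iv x' z')).
  apply: so_ext => x x'; rewrite inL_so so_mulrl; apply: so_ext => z1 z2.
  rewrite inL_so so_mulrl; apply: so_ext => x1 x2.
  by rewrite inN_inL inL_inN nlr.
rewrite (cop_1 d) so_mulrl; apply: so_ext => z1 z2.
rewrite (cop_1 (dia_conv z1 z2 cig cith)) inN_inL inL_inN mul1r.
by rewrite tg_1X tv_1X !ta_unit fm_th_t fm_th_s.
Qed.

(** The outer factors are σ(X_(1), 1) and σ^-1(X_(3), 1), both counits. This becomes the right unit
    law of L. *)
Lemma gact_X1 X : gact X 1 = th X.
Proof.
have [tl ts tt] := bth; apply: iL_inj.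
rewrite (congr1 (fun G => G X 1) gactE) /conv.
rewrite (cop_1 (dia_conv2 X (cls_conv cig cith) civ)).
rewrite -[RHS](cop_epr S X tl); apply: so_ext => x x'.
rewrite tt; congr (_ * _); last by rewrite /iv tv_X1 ta_unit.
rewrite /conv (cop_1 (dia_conv2 x cig cith)) -[RHS](cop_epl S x tl).
apply: so_ext => x1 x2; rewrite ts; congr (_ * _); first by rewrite /ig tg_X1 ta_unit.
by rewrite /ith mulr1.
Qed.

Lemma fva_1 u : free_tact 1 u = u.
Proof.
move: u; apply: (@fm_ext _ _ _ _ _ _ _ F) => [|//|n Z m]; first exact: fva_lin2.
apply: iL_inj; rewrite fva_monE /convol1 (cop_1 (dia_bim (bim_conv1 (bA n) (bG Z)) (bA m))).
rewrite /convol1 (cop_1 (dia_bim (bA n) (bG Z))) /A /G gact_1 !ta_1.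
by rewrite inN_inL inL_inN -nlr.
Qed.

Lemma fva_th X Z : free_tact X (th Z) = gact X Z.
Proof.
have {1}-> : th Z = nl 1 (nr (th Z) 1) by rewrite nr1 nl1.
have [Gl Gs Gt] := bG Z.
apply: iL_inj; rewrite fva_monE -[RHS](cop_epr S X Gl); apply: so_ext => x x'.
rewrite Gt; congr (_ * _); last by rewrite /A ta_unit.
rewrite -[RHS](cop_epl S x Gl); apply: so_ext => x1 x2.
by rewrite Gs; congr (_ * _); rewrite /A ta_unit.
Qed.

Let Pu u X Y := iL (free_tact X (free_tact Y u)).
Let Qu u X Y := iL (free_tact (X * Y) u).
Let iA n X Y := iN (a X (a Y n)).
Let iT n X Y := iN (a (X * Y) n).

Let ciA n : cls true true (iA n) := cls_inN F (cls_act (bim_a T n)).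
Let ciT n : cls false false (iT n) := cls_inN F (cls_mul (bim_a T n)).

Let bfva u : bimod_map (sqz_bmeas T F) (fun X => iL (free_tact X u)).
Proof.
split.
- exact: (lin_ap (@inL_lin _ _ _ F) (fva_lin.1 u)).
- by move=> b X; rewrite fva_s -inN_inL.
- by move=> b X; rewrite fva_t -inL_inN.
Qed.

Let cQ u : cls false false (Qu u) := cls_mul (bfva u).

Let cP u : cls true true (Pu u).
Proof.
split.
- split=> x; apply: (lin_ap (@inL_lin _ _ _ F)); first exact: fva_lin.1.
  exact: (lin_ap (fva_lin.2 x) (fva_lin.1 u)).
- by move=> b X Y; rewrite /Pu fva_s -inN_inL.
- by move=> b X Y; rewrite /Pu fva_t -inL_inN.
- by move=> b X Y; rewrite /Pu fva_s fva_l inL_so; apply: so_ext => x y; rewrite -inN_inL.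
- by move=> b X Y; rewrite /Pu fva_t fva_r inL_so; apply: so_ext => x y; rewrite -inL_inN.
Qed.

Let Pnl n u : Pu (nl n u) = conv (iA n) (Pu u).
Proof.
apply: eq2_fun => X Y; rewrite /Pu fva_l fva_so inL_so; apply: so_ext => y y'.
by rewrite fva_l inL_so; apply: so_ext => x x'; rewrite -inN_inL.
Qed.

Let Pnr n u : Pu (nr u n) = conv (Pu u) (iA n).
Proof.
apply: eq2_fun => X Y; rewrite /Pu fva_r fva_so inL_so; apply: so_ext => y y'.
by rewrite fva_r inL_so; apply: so_ext => x x'; rewrite -inL_inN.
Qed.

Let Qnl n u : Qu (nl n u) = conv (iT n) (Qu u).
Proof.
rewrite (conv_mul (bA n) (bfva u)); apply: eq2_fun => X Y.
by rewrite /Qu fva_l inL_so; apply: so_ext => x x'; rewrite -inN_inL.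
Qed.

Let Qnr n u : Qu (nr u n) = conv (Qu u) (iT n).
Proof.
rewrite (conv_mul (bfva u) (bA n)); apply: eq2_fun => X Y.
by rewrite /Qu fva_r inL_so; apply: so_ext => x x'; rewrite -inL_inN.
Qed.

Let gT n : conv ig (iT n) = conv (iA n) ig.
Proof. by rewrite !conv_inN tg_actE. Qed.

(** By this and [gQ_nr] the elements u satisfying [va_g] form a sub-bimodule, because σ intertwines
    the two actions on N ([gT]). Only generators remain. *)
Let gQ_nl n u : conv ig (Qu u) = conv (Pu u) ig ->
  conv ig (Qu (nl n u)) = conv (Pu (nl n u)) ig.
Proof.
move=> uE; rewrite Qnl Pnl -(convA cig (ciT n) (cQ u)) gT.
by rewrite (convA (ciA n) cig (cQ u)) uE (convA (ciA n) (cP u) cig).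
Qed.

Let gQ_nr n u : conv ig (Qu u) = conv (Pu u) ig ->
  conv ig (Qu (nr u n)) = conv (Pu (nr u n)) ig.
Proof.
move=> uE; rewrite Qnr Pnr -(convA cig (cQ u) (ciT n)) uE.
by rewrite (convA (cP u) cig (ciT n)) gT (convA (cP u) (ciA n) cig).
Qed.

Let aG z X Y := iN (a X (g Y z)).
Let aV z X Y := iN (a X (v Y z)).
Let gR z X Y := ig X (Y * z).
Let vR z X Y := iv X (Y * z).
Let thR z X Y := ith X (Y * z).
Let kR z X Y := iL (gact X (Y * z)).
Let gM z X Y := iN (g (X * Y) z).
Let vM z X Y := iN (v (X * Y) z).

Let Pth Z : Pu (th Z) = convz (convz aG kR) aV Z.
Proof.
apply: eq2_fun => X Y; rewrite /Pu fva_th fva_so inL_so; apply: so_ext => z z'.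
rewrite fva_so inL_so; apply: so_ext => y y'; rewrite fva_so inL_so.
transitivity (\S_(z1, z2 <- D z) \S_(y1, y2 <- D y) \S_(x, x' <- D X)
    ((\S_(x1, x2 <- D x) (aG z1 x1 y1 * kR z2 x2 y2)) * aV z' x' y')).
  apply: so_ext => z1 z2; rewrite fva_so inL_so; apply: so_ext => y1 y2.
  by rewrite fva_monE.
under so_ext => z1 z2 do rewrite so_swap.
rewrite so_swap; apply: so_ext => x x'; rewrite so_mulrl; apply: so_ext => z1 z2.
by rewrite so_mulrl.
Qed.

(** X ▶ (Y ▶ Z) is the product of (X_(1) ▷ σ(Y_(1), Z_(1))) σ(X_(2), Y_(2) Z_(2)), the generator at
    X_(3) Y_(3) Z_(3), and σ^-1(X_(4), Y_(4) Z_(4)) (X_(5) ▷ σ^-1(Y_(5), Z_(5))). The cocycle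
    identity at the left end and its dual at the right end pull out σ(X, Y) and σ^-1(X, Y), and
    leave (X Y) ▶ Z in between. *)
Let gQ_th Z : conv ig (Qu (th Z)) = conv (Pu (th Z)) ig.
Proof.
have caG z : cls true true (aG z) := cls_inN F (cls_act (bim_g T z)).
have caV z : cls true true (aV z) := cls_inN F (cls_act (bim_v T z)).
have cgR z : cls true false (gR z) := cls_mulr z cig.
have cvR z : cls false true (vR z) := cls_mulr z civ.
have cth z : cls false false (thR z) := cls_mulr z cith.
have cgM z : cls false false (gM z) := cls_inN F (cls_mul (bim_g T z)).
have cvM z : cls false false (vM z) := cls_inN F (cls_mul (bim_v T z)).
have il := @inN_lin _ _ _ F.
have zaG : zlinear aG by move=> X Y; apply: (lin_ap il); bal.
have zaV : zlinear aV by move=> X Y; apply: (lin_ap il); bal.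
have zgR : zlinear gR by move=> X Y; apply: (lin_ap il); bal.
have zvR : zlinear vR by move=> X Y; apply: (lin_ap il); bal.
have zth : zlinear thR by move=> X Y; apply: (lin_ap (@inL_lin _ _ _ F)); bal.
have z1 : zbalanced S aG gR.
  by apply: (zbal_false caG cgR) => b z X Y; rewrite /aG /gR ?tg_bal ?mulrA.
have z2 : zbalanced S gR thR.
  by apply: (zbal_false cgR cth) => b z X Y; rewrite /thR /gR mulrA.
have z3 : zbalanced S thR vR.
  by apply: (zbal_false cth cvR) => b z X Y; rewrite /thR /vR mulrA.
have z4 : zbalanced S vR aV.
  by apply: (zbal_false cvR caV) => b z X Y; rewrite /aV /vR ?tv_bal ?mulrA.
have ckR : kR = convz (convz gR thR) vR.
  transitivity (convz (fun z X Y => conv ig ith X (Y * z)) vR).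
    rewrite -(conv_mulr (cls_conv cig cith) civ) -gactE //.
  by congr (convz _ vR); apply: conv_mulr cig cith.
have cgt z := cls_convz z cgR cth.
have zgt : zlinear (convz gR thR) by apply: zlin_convz.
have z12 : zbalanced S aG (convz gR thR) := zbal_convzr caG cgR cth zgR zth z2 z1.
have z23 : zbalanced S (convz gR thR) vR := zbal_convzl cgR cth cvR zgR zth z2 z3.
have aGgR : convz aG gR = fun Z => conv ig (gM Z).
  rewrite convz_inN; apply/funext => Z'; rewrite conv_inN; apply: eq2_fun => X Y.
  by congr iN; apply: tg_cocycle.
have vRaV : convz vR aV = fun Z => conv (vM Z) iv.
  rewrite convz_inN; apply/funext => Z'; rewrite conv_inN; apply: eq2_fun => X Y.
  by congr iN; apply: (congr1 (fun F => F Z' X Y) (tv_cocycle T)).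
have cg z := cls_conv cig (cgM z).
have cv z := cls_conv (cvM z) civ.
have caGgR z := cls_convz z caG cgR.
have zaGgR : zlinear (convz aG gR) := zlin_convz zaG zgR z1.
have z5 : zbalanced S (convz aG gR) thR := zbal_convzl caG cgR cth zaG zgR z1 z2.
have z6 : zbalanced S (convz (convz aG gR) thR) vR :=
  zbal_convzl caGgR cth cvR zaGgR zth z5 z3.
(* The law in solved form; convolving with σ on the right then replaces σ^-1 by the local unit (X Y)
   ▷ 1, which is absorbed. *)
have PE : Pu (th Z) = conv (conv ig (Qu (th Z))) iv.
  rewrite Pth ckR -(convzA caG cgt cvR) // -(convzA caG cgR cth) //.
  rewrite (convzA (fun z => cls_convz z caGgR cth) cvR caV) //; last first.
    exact: zlin_convz zaGgR zth z5.
  rewrite aGgR vRaV (conv_convz cig cgM cth).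
  rewrite (conv_convz cig (fun z => cls_convz z cgM cth) cv).
  rewrite (convz_conv (fun z => cls_convz z cgM cth) cvM civ).
  have -> : convz (convz gM thR) vM = fun Z X Y => iL (gact (X * Y) Z).
    transitivity (fun Z X Y => conv (conv ig ith) iv (X * Y) Z); last first.
      by rewrite -gactE.
    rewrite (conv_mull (cls_conv cig cith) civ); congr (convz _ vM).
    rewrite (conv_mull cig cith); congr (convz _ _); apply/funext => z.
    by apply: eq2_fun => X Y; rewrite /thR /ith mulrA.
  have -> : (fun X Y => iL (gact (X * Y) Z)) = Qu (th Z).
    by apply: eq2_fun => X Y; rewrite /Qu fva_th.
  by rewrite (convA cig (cQ _) civ).
rewrite PE (convA (cls_conv cig (cQ _)) civ cig).
have -> : conv iv ig = fun X Y => iN (a (X * Y) 1).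
  by rewrite conv_inN; apply: eq2_fun => X Y; congr iN; apply: tv_tg.
rewrite (convA cig (cQ _) (ciT 1)); congr (conv _ _).
exact/esym/(conv_1r (bfva _)).
Qed.

Lemma fva_g X Y u :
  \S_(y, y' <- D Y) \S_(x, x' <- D X) nl (g x y) (free_tact (x' * y') u) =
  \S_(y, y' <- D Y) \S_(x, x' <- D X) nr (free_tact x (free_tact y u)) (g x' y').
Proof.
have fl1 := fva_lin.1; have fl2 := fva_lin.2.
have nl1 := (bml_lin F).1; have nl2 := (bml_lin F).2.
have nr1 := (bmr_lin F).1; have nr2 := (bmr_lin F).2.
move: u; apply: (@fm_ext _ _ _ _ _ _ _ F).
- apply: lin_so => y y'; apply: lin_so => x x'.
  exact: (lin_ap (nl2 _) (fl2 _)).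
- apply: lin_so => y y'; apply: lin_so => x x'.
  exact: (lin_ap (nr1 _) (lin_ap (fl2 _) (fl2 _))).
move=> n Z m; have := gQ_nl n (gQ_nr m (gQ_th Z)).
move=> /(congr1 (fun G => G X Y)) uE; apply: iL_inj; move: uE.
move: (nl n _) => u uE; transitivity (conv ig (Qu u) X Y); last rewrite uE.
  rewrite inL_so; apply: so_ext => y y'; rewrite inL_so; apply: so_ext => x x'.
  by rewrite -inN_inL.
rewrite inL_so; apply: so_ext => y y'; rewrite inL_so; apply: so_ext => x x'.
by rewrite -inL_inN.
Qed.

Definition free_tmod : tmod T L :=
  Tmod fva_lin fva_s fva_t fva_1 fva_l fva_r fva_g.


End FreeTwistedModule.

(** * Maps out of the free twisted module, and its algebra structure *)

Section BimoduleSums.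
Variables (k : fieldType) (N : algebra k) (L : lmodType k) (M : bimodule N L).
Variables (K : Type) (r : sumop k K).

Lemma bmr_sol n (f : K -> K -> L) :
  bmr M (\S_(x, y <- r) f x y) n = \S_(x, y <- r) bmr M (f x y) n.
Proof. exact: (so_lin r f ((bmr_lin M).1 n)). Qed.

Lemma bml_sor n (f : K -> K -> L) :
  bml M n (\S_(x, y <- r) f x y) = \S_(x, y <- r) bml M n (f x y).
Proof. exact: (so_lin r f ((bml_lin M).2 n)). Qed.

End BimoduleSums.

Section RegularTmod.
Variables (k : fieldType) (H N : algebra k) (B : Type) (S : hopf_calculus H B).
Variable T : twist N S.

Fact mul_bilin : bilin (fun x y : N => x * y).
Proof. by bal. Qed.

Definition reg_bimod : bimodule N N :=
  Bimodule mul_bilin mul_bilin (fun m n u => mulrA m n u)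
    (fun m n u => esym (mulrA u m n)) (fun m n u => mulrA m u n)
    (fun u => mul1r u) (fun u => mulr1 u).

Definition reg_tmod : tmod T N :=
  @Tmod _ _ _ _ _ _ _ reg_bimod (ta T) (ta_lin T) (ta_s T) (ta_t T) (ta_1 T)
    (fun X n u => ta_mul T X n u) (fun X n u => ta_mul T X u n)
    (fun X Y u => tg_act T X Y u).

End RegularTmod.

Section Orbit.
Variables (k : fieldType) (H N : algebra k) (B : Type) (S : hopf_calculus H B).
Variables (T : twist N S) (L : lmodType k) (F : free_bimod T L).
Variables (V : lmodType k) (M : tmod T V).
Local Notation nl := (bml M).
Local Notation nr := (bmr M).
Local Notation va := (tva M).
Local Notation th := (fm_th F).

Lemma bal3_orbit w : bal3 T (fun n X m => nl n (nr (va X w) m)).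
Proof.
split; first by bal.
- by move=> b n X m; rewrite va_s -nlr nlA.
- by move=> b n X m; rewrite va_t nrA.
Qed.

Definition orbit w : L -> V := s2val (fm_lift F (bal3_orbit w)).

Lemma orbit_lin w : lin (orbit w).
Proof. exact: (s2valP (fm_lift F (bal3_orbit w))). Qed.

Lemma orbit_mon w n X m :
  orbit w (bml F n (bmr F (th X) m)) = nl n (nr (va X w) m).
Proof. exact: (s2valP' (fm_lift F (bal3_orbit w))). Qed.

Lemma orbit_so (K : Type) w (r : sumop k K) (f : K -> K -> L) :
  orbit w (\S_(x, y <- r) f x y) = \S_(x, y <- r) orbit w (f x y).
Proof. exact: so_lin (orbit_lin w). Qed.

Lemma orbit_nl w n u : orbit w (bml F n u) = nl n (orbit w u).
Proof.
move: u; apply: (@fm_ext _ _ _ _ _ _ _ F).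
- exact: lin_ap (orbit_lin w) ((bml_lin F).2 n).
- exact: lin_ap ((bml_lin M).2 n) (orbit_lin w).
by move=> n' X m; rewrite nl_mon !orbit_mon nlA.
Qed.

Lemma orbit_nr w n u : orbit w (bmr F u n) = nr (orbit w u) n.
Proof.
move: u; apply: (@fm_ext _ _ _ _ _ _ _ F).
- exact: lin_ap (orbit_lin w) ((bmr_lin F).1 n).
- exact: lin_ap ((bmr_lin M).1 n) (orbit_lin w).
by move=> n' X m; rewrite nr_mon !orbit_mon -nlr nrA.
Qed.

Lemma orbit_th w X : orbit w (th X) = va X w.
Proof. by rewrite -(nr1 F (th X)) -(nl1 F (bmr F _ _)) orbit_mon nr1 nl1. Qed.

(** On a generator this is [va_vaE]: the formula defining the free action holds in every twisted
    module. *)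
Lemma orbit_va w X u : orbit w (free_tact F X u) = va X (orbit w u).
Proof.
move: u; apply: (@fm_ext _ _ _ _ _ _ _ F).
- exact: lin_ap (orbit_lin w) (fva_lin2 F X).
- exact: lin_ap ((tva_lin M).2 X) (orbit_lin w).
have gE Y Z : orbit w (gen_act F Y Z) = va Y (va Z w).
  have := congr1 (fun G => prL (G Y Z)) (va_vaE M w); rewrite [prL _]/= => ->.
  rewrite orbit_so prL_so; apply: so_ext => y y'.
  rewrite orbit_so prL_so; apply: so_ext => x x'.
  rewrite orbit_so prL_inNr prL_so bmr_sol.
  apply: so_ext => y1 y2.
  rewrite orbit_so prL_so bmr_sol.
  apply: so_ext => x1 x2.
  by rewrite orbit_nl orbit_nr orbit_th prL_inN nlr.
move=> n Z m; rewrite fva_mon orbit_mon nlr va_r orbit_so.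
apply: so_ext => x x3; rewrite va_l orbit_so bmr_sol.
by apply: so_ext => x1 x2; rewrite orbit_nl orbit_nr gE nlr.
Qed.

End Orbit.

Section FreeAlgebra.
Variables (k : fieldType) (H N : algebra k) (B : Type) (S : hopf_calculus H B).
Variables (T : twist N S) (L : lmodType k) (F : free_bimod T L).
Local Notation nl := (bml F).
Local Notation nr := (bmr F).
Local Notation va := (free_tact F).
Local Notation th := (fm_th F).

Definition free_mul (u w : L) : L := orbit F (free_tmod F) w u.

Lemma fmul_mon n X m w : free_mul (nl n (nr (th X) m)) w = nl n (nr (va X w) m).
Proof. exact: orbit_mon. Qed.

Lemma fmul_nl n u w : free_mul (nl n u) w = nl n (free_mul u w).
Proof. exact: orbit_nl. Qed.

Lemma fmul_nr n u w : free_mul (nr u n) w = nr (free_mul u w) n.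
Proof. exact: orbit_nr. Qed.

Lemma fmul_th X w : free_mul (th X) w = va X w.
Proof. exact: orbit_th. Qed.

Lemma fmul_linl w : lin (free_mul^~ w).
Proof. exact: orbit_lin. Qed.

Lemma fmul_linr u : lin (free_mul u).
Proof.
move=> c w w'; move: u; apply: (@fm_ext _ _ _ _ _ _ _ F).
- exact: fmul_linl.
- by move=> d u u'; rewrite !fmul_linl !scalerDr !scalerA (mulrC c) addrACA.
move=> n X m; rewrite !fmul_mon (fva_lin2 F X) (bmr_lin F).1.
exact: (bml_lin F).2.
Qed.

Lemma fmul1l : left_id (th 1) free_mul.
Proof. by move=> u; rewrite fmul_th fva_1. Qed.

Lemma fmul1r : right_id (th 1) free_mul.
Proof.
apply: (@fm_ext _ _ _ _ _ _ _ F) => [|//|n X m]; first exact: fmul_linl.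
by rewrite fmul_mon fva_th gact_X1.
Qed.

Lemma fmulA : associative free_mul.
Proof.
move=> u w z; move: u; apply: (@fm_ext _ _ _ _ _ _ _ F).
- exact: fmul_linl.
- exact: lin_ap (fmul_linl z) (fmul_linl w).
move=> n X m; rewrite !fmul_mon fmul_nl fmul_nr; congr (nl n (nr _ m)).
exact/esym/orbit_va.
Qed.

Definition free_algebra_on : algebra_on L.
Proof.
refine (@AlgebraOn k L free_mul (th 1) fmulA fmul1l fmul1r _ _ _ _).
- by move=> u w z; rewrite (linD (fmul_linl z)).
- by move=> u w z; rewrite (linD (fmul_linr u)).
- by move=> c u w; rewrite (linZ (fmul_linl w)).
- by move=> c u w; rewrite (linZ (fmul_linr u)).
Defined.

Definition free_algebra : algebra k := Algebra free_algebra_on.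

End FreeAlgebra.

Section LinearMaps.
Variables (k : fieldType) (V W : lmodType k) (f : V -> W).
Hypothesis fl : lin f.

Definition linear_of : {linear V -> W} :=
  HB.pack f (GRing.isLinear.Build k V W *:%R f fl).

End LinearMaps.

Section FreeBase.
Variables (k : fieldType) (H N : algebra k) (B : Type) (S : hopf_calculus H B).
Variables (T : twist N S) (L : lmodType k) (F : free_bimod T L).
Local Notation nl := (bml F).
Local Notation nr := (bmr F).
Local Notation th := (fm_th F).
Local Notation A := (free_algebra F).

Definition free_src : {linear N -> A} := linear_of ((bml_lin F).1 (th 1) : @lin k N A _).
Definition free_tgt : {linear N -> A} := linear_of ((bmr_lin F).2 (th 1) : @lin k N A _).

Lemma free_srcM n (u : A) : free_src n * u = nl n u.
Proof. exact: etrans (fmul_nl F n (th 1) u) (congr1 (nl n) (fmul1l F u)). Qed.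

Lemma free_tgtM n (u : A) : free_tgt n * u = nr u n.
Proof. exact: etrans (fmul_nr F n (th 1) u) (congr1 (nr^~ n) (fmul1l F u)). Qed.

Definition free_base : base_ring N A.
Proof.
refine (@BaseRing k N A free_src free_tgt _ _ _).
- split; first exact: (nl1 F (th 1)).
  by move=> m n; rewrite free_srcM; exact: (esym (nlA F m n (th 1))).
- split; first exact: (nr1 F (th 1)).
  by move=> m n; rewrite [RHS]free_tgtM; exact: (esym (nrA F n m (th 1))).
- by move=> m n; rewrite free_srcM free_tgtM; exact: (nlr F m n (th 1)).
Defined.

End FreeBase.

(** * Maps on balanced tensor products, and the truncated tensor algebra *)

Section TensorMaps.
Variables (k : fieldType) (M N : lmodType k) (A : Type).
Variables (r : A -> M -> M) (l : A -> N -> N).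
Local Notation tens := (tens r l).

Definition balan (V : lmodType k) (f : M -> N -> V) :=
  bilin f /\ forall a m n, f (r a m) n = f m (l a n).

Lemma balanE (V : lmodType k) (f : M -> N -> V) : balan f -> balanced r l f.
Proof. by case=> -[f1 f2] fb; split. Qed.

Lemma tlift_lin (V : lmodType k) (f : M -> N -> V) :
  balan f -> lin (fun u : tens => tlift u f).
Proof. by move=> /balanE/tlift_linear. Qed.

Lemma tliftE (V : lmodType k) (f : M -> N -> V) m n :
  balan f -> tlift (pure r l m n) f = f m n.
Proof. by move=> /balanE/tlift_pure. Qed.

Lemma balan_pure : balan (pure r l).
Proof. by have [p1 p2 p3] := pure_balanced r l; split. Qed.

Lemma tens_ext (V : lmodType k) (phi psi : tens -> V) : lin phi -> lin psi ->
  (forall m n, phi (pure r l m n) = psi (pure r l m n)) -> forall u, phi u = psi u.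
Proof.
move=> pl ql pq u; rewrite (tensE u) !lin_sum //.
by apply: eq_bigr => p _.
Qed.

Lemma lin_tlift (V : lmodType k) (phi : tens -> V) : lin phi ->
  forall u, phi u = tlift u (fun m n => phi (pure r l m n)).
Proof. by move=> pl u; rewrite {1}(tensE u) lin_sum. Qed.

End TensorMaps.

Section TensorSums.
Variables (k : fieldType) (M : lmodType k) (A : Type) (r l : A -> M -> M).

Fact tsum_repr (u : tens r l) : exists v : seq (M * M),
  forall (V : lmodType k) (f : M -> M -> V), tlift u f = \sum_(p <- v) f p.1 p.2.
Proof. by exists (repr u). Qed.

(** [tlift u f] and [so (tsum u) f] are convertible, so the Sweedler sums of the statement are
    operators without any rewriting. *)
Definition tsum (u : tens r l) : sumop k M := Sumop (tsum_repr u).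

End TensorSums.

Section TruncatedTensor.
Variables (k : fieldType) (N : algebra k) (L P : lmodType k).
Variables (M : bimodule N L) (M2 : bimodule N P) (p : L -> L -> P).
Local Notation nl := (bml M).
Local Notation nr := (bmr M).
Local Notation nl2 := (bml M2).
Local Notation nr2 := (bmr M2).

Hypothesis p_lin : bilin p.
Hypothesis p_l : forall n u w, p (nl n u) w = nl2 n (p u w).
Hypothesis p_r : forall n u w, p u (nr w n) = nr2 (p u w) n.
Hypothesis p_m : forall n u w, p (nr u n) w = p u (nl n w).

Let pDl u u' w : p (u + u') w = p u w + p u' w := linD (p_lin.1 w) u u'.
Let pDr u w w' : p u (w + w') = p u w + p u w' := linD (p_lin.2 u) w w'.
Let nlD n u w : nl2 n (u + w) = nl2 n u + nl2 n w := linD ((bml_lin M2).2 n) u w.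
Let nrD n u w : nr2 (u + w) n = nr2 u n + nr2 w n := linD ((bmr_lin M2).1 n) u w.
Let nlDn m n u : nl2 (m + n) u = nl2 m u + nl2 n u := linD ((bml_lin M2).1 u) m n.
Let nrDn m n u : nr2 u (m + n) = nr2 u m + nr2 u n := linD ((bmr_lin M2).2 u) m n.

Local Notation S1 := (sqz M).

Definition tt_mul (x y : (S1 * P)%type) : (S1 * P)%type :=
  (x.1 * y.1, nl2 (prN x.1) y.2 + p (prL x.1) (prL y.1) + nr2 x.2 (prN y.1)).

(* The tensor algebra of L over N, truncated in degree 2, with P in place of
   the tensor square. In it, the coproduct of X ▶ u becomes a convolution. *)
Definition ttens : algebra k.
Proof.
refine (@Algebra k (S1 * P)%type (@AlgebraOn k (S1 * P)%type tt_mul (1, 0)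
  _ _ _ _ _ _ _)); rewrite /tt_mul.
- move=> x y z; congr pair; first exact: mulrA.
  rewrite /prN /prL /= !nlD !nrD pDl pDr !nlA !nrA nlr p_l p_r p_m.
  set A1 := nl2 _ z.2; set A2 := nl2 _ (p _ _); set A3 := nr2 (nl2 _ _) _.
  set B1 := p _ (nl _ _); set B2 := nr2 (p _ _) _; set C := nr2 _ (_ * _).
  rewrite -!addrA; congr (A1 + (A2 + _)); rewrite !addrA; congr (_ + B2 + C).
  exact: addrC.
- case=> x u; congr pair; first exact: mul1r.
  by rewrite /prN /prL /= nl1 (lin0 (p_lin.1 _)) (lin0 ((bmr_lin M2).1 _)) !addr0.
- case=> x u; congr pair; first exact: mulr1.
  by rewrite /prN /prL /= nr1 (lin0 (p_lin.2 _)) (lin0 ((bml_lin M2).2 _)) !add0r.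
- move=> x y z; congr pair; first exact: mulrDl.
  rewrite /prN /prL /= nlDn pDl nrD.
  by rewrite (addrACA (nl2 _ _)) (addrACA (nl2 _ _ + _)).
- move=> x y z; congr pair; first exact: mulrDr.
  rewrite /prN /prL /= nlD pDr nrDn.
  by rewrite (addrACA (nl2 _ _)) (addrACA (nl2 _ _ + _)).
- move=> c x y; congr pair; first exact: alg_scalerAl.
  by rewrite /prN /prL /= (linZ ((bml_lin M2).1 _)) (linZ (p_lin.1 _))
    (linZ ((bmr_lin M2).1 _)) !scalerDr.
- move=> c x y; congr pair; first exact: alg_scalerAr.
  by rewrite /prN /prL /= (linZ ((bml_lin M2).2 _)) (linZ (p_lin.2 _))
    (linZ ((bmr_lin M2).2 _)) !scalerDr.
Defined.

End TruncatedTensor.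

Section TruncatedTensorMaps.
Variables (k : fieldType) (N : algebra k) (L P : lmodType k).
Variables (M : bimodule N L) (M2 : bimodule N P) (p : L -> L -> P).
Hypothesis p_lin : bilin p.
Hypothesis p_l : forall n u w, p (bml M n u) w = bml M2 n (p u w).
Hypothesis p_r : forall n u w, p u (bmr M w n) = bmr M2 (p u w) n.
Hypothesis p_m : forall n u w, p (bmr M u n) w = p u (bml M n w).
Local Notation TT := (ttens p_lin p_l p_r p_m).

Definition ttN n : TT := (inN M n, 0 : P).
Definition ttL u : TT := (inL M u, 0 : P).
Definition ttP q : TT := (0 : sqz M, q).
Lemma jN_lin : lin ttN.
Proof. by move=> c x y; congr pair; [exact: inN_lin | rewrite /= scaler0 addr0]. Qed.

Lemma jL_lin : lin ttL.
Proof. by move=> c x y; congr pair; [exact: inL_lin | rewrite /= scaler0 addr0]. Qed.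

Lemma jP_lin : lin ttP.
Proof. by move=> c x y; congr pair; rewrite /= scaler0 addr0. Qed.

Lemma jP_inj : injective ttP.
Proof. by move=> x y [->]. Qed.

Let z1 := lin0 (p_lin.1 0).

Lemma jNM m n : ttN (m * n) = ttN m * ttN n.
Proof.
congr pair; first exact: inNM.
by rewrite /= (lin0 ((bml_lin M2).2 _)) (lin0 ((bmr_lin M2).1 _)) (lin0 (p_lin.1 _)) !addr0.
Qed.

Lemma jN_jL n u : ttN n * ttL u = ttL (bml M n u).
Proof.
congr pair; first exact: inN_inL.
by rewrite /= (lin0 ((bml_lin M2).2 _)) (lin0 ((bmr_lin M2).1 _)) (lin0 (p_lin.1 _)) !addr0.
Qed.

Lemma jL_jN n u : ttL u * ttN n = ttL (bmr M u n).
Proof.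
congr pair; first exact: inL_inN.
by rewrite /= (lin0 ((bml_lin M2).2 _)) (lin0 ((bmr_lin M2).1 _)) (lin0 (p_lin.2 _)) !addr0.
Qed.

Lemma jL_jL u w : ttL u * ttL w = ttP (p u w).
Proof.
congr pair; last first.
  by rewrite /= (lin0 ((bml_lin M2).2 _)) (lin0 ((bmr_lin M2).1 _)) add0r addr0.
by apply: sqzP; rewrite ?prNM ?prLM /prN /prL /= ?mulr0 // (lin0 ((bml_lin M).1 _))
  (lin0 ((bmr_lin M).2 _)) addr0.
Qed.

Lemma jN_jP n q : ttN n * ttP q = ttP (bml M2 n q).
Proof.
congr pair; first exact: mulr0.
by rewrite /= (lin0 (p_lin.1 _)) (lin0 ((bmr_lin M2).1 _)) !addr0.
Qed.

Lemma jP_jN n q : ttP q * ttN n = ttP (bmr M2 q n).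
Proof.
congr pair; first exact: mul0r.
by rewrite /= (lin0 (p_lin.1 _)) (lin0 ((bml_lin M2).2 _)) !add0r.
Qed.

End TruncatedTensorMaps.

(** * The coproduct of the free twisted module *)

Section FreeTensorSquare.
Variables (k : fieldType) (H N : algebra k) (B : Type) (S : hopf_calculus H B).
Variables (T : twist N S) (L : lmodType k) (F : free_bimod T L).
Local Notation nl := (bml F).
Local Notation nr := (bmr F).
Local Notation A := (free_algebra F).
Local Notation e := (free_base F).
Local Notation LL := (HdH e).

Definition free_diamond (u w : L) : LL :=
  pure (fun n (u : A) => tgt e n * u) (fun n (u : A) => src e n * u) u w.

Definition hd_balanced (V : lmodType k) (f : L -> L -> V) :=
  bilin f /\ forall n u w, f (nr u n) w = f u (nl n w).

Lemma balhdE (V : lmodType k) (f : L -> L -> V) : hd_balanced f ->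
  balan (fun n (u : A) => tgt e n * u) (fun n (u : A) => src e n * u) (f : A -> A -> V).
Proof.
case=> fl fb; split=> // n u w.
by rewrite [tgt e n * u]free_tgtM [src e n * w]free_srcM.
Qed.

Lemma hd_lin : bilin free_diamond.
Proof.
exact: (balan_pure (fun n (u : A) => tgt e n * u) (fun n (u : A) => src e n * u)).1.
Qed.

Lemma hd_bal n u w : free_diamond (nr u n) w = free_diamond u (nl n w).
Proof.
have [_ hb] := balan_pure (fun n (u : A) => tgt e n * u) (fun n (u : A) => src e n * u).
have := hb n u w.
by rewrite [tgt e n * u]free_tgtM [src e n * w]free_srcM.
Qed.

Definition free_diamond_lift (V : lmodType k) (f : L -> L -> V) (z : LL) : V := tlift z f.

Lemma hdlift_lin (V : lmodType k) (f : L -> L -> V) : hd_balanced f -> lin (free_diamond_lift f).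
Proof. by move=> /balhdE/tlift_lin. Qed.

Lemma hdliftE (V : lmodType k) (f : L -> L -> V) u w :
  hd_balanced f -> free_diamond_lift f (free_diamond u w) = f u w.
Proof. by move=> /balhdE fb; exact: (@tliftE k A A N _ _ V f u w fb). Qed.

Lemma hd_ext (V : lmodType k) (phi psi : LL -> V) : lin phi -> lin psi ->
  (forall u w, phi (free_diamond u w) = psi (free_diamond u w)) -> forall z, phi z = psi z.
Proof. exact: tens_ext. Qed.

Lemma balhd_l n : hd_balanced (fun u w => free_diamond (nl n u) w).
Proof.
split=> [|m u w]; last by rewrite nlr hd_bal.
split=> u; last exact: hd_lin.2.
exact: lin_ap (hd_lin.1 u) ((bml_lin F).2 n).
Qed.

Lemma balhd_r n : hd_balanced (fun u w => free_diamond u (nr w n)).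
Proof.
split=> [|m u w]; last by rewrite hd_bal nlr.
split=> u; first exact: hd_lin.1.
exact: lin_ap (hd_lin.2 u) ((bmr_lin F).1 n).
Qed.

Definition hdl n (z : LL) : LL := free_diamond_lift (fun u w => free_diamond (nl n u) w) z.
Definition hdr (z : LL) n : LL := free_diamond_lift (fun u w => free_diamond u (nr w n)) z.

Lemma hdl_hd n u w : hdl n (free_diamond u w) = free_diamond (nl n u) w.
Proof. exact: hdliftE (balhd_l n). Qed.

Lemma hdr_hd n u w : hdr (free_diamond u w) n = free_diamond u (nr w n).
Proof. exact: hdliftE (balhd_r n). Qed.

Lemma hdl_lin2 n : lin (hdl n).
Proof. exact: hdlift_lin (balhd_l n). Qed.

Lemma hdr_lin1 n : lin (hdr^~ n).
Proof. exact: hdlift_lin (balhd_r n). Qed.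

Lemma lin_axpy (V W : lmodType k) (f g : V -> W) (c : k) :
  lin f -> lin g -> lin (fun z => c *: f z + g z).
Proof.
move=> fl gl d u w; rewrite fl gl !scalerDr !scalerA (mulrC c) addrACA.
by rewrite -scalerA -scalerDr.
Qed.

Lemma hdl_lin : bilin hdl.
Proof.
split=> [z c m n|]; last exact: hdl_lin2.
move: z; apply: hd_ext; first exact: hdl_lin2.
  exact: (lin_axpy c (hdl_lin2 m) (hdl_lin2 n)).
by move=> u w; rewrite !hdl_hd (bml_lin F).1 hd_lin.1.
Qed.

Lemma hdr_lin : bilin hdr.
Proof.
split=> [|z c m n]; first exact: hdr_lin1.
move: z; apply: hd_ext; first exact: hdr_lin1.
  exact: (lin_axpy c (hdr_lin1 m) (hdr_lin1 n)).
by move=> u w; rewrite !hdr_hd (bmr_lin F).2 hd_lin.2.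
Qed.

(** The outer actions on L ◇ L: s(n) on the first factor and t(n) on the second. The coproduct is a
    bimodule map for them. *)
Definition hd_bimod : bimodule N LL.
Proof.
refine (@Bimodule k N LL hdl hdr hdl_lin hdr_lin _ _ _ _ _).
- move=> m n; apply: hd_ext; [exact: lin_ap (hdl_lin2 m) (hdl_lin2 n) | exact: hdl_lin2 |].
  by move=> u w; rewrite !hdl_hd nlA.
- move=> m n; apply: hd_ext; [exact: lin_ap (hdr_lin1 n) (hdr_lin1 m) | exact: hdr_lin1 |].
  by move=> u w; rewrite !hdr_hd nrA.
- move=> m n; apply: hd_ext; [exact: lin_ap (hdl_lin2 m) (hdr_lin1 n)
    | exact: lin_ap (hdr_lin1 n) (hdl_lin2 m) |].
  by move=> u w; rewrite !(hdr_hd, hdl_hd).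
- by apply: hd_ext => [|//|u w]; [exact: hdl_lin2 | rewrite hdl_hd nl1].
- by apply: hd_ext => [|//|u w]; [exact: hdr_lin1 | rewrite hdr_hd nr1].
Defined.

End FreeTensorSquare.

Section FreeCoproduct.
Variables (k : fieldType) (H N : algebra k) (B : Type) (S : hopf_calculus H B).
Variables (T : twist N S) (L : lmodType k) (F : free_bimod T L).
Local Notation s := (hs S).
Local Notation t := (ht S).
Local Notation D := (cop S).
Local Notation a := (ta T).
Local Notation g := (tg T).
Local Notation v := (tv T).
Local Notation i := (tb T).
Local Notation nl := (bml F).
Local Notation nr := (bmr F).
Local Notation th := (fm_th F).
Local Notation va := (free_tact F).
Local Notation e := (free_base F).
Local Notation LL := (HdH e).
Local Notation hd := (free_diamond F).
Local Notation hdlift := (@free_diamond_lift _ _ _ _ _ _ _ F _).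
Local Notation balhd := (hd_balanced F).
Local Notation nl2 := (bml (hd_bimod F)).
Local Notation nr2 := (bmr (hd_bimod F)).

Lemma nl2_hd n u w : nl2 n (hd u w) = hd (nl n u) w.
Proof. exact: hdl_hd. Qed.

Lemma nr2_hd n u w : nr2 (hd u w) n = hd u (nr w n).
Proof. exact: hdr_hd. Qed.

Definition dth X : LL := \S_(x, x' <- D X) hd (th x) (th x').

Lemma dia_hd_th : dbalanced s t (fun x x' => hd (th x) (th x')).
Proof.
split; last by move=> b x y; rewrite fm_th_t fm_th_s hd_bal.
by split=> x; [apply: lin_ap ((hd_lin F).1 _) _ | apply: lin_ap ((hd_lin F).2 _) _];
  exact: fm_th_lin.
Qed.

Lemma dth_lin : lin dth.
Proof. exact: cop_lin dia_hd_th. Qed.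

Lemma dth_s b X : dth (s b * X) = nl2 (i b) (dth X).
Proof.
rewrite /dth (cop_s _ _ dia_hd_th) bml_sor; apply: so_ext => x y.
by rewrite fm_th_s nl2_hd.
Qed.

Lemma dth_t b X : dth (t b * X) = nr2 (dth X) (i b).
Proof.
rewrite /dth (cop_t _ _ dia_hd_th) bmr_sol; apply: so_ext => x y.
by rewrite fm_th_t nr2_hd.
Qed.

Lemma bal3_dth : bal3 T (fun n X m => nl2 n (nr2 (dth X) m)).
Proof.
split.
- split=> x y.
  + exact: (bml_lin (hd_bimod F)).1.
  + exact: (lin_ap ((bml_lin (hd_bimod F)).2 _)
      (lin_ap ((bmr_lin (hd_bimod F)).1 _) dth_lin)).
  + exact: (lin_ap ((bml_lin (hd_bimod F)).2 _) ((bmr_lin (hd_bimod F)).2 _)).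
- by move=> b n X m; rewrite dth_s -nlr nlA.
- by move=> b n X m; rewrite dth_t nrA.
Qed.

Definition free_Delta : L -> LL := s2val (fm_lift F bal3_dth).

Lemma fdelta_lin : lin free_Delta.
Proof. exact: (s2valP (fm_lift F bal3_dth)). Qed.

Lemma fdelta_mon n X m : free_Delta (nl n (nr (th X) m)) = nl2 n (nr2 (dth X) m).
Proof. exact: (s2valP' (fm_lift F bal3_dth)). Qed.

Lemma fdelta_monE n X m : free_Delta (nl n (nr (th X) m)) =
  \S_(x, x' <- D X) hd (nl n (th x)) (nr (th x') m).
Proof.
rewrite fdelta_mon bmr_sol bml_sor; apply: so_ext => x x'.
by rewrite nr2_hd nl2_hd.
Qed.

Lemma fdelta_nl n u : free_Delta (nl n u) = nl2 n (free_Delta u).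
Proof.
move: u; apply: (@fm_ext _ _ _ _ _ _ _ F).
- exact: lin_ap fdelta_lin ((bml_lin F).2 n).
- exact: lin_ap ((bml_lin (hd_bimod F)).2 n) fdelta_lin.
by move=> n' X m; rewrite nl_mon !fdelta_mon nlA.
Qed.

Lemma fdelta_nr n u : free_Delta (nr u n) = nr2 (free_Delta u) n.
Proof.
move: u; apply: (@fm_ext _ _ _ _ _ _ _ F).
- exact: lin_ap fdelta_lin ((bmr_lin F).1 n).
- exact: lin_ap ((bmr_lin (hd_bimod F)).1 n) fdelta_lin.
by move=> n' X m; rewrite nr_mon !fdelta_mon -nlr nrA.
Qed.

Lemma fdelta_th X : free_Delta (th X) = dth X.
Proof. by rewrite -(nr1 F (th X)) -(nl1 F (nr _ _)) fdelta_mon nr1 nl1. Qed.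

Lemma hdlift_fdelta (V : lmodType k) (f : L -> L -> V) n X m : balhd f ->
  hdlift f (free_Delta (nl n (nr (th X) m))) =
  \S_(x, x' <- D X) f (nl n (th x)) (nr (th x') m).
Proof.
move=> fb; rewrite fdelta_monE (so_lin _ _ (hdlift_lin fb)).
by apply: so_ext => x x'; rewrite hdliftE.
Qed.

Let hd_l n u w : hd (nl n u) w = nl2 n (hd u w) := esym (nl2_hd n u w).
Let hd_r n u w : hd u (nr w n) = nr2 (hd u w) n := esym (nr2_hd n u w).
Let hd_m n u w : hd (nr u n) w = hd u (nl n w) := hd_bal F n u w.

Local Notation TT := (ttens (hd_lin F) hd_l hd_r hd_m).
Local Notation jN := (ttN (hd_lin F) hd_l hd_r hd_m).
Local Notation jL := (ttL (hd_lin F) hd_l hd_r hd_m).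
Local Notation jP := (ttP (hd_lin F) hd_l hd_r hd_m).
Local Notation conv := (convol S).
Local Notation conv1 := (convol1 S).

Let jNl : lin jN := jN_lin _ _ _ _.
Let jLl : lin jL := jL_lin _ _ _ _.
Let jPl : lin jP := jP_lin _ _ _ _.
Let jNm m n : jN (m * n) = jN m * jN n := jNM _ _ _ _ m n.
Let bm : bmeas TT S := map_bmeas T jNl jNm.

Let jg X Y := jN (g X Y).
Let jv X Y := jN (v X Y).
Let jth X Y := jL (th (X * Y)).
Let cjg : conv_class bm true false jg := cls_map jNl jNm (cls_g T).
Let cjv : conv_class bm false true jv := cls_map jNl jNm (cls_v T).

Let bjth : bimod_map bm (fun X => jL (th X)).
Proof.
split; first exact: lin_ap jLl (fm_th_lin F).
  by move=> b X; rewrite fm_th_s -jN_jL.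
by move=> b X; rewrite fm_th_t -jL_jN.
Qed.

Let cjth : conv_class bm false false jth := cls_mul bjth.

(** Write θ for the generator at X Y. The product (σ θ σ^-1) (σ θ σ^-1) telescopes: σ^-1 σ = (X Y) ▷
    1 is absorbed by θ, and θ θ is the coproduct of the generator. *)
Lemma fdelta_gact : (fun X Z => jP (free_Delta (gen_act F X Z))) =
  conv (fun X Z => jL (gen_act F X Z)) (fun X Z => jL (gen_act F X Z)).
Proof.
have gE := gact_map (M := F) (phi := id) (@lin_id _ _) (fun n u => erefl)
  (fun n u => erefl) jLl (jN_jL _ _ _ _) (jL_jN _ _ _ _).
have dE := gact_map (M := hd_bimod F) fdelta_lin fdelta_nl fdelta_nr jPl
  (jN_jP _ _ _ _) (jP_jN _ _ _ _).
rewrite dE [in RHS]gE; have cgt := cls_conv cjg cjth.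
rewrite (convA cgt cjv (cls_conv cgt cjv)) -(convA cjv cgt cjv).
rewrite -(convA cjv cjg cjth).
have -> : conv jv jg = fun X Y => jN (a (X * Y) 1).
  by rewrite (conv_map S jNl jNm); apply: eq2_fun => X Y; congr jN; apply: tv_tg.
rewrite (conv_1l bjth) (convA cjg cjth (cls_conv cjth cjv)).
rewrite -(convA cjth cjth cjv) -(convA cjg (cls_conv cjth cjth) cjv).
congr (conv (conv jg _) jv); rewrite (conv_mul bjth bjth); apply: eq2_fun => X Y.
rewrite fdelta_th (so_lin _ _ jPl); apply: so_ext => x x'.
exact/esym/jL_jL.
Qed.

Lemma conv1_suml (K : Type) (r : sumop k K) (f : K -> K -> H -> TT) (f' : H -> TT) :
  conv1 (fun x => \S_(z, z' <- r) f z z' x) f' =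
  fun x => \S_(z, z' <- r) conv1 (f z z') f' x.
Proof.
apply/funext => X; rewrite so_swap; apply: so_ext => x x'.
by rewrite so_mulrl.
Qed.

Lemma conv1_sumr (K : Type) (r : sumop k K) (f : K -> K -> H -> TT) (f' : H -> TT) :
  conv1 f' (fun x => \S_(z, z' <- r) f z z' x) =
  fun x => \S_(z, z' <- r) conv1 f' (f z z') x.
Proof.
apply/funext => X; rewrite so_swap; apply: so_ext => x x'.
by rewrite so_mulrr.
Qed.

Definition va2 X u w : LL := \S_(x, x' <- D X) hd (va x u) (va x' w).

(** An element c between the factors becomes X_(2) ▷ c between X_(1) ▶ u and X_(3) ▶ w, whichever
    factor it started from. *)
Lemma balhd_va2 X : balhd (va2 X).
Proof.
have h1 := (hd_lin F).1; have h2 := (hd_lin F).2.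
split=> [|c u w].
  split=> u; apply: lin_so => x x'; [apply: lin_ap (h1 _) _ | apply: lin_ap (h2 _) _];
  exact: fva_lin2.
transitivity (\S_(x, x' <- D X) \S_(x1, x2 <- D x)
    hd (va x1 u) (nl (a x2 c) (va x' w))).
  apply: so_ext => x x'; rewrite fva_r (so_lin _ _ (h1 _)).
  by apply: so_ext => x1 x2; rewrite hd_bal.
rewrite (copA (f := fun x y z => hd (va x u) (nl (a y c) (va z w)))).
- by apply: so_ext => x x'; rewrite fva_l (so_lin _ _ (h2 _)).
- split=> x y.
  + exact: lin_ap (h1 _) ((fva_lin F).1 u).
  + exact: lin_ap (h2 _) (lin_ap ((bml_lin F).1 _) ((ta_lin T).1 c)).
  + exact: lin_ap (h2 _) (lin_ap ((bml_lin F).2 _) ((fva_lin F).1 w)).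
- by move=> b x y z; rewrite fva_t hd_bal nlA ta_s.
- by move=> b x y z; rewrite ta_t fva_s nlA.
Qed.

Let jA n X := jN (a X n).
Let jG Z X := jL (gen_act F X Z).

Let bA n : bimod_map bm (jA n) := bim_map jNl jNm (bim_a T n).

Let bG Z : bimod_map bm (jG Z).
Proof.
split.
- exact: lin_ap jLl ((gact_lin F).1 Z).
- by move=> b X; rewrite /jG gact_s -jN_jL.
- by move=> b X; rewrite /jG gact_t -jL_jN.
Qed.

(** Left multiplication by a generator is ▶, so multiplicativity of the coproduct comes down to
    this. In the truncated tensor algebra both sides are, by [fdelta_gact], the same product of four
    factors with different brackets. *)
Lemma fdelta_va X u : free_Delta (va X u) = hdlift (va2 X) (free_Delta u).
Proof.
move: u; apply: (@fm_ext _ _ _ _ _ _ _ F).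
- exact: lin_ap fdelta_lin (fva_lin2 F X).
- exact: lin_ap (hdlift_lin (balhd_va2 X)) fdelta_lin.
move=> n Z m; rewrite (hdlift_fdelta _ _ _ (balhd_va2 X)) fva_mon.
apply: (@jP_inj _ _ _ _ _ _ _ (hd_lin F) hd_l hd_r hd_m).
rewrite (free_act_map (M := hd_bimod F) fdelta_lin fdelta_nl fdelta_nr jPl
  (jN_jP _ _ _ _) (jP_jN _ _ _ _)).
have -> : (fun x => jP (free_Delta (gen_act F x Z))) =
    fun x => \S_(z, z' <- D Z) conv1 (jG z) (jG z') x.
  by apply/funext => x; exact: (congr1 (fun G => G x Z) fdelta_gact).
rewrite conv1_sumr conv1_suml (so_lin _ _ jPl); apply: so_ext => z z'.
have lE : (fun x => jL (va x (nl n (th z)))) = conv1 (jA n) (jG z).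
  apply/funext => x; rewrite fva_l (so_lin _ _ jLl); apply: so_ext => y y'.
  by rewrite fva_th -jN_jL.
have rE : (fun x => jL (va x (nr (th z') m))) = conv1 (jG z') (jA m).
  apply/funext => x; rewrite fva_r (so_lin _ _ jLl); apply: so_ext => y y'.
  by rewrite fva_th -jL_jN.
transitivity (conv1 (conv1 (jA n) (jG z)) (conv1 (jG z') (jA m)) X).
  rewrite -(conv1A (bim_conv1 (bA n) (bG z)) (bG z') (bA m)).
  by rewrite (conv1A (bA n) (bG z) (bG z')).
rewrite -lE -rE (so_lin _ _ jPl); apply: so_ext => x x'.
exact: jL_jL.
Qed.

End FreeCoproduct.

(** * The left bialgebroid structure of the free twisted module *)

Section FreeBialgebroid.
Variables (k : fieldType) (H N : algebra k) (B : Type) (S : hopf_calculus H B).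
Variables (T : twist N S) (L : lmodType k) (F : free_bimod T L).
Local Notation D := (cop S).
Local Notation a := (ta T).
Local Notation nl := (bml F).
Local Notation nr := (bmr F).
Local Notation th := (fm_th F).
Local Notation va := (free_tact F).
Local Notation A := (free_algebra F).
Local Notation e := (free_base F).
Local Notation LL := (HdH e).
Local Notation hd := (free_diamond F).
Local Notation hdlift := (@free_diamond_lift _ _ _ _ _ _ _ F _).
Local Notation balhd := (hd_balanced F).
Local Notation nl2 := (bml (hd_bimod F)).
Local Notation nr2 := (bmr (hd_bimod F)).
Local Notation fmul := (free_mul F).
Local Notation fdelta := (free_Delta F).

Let h1 := (hd_lin F).1.
Let h2 := (hd_lin F).2.

Lemma hdlift_so (V : lmodType k) (f : L -> L -> V) z :
  hdlift f z = \S_(u, w <- tsum z) f u w.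
Proof. by []. Qed.

Lemma hdlift_ext (V : lmodType k) (f f' : L -> L -> V) z :
  (forall u w, f u w = f' u w) -> hdlift f z = hdlift f' z.
Proof. by move=> ff'; rewrite !hdlift_so; apply: so_ext. Qed.

Lemma lin_hdlift (U V : lmodType k) (f : U -> L -> L -> V) z :
  (forall u w, lin (fun x => f x u w)) -> lin (fun x => hdlift (f x) z).
Proof. by move=> fl; apply: (@lin_so k L V U (tsum z) f). Qed.

(** On n ⊗ X ⊗ m both sides become the generators n ⊗ X_(1) ⊗ 1 and 1 ⊗ X_(3) ⊗ m with X_(2) ▷ c
    inserted between them: a base element multiplied from the right is acted on before it reaches
    the middle. *)
Lemma fdelta_takeuchi u c :
  hdlift (fun x y => hd (fmul x (nr (th 1) c)) y) (fdelta u) =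
  hdlift (fun x y => hd x (fmul y (nl c (th 1)))) (fdelta u).
Proof.
have b1 : balhd (fun x y => hd (fmul x (nr (th 1) c)) y).
  split=> [|n x y]; last by rewrite fmul_nr hd_bal.
  by split=> x; [exact: lin_ap (h1 _) (fmul_linl F _) | exact: h2].
have b2 : balhd (fun x y => hd x (fmul y (nl c (th 1)))).
  split=> [|n x y]; last by rewrite fmul_nl hd_bal.
  by split=> x; [exact: h1 | exact: lin_ap (h2 _) (fmul_linl F _)].
move: u; apply: (@fm_ext _ _ _ _ _ _ _ F).
- exact: lin_ap (hdlift_lin b1) (fdelta_lin F).
- exact: lin_ap (hdlift_lin b2) (fdelta_lin F).
move=> n X m; rewrite (hdlift_fdelta _ _ _ b1) (hdlift_fdelta _ _ _ b2).
transitivity (\S_(x, x' <- D X) \S_(x1, x2 <- D x)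
    hd (nl n (th x1)) (nl (a x2 c) (nr (th x') m))).
  apply: so_ext => x x'; rewrite fmul_nl fmul_th fva_r bml_sor (so_lin _ _ (h1 _)).
  by apply: so_ext => x1 x2; rewrite fva_th gact_X1 nlr hd_bal.
rewrite (copA (f := fun x y z => hd (nl n (th x)) (nl (a y c) (nr (th z) m)))).
- apply: so_ext => x x'; rewrite fmul_nr fmul_th fva_l bmr_sol (so_lin _ _ (h2 _)).
  by apply: so_ext => x1 x2; rewrite fva_th gact_X1 nlr.
- split=> x y.
  + exact: lin_ap (h1 _) (lin_ap ((bml_lin F).2 _) (fm_th_lin F)).
  + exact: lin_ap (h2 _) (lin_ap ((bml_lin F).1 _) ((ta_lin T).1 c)).
  + exact: lin_ap (h2 _) (lin_ap ((bml_lin F).2 _)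
      (lin_ap ((bmr_lin F).1 _) (fm_th_lin F))).
- by move=> b x y z; rewrite fm_th_t nlr hd_bal nlA ta_s.
- by move=> b x y z; rewrite ta_t fm_th_s -nlr nlA.
Qed.

Lemma fdelta_1 : fdelta (th 1) = hd (th 1) (th 1).
Proof. by rewrite fdelta_th /dth (cop_1 (dia_hd_th F)). Qed.

Lemma nl2_so (K : Type) (r : sumop k K) n m (f : K -> K -> LL) :
  nl2 n (nr2 (\S_(x, y <- r) f x y) m) = \S_(x, y <- r) nl2 n (nr2 (f x y) m).
Proof. by rewrite bmr_sol bml_sor. Qed.

Lemma fdelta_mul u w : fdelta (fmul u w) =
  hdlift (fun x y => hdlift (fun x' y' => hd (fmul x x') (fmul y y')) (fdelta w))
    (fdelta u).
Proof.
have bb : balhd (fun x y =>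
    hdlift (fun x' y' => hd (fmul x x') (fmul y y')) (fdelta w)).
  split=> [|n x y]; last first.
    by apply: hdlift_ext => x' y'; rewrite fmul_nr fmul_nl hd_bal.
  split=> x; apply: lin_hdlift => x' y'.
    exact: lin_ap (h1 _) (fmul_linl F _).
  exact: lin_ap (h2 _) (fmul_linl F _).
move: u; apply: (@fm_ext _ _ _ _ _ _ _ F).
- exact: lin_ap (fdelta_lin F) (fmul_linl F w).
- exact: lin_ap (hdlift_lin bb) (fdelta_lin F).
move=> n X m; rewrite (hdlift_fdelta _ _ _ bb) fmul_mon fdelta_nl fdelta_nr fdelta_va.
rewrite hdlift_so nl2_so.
transitivity (\S_(u, v <- tsum (fdelta w)) \S_(x, x' <- D X)
    hd (nl n (va x u)) (nr (va x' v) m)).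
  apply: so_ext => u v; rewrite nl2_so; apply: so_ext => x x'.
  by rewrite nr2_hd nl2_hd.
rewrite so_swap; apply: so_ext => x x'; apply: so_ext => u v.
by rewrite fmul_nl fmul_nr !fmul_th.
Qed.

Definition hh (z : LL) (u : L) : HdHdH e :=
  pure (fun n (z : LL) => hdlift (fun x y => hd x (tgt e n * (y : A))) z)
    (fun n (u : A) => src e n * u) z u.

Lemma hh_lin : bilin hh.
Proof.
exact: (balan_pure (fun n (z : LL) => hdlift (fun x y => hd x (tgt e n * (y : A))) z)
  (fun n (u : A) => src e n * u)).1.
Qed.

Lemma hh_bal n z u : hh (nr2 z n) u = hh z (nl n u).
Proof.
have [_ hb] := balan_pure
  (fun n (z : LL) => hdlift (fun x y => hd x (tgt e n * (y : A))) z)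
  (fun n (u : A) => src e n * u).
have := hb n z u; rewrite [src e n * u]free_srcM => hE.
rewrite [RHS](esym hE); congr hh; apply: hdlift_ext => x y.
by rewrite [tgt e n * (y : A)]free_tgtM.
Qed.

Lemma fdelta_coassoc u :
  hdlift (fun x y => hh (fdelta x) y) (fdelta u) =
  hdlift (fun x y => hdlift (fun x' y' => hh (hd x x') y') (fdelta y)) (fdelta u).
Proof.
have bb x : balhd (fun x' y' => hh (hd x x') y').
  split=> [|n x' y']; last by rewrite -nr2_hd hh_bal.
  by split=> x'; [exact: lin_ap (hh_lin.1 _) (h2 _) | exact: hh_lin.2].
have b1 : balhd (fun x y => hh (fdelta x) y).
  split=> [|n x y]; last by rewrite fdelta_nr hh_bal.
  by split=> x; [exact: lin_ap (hh_lin.1 _) (fdelta_lin F) | exact: hh_lin.2].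
have b2 : balhd (fun x y => hdlift (fun x' y' => hh (hd x x') y') (fdelta y)).
  split=> [|n x y]; first split=> x.
  - by apply: lin_hdlift => x' y'; exact: lin_ap (hh_lin.1 _) (h1 _).
  - exact: lin_ap (hdlift_lin (bb x)) (fdelta_lin F).
  rewrite fdelta_nl; move: (fdelta y); apply: hd_ext.
  - exact: hdlift_lin.
  - exact: lin_ap (hdlift_lin (bb x)) ((bml_lin (hd_bimod F)).2 n).
  by move=> x' y'; rewrite nl2_hd !hdliftE // hd_bal.
move: u; apply: (@fm_ext _ _ _ _ _ _ _ F).
- exact: lin_ap (hdlift_lin b1) (fdelta_lin F).
- exact: lin_ap (hdlift_lin b2) (fdelta_lin F).
move=> n X m; rewrite (hdlift_fdelta _ _ _ b1) (hdlift_fdelta _ _ _ b2).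
transitivity (\S_(x, x' <- D X) \S_(x1, x2 <- D x)
    hh (hd (nl n (th x1)) (th x2)) (nr (th x') m)).
  apply: so_ext => x x'; rewrite fdelta_nl fdelta_th bml_sor (so_lin _ _ (hh_lin.1 _)).
  by apply: so_ext => x1 x2; rewrite nl2_hd.
rewrite (copA (f := fun x y z => hh (hd (nl n (th x)) (th y)) (nr (th z) m))).
- apply: so_ext => x x'; rewrite fdelta_nr fdelta_th bmr_sol.
  rewrite (so_lin _ _ (hdlift_lin (bb _))); apply: so_ext => x1 x2.
  by rewrite nr2_hd hdliftE.
- split=> x y.
  + exact: lin_ap (hh_lin.1 _) (lin_ap (h1 _) (lin_ap ((bml_lin F).2 _) (fm_th_lin F))).
  + exact: lin_ap (hh_lin.1 _) (lin_ap (h2 _) (fm_th_lin F)).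
  + exact: lin_ap (hh_lin.2 _) (lin_ap ((bmr_lin F).1 _) (fm_th_lin F)).
- by move=> b x y z; rewrite fm_th_t fm_th_s nlr hd_bal.
- by move=> b x y z; rewrite fm_th_t fm_th_s -nlr -hh_bal nr2_hd.
Qed.

Definition fcounit : L -> N := orbit F (reg_tmod T) 1.

Lemma fcounit_lin : lin fcounit.
Proof. exact: orbit_lin. Qed.

Lemma fcounit_nl n u : fcounit (nl n u) = n * fcounit u.
Proof. exact: orbit_nl. Qed.

Lemma fcounit_nr n u : fcounit (nr u n) = fcounit u * n.
Proof. exact: orbit_nr. Qed.

Lemma fcounit_th X : fcounit (th X) = a X 1.
Proof. exact: orbit_th. Qed.

Lemma fcounit_va X u : fcounit (va X u) = a X (fcounit u).
Proof. exact: orbit_va. Qed.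

(** Since w enters only through ε(w), the axioms ε(u ε(w)) = ε(u w), for the source and for the
    target, reduce to comparing the counits of the right factors. *)
Lemma fcounit_mul u w : fcounit (fmul u w) = orbit F (reg_tmod T) (fcounit w) u.
Proof.
move: u; apply: (@fm_ext _ _ _ _ _ _ _ F).
- exact: lin_ap fcounit_lin (fmul_linl F w).
- exact: orbit_lin.
by move=> n X m; rewrite fmul_mon fcounit_nl fcounit_nr fcounit_va orbit_mon.
Qed.

Lemma fcounitl u : hdlift (fun x y => nl (fcounit x) y) (fdelta u) = u.
Proof.
have bb : balhd (fun x y => nl (fcounit x) y).
  split=> [|n x y]; last by rewrite fcounit_nr nlA.
  by split=> x; [exact: lin_ap ((bml_lin F).1 _) fcounit_lin | exact: (bml_lin F).2].
move: u; apply: (@fm_ext _ _ _ _ _ _ _ F) => [|//|n X m].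
  exact: lin_ap (hdlift_lin bb) (fdelta_lin F).
rewrite (hdlift_fdelta _ _ _ bb).
have tl : lin (fun x => nl n (nr (th x) m)).
  exact: lin_ap ((bml_lin F).2 _) (lin_ap ((bmr_lin F).1 _) (fm_th_lin F)).
rewrite -[RHS](cop_epl S X tl); apply: so_ext => x x'.
by rewrite fcounit_nl fcounit_th ta_unit -nlA nlr -fm_th_s.
Qed.

Lemma fcounitr u : hdlift (fun x y => nr x (fcounit y)) (fdelta u) = u.
Proof.
have bb : balhd (fun x y => nr x (fcounit y)).
  split=> [|n x y]; last by rewrite fcounit_nl nrA.
  by split=> x; [exact: (bmr_lin F).1 | exact: lin_ap ((bmr_lin F).2 _) fcounit_lin].
move: u; apply: (@fm_ext _ _ _ _ _ _ _ F) => [|//|n X m].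
  exact: lin_ap (hdlift_lin bb) (fdelta_lin F).
rewrite (hdlift_fdelta _ _ _ bb).
have tl : lin (fun x => nl n (nr (th x) m)).
  exact: lin_ap ((bml_lin F).2 _) (lin_ap ((bmr_lin F).1 _) (fm_th_lin F)).
rewrite -[RHS](cop_epr S X tl); apply: so_ext => x x'.
by rewrite fcounit_nr fcounit_th ta_unit -nrA -nlr -fm_th_t nlr.
Qed.

Definition free_delta : {linear A -> LL} := linear_of (fdelta_lin F : @lin k A LL _).
Definition free_counit : {linear A -> N} := linear_of (fcounit_lin : @lin k A N _).

Definition free_bialgebroid : left_bialgebroid N A.
Proof.
refine (@LeftBialgebroid k N A e free_delta free_counit
  _ _ _ _ _ _ _ _ _ _ _).
- move=> u c; exact: (fdelta_takeuchi u c).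
- exact: fdelta_1.
- exact: fdelta_mul.
- exact: fdelta_coassoc.
- move=> b c u.
  rewrite -mulrA [X in free_delta X]free_srcM [X in nl _ X]free_tgtM.
  rewrite [LHS]fdelta_nl fdelta_nr.
  rewrite [LHS](lin_tlift (lin_ap ((bml_lin (hd_bimod F)).2 b) ((bmr_lin (hd_bimod F)).1 c))).
  apply: (hdlift_ext (f := fun x y => nl2 b (nr2 (hd x y) c))
    (f' := fun x y => hd (src e b * (x : A)) (tgt e c * (y : A)))) => x y.
  by rewrite [src e b * (x : A)]free_srcM [tgt e c * (y : A)]free_tgtM nr2_hd nl2_hd.
- move=> b c u; rewrite -mulrA [X in free_counit X]free_srcM [X in nl _ X]free_tgtM.
  by rewrite [LHS]fcounit_nl fcounit_nr mulrA.
- move=> u; rewrite -[RHS](fcounitl u).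
  apply: (hdlift_ext (f := fun x y => src e (fcounit x) * (y : A))
    (f' := fun x y => nl (fcounit x) y)) => x y; exact: free_srcM.
- move=> u; rewrite -[RHS](fcounitr u).
  apply: (hdlift_ext (f := fun x y => tgt e (fcounit y) * (x : A))
    (f' := fun x y => nr x (fcounit y))) => x y; exact: free_tgtM.
- by rewrite [LHS]fcounit_th ta_1.
- move=> u w; rewrite [LHS]fcounit_mul [RHS]fcounit_mul.
  by congr orbit; rewrite [LHS]fcounit_nl fcounit_th ta_1 mulr1.
- move=> u w; rewrite [LHS]fcounit_mul [RHS]fcounit_mul.
  by congr orbit; rewrite [LHS]fcounit_nr fcounit_th ta_1 mul1r.
Defined.

End FreeBialgebroid.

Lemma lin_linear (k : fieldType) (V W : lmodType k) (f : {linear V -> W}) : lin f.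
Proof. by move=> c u v; rewrite linearP. Qed.

(** * Hopf algebroids as Sweedler calculi *)

Section BialgebroidCalculus.
Variables (k : fieldType) (B H : algebra k) (h : left_bialgebroid B H).
Local Notation s := (src h).
Local Notation t := (tgt h).
Local Notation D := (fun X => tsum (Delta h X)).
Local Notation dia := (dbalanced s t).
Implicit Types (b c : B) (X Y : H).

Lemma lb_pure_dia : dia (fun x y => (x ⊗ y : HdH h)).
Proof. exact: balan_pure. Qed.

Section Values.
Variables (V : lmodType k) (f : H -> H -> V).
Hypothesis fd : dia f.

Lemma lb_cop_lin : lin (fun X => so (D X) f).
Proof. exact: lin_ap (tlift_lin fd) (lin_linear (Delta h)). Qed.

Lemma lb_cop_1 : so (D 1) f = f 1 1.
Proof. by rewrite /= Delta1 (tliftE _ _ fd). Qed.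

Lemma lb_cop_base b c X : so (D (s b * t c * X)) f =
  \S_(x, y <- D X) f (s b * x) (t c * y).
Proof.
rewrite /= Delta_base.
rewrite [LHS](so_lin (tsum (Delta h X)) (fun x y => (s b * x ⊗ t c * y : HdH h))
  (tlift_lin fd)).
by apply: so_ext => x y; rewrite (tliftE _ _ fd).
Qed.

Lemma lb_cop_s b X : so (D (s b * X)) f = \S_(x, y <- D X) f (s b * x) y.
Proof.
have [t1 _] := tgt_morph h.
rewrite -[s b]mulr1 -[X in s b * X]t1 lb_cop_base.
by apply: so_ext => x y; rewrite [t 1]t1 mulr1 mul1r.
Qed.

Lemma lb_cop_t b X : so (D (t b * X)) f = \S_(x, y <- D X) f x (t b * y).
Proof.
have [s1 _] := src_morph h.
rewrite -[t b]mul1r -[X in X * t b]s1 lb_cop_base.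
by apply: so_ext => x y; rewrite s1 !mul1r.
Qed.

Lemma lb_cop_mul X Y : so (D (X * Y)) f =
  \S_(y, y' <- D Y) \S_(x, x' <- D X) f (x * y) (x' * y').
Proof.
rewrite [RHS]so_swap /= DeltaM.
rewrite [LHS](so_lin (tsum (Delta h X)) (fun x x' =>
  \sw_(y, y' <- Delta h Y) (x * y ⊗ x' * y' : HdH h)) (tlift_lin fd)).
apply: so_ext => x x'.
rewrite (so_lin (tsum (Delta h Y)) (fun y y' => (x * y ⊗ x' * y' : HdH h))
  (tlift_lin fd)).
by apply: so_ext => y y'; rewrite (tliftE _ _ fd).
Qed.

Lemma lb_cop_tak b X :
  \S_(x, y <- D X) f (x * t b) y = \S_(x, y <- D X) f x (y * s b).
Proof.
have := congr1 (fun z => tlift z f) (Delta_takeuchi h X b).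
rewrite (so_lin (tsum (Delta h X)) (fun x y => (x * t b ⊗ y : HdH h)) (tlift_lin fd)).
rewrite (so_lin (tsum (Delta h X)) (fun x y => (x ⊗ y * s b : HdH h)) (tlift_lin fd)).
under so_ext => x y do rewrite (tliftE _ _ fd).
by under [X in _ = X -> _]so_ext => x y do rewrite (tliftE _ _ fd).
Qed.

Lemma lb_dia_mul y y' : dia (fun x x' => f (x * y) (x' * y')).
Proof. by case: fd => fl fb; bal; rewrite -!mulrA fb. Qed.

End Values.

(** The counterpart of [dia_cop_mul] for a bare bialgebroid: [hopf_calculus] already contains
    translation maps, while here the Galois maps have yet to be shown well defined. *)
Lemma lb_dia_cop_mul (V : lmodType k) (f : H -> H -> V) X : dia f ->
  dia (fun y y' => \S_(x, x' <- D X) f (x * y) (x' * y')).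
Proof.
move=> fd; have [fl fb] := fd; bal.
under so_ext do rewrite mulrA.
rewrite (lb_cop_tak (lb_dia_mul fd _ _)).
by apply: so_ext => x x'; rewrite mulrA.
Qed.

Lemma lb_cop_sr (V : lmodType k) (f : H -> H -> V) b X : dia f ->
  so (D (X * s b)) f = \S_(x, y <- D X) f (x * s b) y.
Proof.
move=> fd; have [Fl Fb] := lb_dia_cop_mul X fd.
rewrite lb_cop_mul // -[s b]mulr1 (lb_cop_s (lb_dia_cop_mul X fd)) lb_cop_1.
  by apply: so_ext => x x'; rewrite !mulr1.
split=> [|c x y]; first by split=> x; [apply: lin_ap (Fl.1 _) _; bal | exact: Fl.2].
by rewrite mulrA src_tgt_comm -mulrA Fb.
Qed.

Lemma lb_cop_tr (V : lmodType k) (f : H -> H -> V) b X : dia f ->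
  so (D (X * t b)) f = \S_(x, y <- D X) f x (y * t b).
Proof.
move=> fd; have [Fl Fb] := lb_dia_cop_mul X fd.
rewrite lb_cop_mul // -[t b]mulr1 (lb_cop_t (lb_dia_cop_mul X fd)) lb_cop_1.
  by apply: so_ext => x x'; rewrite !mulr1.
split=> [|c x y]; first by split=> x; [exact: Fl.1 | apply: lin_ap (Fl.2 _) _; bal].
by rewrite mulrA -src_tgt_comm -mulrA Fb.
Qed.

Lemma lb_copA (V : lmodType k) (f : H -> H -> H -> V) X : trilin f ->
  (forall b x y z, f (t b * x) y z = f x (s b * y) z) ->
  (forall b x y z, f x (t b * y) z = f x y (s b * z)) ->
  \S_(x, x' <- D X) \S_(y, z <- D x) f y z x' =
  \S_(x, x' <- D X) \S_(y, z <- D x') f x y z.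
Proof.
move=> fl fb fb'; have [f1 f2 f3] := fl.
have fd x : dia (fun y z => f y z x) by split; [split=> y | move=> b y z].
have fo : balan (fun b (u : HdH h) => \sw_(x, y <- u) (x ⊗ (t b * y) : HdH h))
    (fun b (Z : H) => s b * Z) (fun (u : HdH h) z => tlift u (fun x y => f x y z)).
  split=> [|b u z].
    split=> x; first exact: tlift_lin (fd x).
    by apply: (@lin_so _ _ _ _ (tsum x) (fun z x y => f x y z)) => y z; bal.
  rewrite (so_lin (tsum u) (fun x y => (x ⊗ (t b * y) : HdH h)) (tlift_lin (fd z))).
  by apply: so_ext => x y; rewrite (tliftE _ _ (fd z)).
have := congr1 (fun w => tlift w (fun (u : HdH h) z => tlift u (fun x y => f x y z)))
  (Delta_coassoc h X).
rewrite (so_lin (tsum (Delta h X)) (fun x x' => (Delta h x ⊗ x' : HdHdH h)) (tlift_lin fo)).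
under so_ext => x x' do rewrite (tliftE _ _ fo).
move=> ->.
rewrite (so_lin (tsum (Delta h X)) (fun x x' => \sw_(y, z <- Delta h x')
  ((x ⊗ y : HdH h) ⊗ z : HdHdH h)) (tlift_lin fo)).
apply: so_ext => x x'.
rewrite (so_lin (tsum (Delta h x')) (fun y z => ((x ⊗ y : HdH h) ⊗ z : HdHdH h))
  (tlift_lin fo)).
by apply: so_ext => y z; rewrite (tliftE _ _ fo) (tliftE _ _ (fd z)).
Qed.

Lemma lb_counit_s : lin (fun X => s (counit h X)).
Proof. exact: lin_ap (lin_linear _) (lin_linear _). Qed.

Lemma lb_counit_t : lin (fun X => t (counit h X)).
Proof. exact: lin_ap (lin_linear _) (lin_linear _). Qed.

Definition lamf X Y : HdH h := \S_(x, x' <- D X) (x ⊗ x' * Y : HdH h).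
Definition muf X Y : HdH h := \S_(x, x' <- D X) (x * Y ⊗ x' : HdH h).

Lemma lb_dia_mulr (V : lmodType k) (f : H -> H -> V) Y : dia f ->
  dia (fun x y => f x (y * Y)).
Proof. by case=> fl fb; bal; rewrite fb mulrA. Qed.

Lemma lb_dia_mull (V : lmodType k) (f : H -> H -> V) Y : dia f ->
  dia (fun x y => f (x * Y) y).
Proof. by case=> fl fb; bal; rewrite -mulrA fb. Qed.

Lemma lamf_bal : balan (fun b (X : H) => X * t b) (fun b (Y : H) => t b * Y) lamf.
Proof.
have dY Y := lb_dia_mulr Y lb_pure_dia.
have [pl _] := lb_pure_dia.
split=> [|b X Y].
  split=> x; first exact: lb_cop_lin (dY x).
  by apply: lin_so => y y'; apply: lin_ap (pl.2 _) _; bal.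
rewrite /lamf (lb_cop_tr _ _ (dY Y)).
by apply: so_ext => x y; rewrite mulrA.
Qed.

Lemma muf_bal : balan (fun b (X : H) => X * s b) (fun b (Y : H) => s b * Y) muf.
Proof.
have dY Y := lb_dia_mull Y lb_pure_dia.
have [pl _] := lb_pure_dia.
split=> [|b X Y].
  split=> x; first exact: lb_cop_lin (dY x).
  by apply: lin_so => y y'; apply: lin_ap (pl.1 _) _; bal.
rewrite /muf (lb_cop_sr _ _ (dY Y)).
by apply: so_ext => x y; rewrite mulrA.
Qed.

Lemma lam_lin : lin (@lam _ _ _ h).
Proof. exact: tlift_lin lamf_bal. Qed.

Lemma mu_lin : lin (@mu _ _ _ h).
Proof. exact: tlift_lin muf_bal. Qed.

Lemma lamE X Y : lam (X ⊗ Y : HobH h) = lamf X Y.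
Proof. exact: tliftE lamf_bal. Qed.

Lemma muE X Y : mu (X ⊗ Y : HoH h) = muf X Y.
Proof. exact: tliftE muf_bal. Qed.

End BialgebroidCalculus.

Section HopfAlgebroidCalculus.
Variables (k : fieldType) (B H : algebra k) (h : hopf_algebroid B H).
Local Notation s := (src h).
Local Notation t := (tgt h).
Local Notation D := (fun X => tsum (Delta h X)).
Local Notation P := (fun X => tsum (transl h X)).
Local Notation Q := (fun X => tsum (translb h X)).
Local Notation lamb := (@lam _ _ _ h).
Local Notation mub := (@mu _ _ _ h).
Implicit Types (b c : B) (X Y : H).

Lemma lam_transl X : lam (transl h X) = X ⊗ 1.
Proof.
have [g _ gK] := lam_bij h.
exact: (xgetPex 0 (P := [set u | lamb u = X ⊗ 1]) (ex_intro _ (g (X ⊗ 1)) (gK _))).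
Qed.

Lemma mu_translb X : mu (translb h X) = 1 ⊗ X.
Proof.
have [g _ gK] := mu_bij h.
exact: (xgetPex 0 (P := [set u | mub u = 1 ⊗ X]) (ex_intro _ (g (1 ⊗ X)) (gK _))).
Qed.

Lemma transl_lin : lin (transl h).
Proof.
move=> c X Y; apply: (bij_inj (lam_bij h)); rewrite lam_lin !lam_transl.
by have [[pl _] _] := lb_pure_dia h; rewrite pl.
Qed.

Lemma translb_lin : lin (translb h).
Proof.
move=> c X Y; apply: (bij_inj (mu_bij h)); rewrite mu_lin !mu_translb.
by have [[_ pl] _] := lb_pure_dia h; rewrite pl.
Qed.

Lemma lam_sum (K : Type) (r : sumop k K) (f : K -> K -> HobH h) :
  lam (\S_(x, y <- r) f x y) = \S_(x, y <- r) lam (f x y).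
Proof. exact: so_lin (lam_lin (h := h)). Qed.

Lemma mu_sum (K : Type) (r : sumop k K) (f : K -> K -> HoH h) :
  mu (\S_(x, y <- r) f x y) = \S_(x, y <- r) mu (f x y).
Proof. exact: so_lin (mu_lin (h := h)). Qed.

Lemma ha_trK (V : lmodType k) (f : H -> H -> V) X : dbalanced s t f ->
  \S_(x, y <- P X) \S_(x1, x2 <- D x) f x1 (x2 * y) = f X 1.
Proof.
move=> fd; rewrite -(tliftE (f := f) X 1 fd) -lam_transl.
rewrite [RHS](so_lin (P X) _ (tlift_lin fd)); apply: so_ext => x y.
rewrite (so_lin (D x) (fun x1 x2 => (x1 ⊗ x2 * y : HdH h)) (tlift_lin fd)).
by apply: so_ext => x1 x2; rewrite (tliftE _ _ fd).
Qed.

Lemma ha_trbK (V : lmodType k) (f : H -> H -> V) X : dbalanced t s f ->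
  \S_(x, y <- Q X) \S_(x1, x2 <- D x) f x2 (x1 * y) = f X 1.
Proof.
move=> /dia_flip fd; rewrite -(tliftE (f := fun x y => f y x) 1 X fd) -mu_translb.
rewrite [RHS](so_lin (Q X) _ (tlift_lin fd)); apply: so_ext => x y.
rewrite (so_lin (D x) (fun x1 x2 => (x1 * y ⊗ x2 : HdH h)) (tlift_lin fd)).
by apply: so_ext => x1 x2; rewrite (tliftE _ _ fd).
Qed.

Lemma lam_mulr X Y : \S_(x, y <- P X) lamf h x (y * Y) = (X ⊗ Y : HdH h).
Proof.
have fd := lb_dia_mulr Y (lb_pure_dia h).
rewrite -[RHS](congr1 (fun y => (X ⊗ y : HdH h)) (mul1r Y)) -(ha_trK X fd).
by apply: so_ext => x y; apply: so_ext => x1 x2; rewrite mulrA.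
Qed.

Lemma mu_mulr X Y : \S_(x, y <- Q X) muf h x (y * Y) = (Y ⊗ X : HdH h).
Proof.
have fd := dia_flip (lb_dia_mull Y (lb_pure_dia h)).
rewrite -[RHS](congr1 (fun y => (y ⊗ X : HdH h)) (mul1r Y)) -(ha_trbK X fd).
by apply: so_ext => x y; apply: so_ext => x1 x2; rewrite mulrA.
Qed.

(** The inverse of λ is not explicit, so the two sides are compared after applying λ, where
    [lam_mulr] evaluates the sums over X_+ ⊗ X_-. [Delta_transl] is obtained in the same way. *)
Lemma transl_t b X :
  transl h (t b * X) = \S_(x, y <- P X) (x ⊗ y * s b : HobH h).
Proof.
apply: (bij_inj (lam_bij h)); rewrite lam_transl lam_sum.
under [RHS]so_ext => x y do rewrite lamE.
by rewrite lam_mulr; have [_ ->] := lb_pure_dia h; rewrite mulr1.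
Qed.

Lemma translb_s b X :
  translb h (s b * X) = \S_(x, y <- Q X) (x ⊗ y * t b : HoH h).
Proof.
apply: (bij_inj (mu_bij h)); rewrite mu_translb mu_sum.
under [RHS]so_ext => x y do rewrite muE.
by rewrite mu_mulr; have [_ <-] := lb_pure_dia h; rewrite mulr1.
Qed.

Lemma Delta_transl X :
  \S_(x, x' <- D X) \S_(p, q <- P x) (p ⊗ q * x' : HobH h) = X ⊗ 1.
Proof.
apply: (bij_inj (lam_bij h)); rewrite lam_sum lamE.
apply: so_ext => x x'; rewrite mulr1 lam_sum.
by under so_ext => p q do rewrite lamE; rewrite lam_mulr.
Qed.

Lemma Delta_translb X :
  \S_(x, x' <- D X) \S_(p, q <- Q x') (p ⊗ q * x : HoH h) = X ⊗ 1.
Proof.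
apply: (bij_inj (mu_bij h)); rewrite mu_sum muE.
apply: so_ext => x x'; rewrite mulr1 mu_sum.
by under so_ext => p q do rewrite muE; rewrite mu_mulr.
Qed.

Definition calc : hopf_calculus H B.
Proof.
refine (@HopfCalculus k H B s t (counit h) D P Q
  _ _ _ _ _ _ _ _ _ _ _ _ _ _ _ _ _ _ _ _).
- exact: src_tgt_comm.
- exact: lb_counit_s.
- exact: lb_counit_t.
- by move=> V f; apply: lb_cop_lin.
- by move=> V f; apply: lb_cop_1.
- by move=> V f b X fd; apply: lb_cop_s.
- by move=> V f b X fd; apply: lb_cop_t.
- by move=> V f X Y fd; apply: lb_cop_mul.
- by move=> V f b X fd; apply: lb_cop_tak.
- by move=> V f X; apply: lb_copA.
- exact: counitl.
- exact: counitr.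
- by move=> V f fo; apply: lin_ap (tlift_lin fo) transl_lin.
- move=> V f b X fo; rewrite /= transl_t.
  rewrite [LHS](so_lin (P X) _ (tlift_lin fo)).
  by apply: so_ext => x y; rewrite (tliftE _ _ fo).
- by move=> V f X; apply: ha_trK.
- move=> V f X fo; rewrite -(tliftE (f := f) X 1 fo) -Delta_transl.
  rewrite [RHS](so_lin (D X) _ (tlift_lin fo)); apply: so_ext => x x'.
  rewrite (so_lin (P x) _ (tlift_lin fo)); apply: so_ext => p q.
  by rewrite (tliftE _ _ fo).
- by move=> V f fo; apply: lin_ap (tlift_lin fo) translb_lin.
- move=> V f b X fo; rewrite /= translb_s.
  rewrite [LHS](so_lin (Q X) _ (tlift_lin fo)).
  by apply: so_ext => x y; rewrite (tliftE _ _ fo).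
- by move=> V f X; apply: ha_trbK.
- move=> V f X fo; rewrite -(tliftE (f := f) X 1 fo) -Delta_translb.
  rewrite [RHS](so_lin (D X) _ (tlift_lin fo)); apply: so_ext => x x'.
  rewrite (so_lin (Q x') _ (tlift_lin fo)); apply: so_ext => p q.
  by rewrite (tliftE _ _ fo).
Defined.

End HopfAlgebroidCalculus.

Section TwistedModuleRules.
Variables (k : fieldType) (H N : algebra k) (B : Type) (S : hopf_calculus H B).
Variables (T : twist N S) (L : lmodType k) (M : tmod T L).
Local Notation s := (hs S).
Local Notation t := (ht S).
Local Notation D := (cop S).
Local Notation i := (tb T).
Local Notation nl := (bml M).
Local Notation nr := (bmr M).
Local Notation va := (tva M).
Local Notation iL := (@inL _ _ _ M).
Local Notation iN := (@inN _ _ _ M).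

(** The rules of this section are the L-components of the rules for ∧ and ∨ over the square zero
    extension. *)
Lemma vdn_lin : bilin (tmod_vee M).
Proof.
have [d1 d2] := dn_lin (sqz_twist M).
split=> [u c X Y|X c u w].
  by have := d1 (iL u) c X Y => /(congr1 (@prL _ _ _ M)); rewrite (@prL_lin _ _ _ M) !prL_dn.
have := d2 X c (iL u) (iL w) => /(congr1 (@prL _ _ _ M)).
by rewrite (@prL_lin _ _ _ M) !prL_dn.
Qed.

Lemma vup_lin : bilin (tmod_wedge M).
Proof.
have [d1 d2] := up_lin (sqz_twist M).
split=> [u c X Y|X c u w].
  by have := d1 (iL u) c X Y => /(congr1 (@prL _ _ _ M)); rewrite (@prL_lin _ _ _ M) !prL_up.
have := d2 X c (iL u) (iL w) => /(congr1 (@prL _ _ _ M)).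
by rewrite (@prL_lin _ _ _ M) !prL_up.
Qed.

Lemma vdn_t b X u : tmod_vee M (t b * X) u = nr (tmod_vee M X u) (i b).
Proof.
have := congr1 (@prL _ _ _ M) (dn_t (sqz_twist M) b X (iL u)).
by rewrite prL_inNr !prL_dn.
Qed.

Lemma vdn_sr b X u : tmod_vee M (X * s b) u = tmod_vee M X (nl (i b) u).
Proof.
have := congr1 (@prL _ _ _ M) (dn_sr (sqz_twist M) b X (iL u)).
by rewrite !prL_dn inN_inL.
Qed.

Lemma vup_s b X u : tmod_wedge M (s b * X) u = nl (i b) (tmod_wedge M X u).
Proof.
have := congr1 (@prL _ _ _ M) (up_s (sqz_twist M) b X (iL u)).
by rewrite prL_inN !prL_up.
Qed.

Lemma vup_tr b X u : tmod_wedge M (X * t b) u = tmod_wedge M X (nr u (i b)).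
Proof.
have := congr1 (@prL _ _ _ M) (up_tr (sqz_twist M) b X (iL u)).
by rewrite !prL_up inL_inN.
Qed.

Lemma vdn_nl X n u :
  tmod_vee M X (nl n u) = \S_(x, y <- D X) nl (twist_vee T x n) (va y u).
Proof.
have dE Y : twist_vee (sqz_twist M) Y (iN n) = iN (twist_vee T Y n).
  rewrite [RHS]inN_so; apply: so_ext => y y'.
  rewrite nu_sqz inNM; congr (_ * _); apply: sqzP => //.
  exact: (lin0 ((tva_lin M).2 y')).
have := congr1 (@prL _ _ _ M) (dn_mul (sqz_twist M) X (iN n) (iL u)).
rewrite prL_dn inN_inL => ->; rewrite prL_so; apply: so_ext => x y.
by rewrite dE prL_inN.
Qed.

Lemma vup_nr X n u :
  tmod_wedge M X (nr u n) = \S_(x, y <- D X) nr (va x u) (twist_wedge T y n).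
Proof.
have dE Y : twist_wedge (sqz_twist M) Y (iN n) = iN (twist_wedge T Y n).
  rewrite [RHS]inN_so; apply: so_ext => y y'.
  rewrite om_sqz inNM; congr (_ * _); apply: sqzP => //.
  exact: (lin0 ((tva_lin M).2 y)).
have := congr1 (@prL _ _ _ M) (up_mul (sqz_twist M) X (iL u) (iN n)).
rewrite prL_up inL_inN => ->; rewrite prL_so; apply: so_ext => x y.
by rewrite dE prL_inNr.
Qed.

End TwistedModuleRules.

(** * The Galois maps of the free twisted module *)

Section FreeGalois.
Variables (k : fieldType) (H N : algebra k) (B : Type) (S : hopf_calculus H B).
Variables (T : twist N S) (L : lmodType k) (F : free_bimod T L).
Local Notation s := (hs S).
Local Notation t := (ht S).
Local Notation D := (cop S).
Local Notation P := (tr S).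
Local Notation Q := (trb S).
Local Notation a := (ta T).
Local Notation i := (tb T).
Local Notation om := (twist_wedge1 T).
Local Notation nu := (twist_vee1 T).
Local Notation M := (free_tmod F).
Local Notation nl := (bml F).
Local Notation nr := (bmr F).
Local Notation th := (fm_th F).
Local Notation va := (free_tact F).
Local Notation vup := (tmod_wedge M).
Local Notation vdn := (tmod_vee M).
Local Notation A := (free_algebra F).
Local Notation e := (free_base F).
Local Notation Lb := (free_bialgebroid F).
Local Notation LL := (HdH e).
Local Notation hd := (free_diamond F).
Local Notation hdlift := (@free_diamond_lift _ _ _ _ _ _ _ F _).
Local Notation balhd := (hd_balanced F).
Local Notation fmul := (free_mul F).

Let h1 := (hd_lin F).1.
Let h2 := (hd_lin F).2.

Definition hob (u w : L) : HobH Lb :=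
  pure (fun n (u : A) => u * tgt Lb n) (fun n (u : A) => tgt Lb n * u) u w.

Lemma hob_lin : bilin hob.
Proof.
exact: (balan_pure (fun n (u : A) => u * tgt Lb n) (fun n (u : A) => tgt Lb n * u)).1.
Qed.

Lemma hob_bal n u w : hob (fmul u (nr (th 1) n)) w = hob u (nr w n).
Proof.
have [_ hb] := balan_pure (fun n (u : A) => u * tgt Lb n) (fun n (u : A) => tgt Lb n * u).
by have := hb n u w; rewrite [tgt Lb n * w]free_tgtM.
Qed.

Lemma fmul_mon_tgt n X m c : fmul (nl n (nr (th X) m)) (nr (th 1) c) =
  \S_(x, y <- D X) nl n (nr (th x) (a y c * m)).
Proof.
rewrite fmul_mon fva_r bmr_sol bml_sor; apply: so_ext => x y.
by rewrite fva_th gact_X1 nrA.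
Qed.

Lemma hob_mon_nr n X m c w : hob (nl n (nr (th X) m)) (nr w c) =
  \S_(x, y <- D X) hob (nl n (nr (th x) (a y c * m))) w.
Proof. by rewrite -hob_bal fmul_mon_tgt (so_lin _ _ (hob_lin.1 w)). Qed.

Lemma mon_lin : trilin (fun n X m => nl n (nr (th X) m)).
Proof. by bal. Qed.

Lemma dia_hob n w : dbalanced s t (fun x y => hob (nl n (nr (th x) (om y))) w).
Proof.
have [m1 m2 m3] := mon_lin.
split=> [|b x y]; last by rewrite fm_th_t nrA om_s.
split=> x; first exact: lin_ap (hob_lin.1 w) (m2 n (om x)).
exact: lin_ap (hob_lin.1 w) (lin_ap (m3 n x) (om_lin T)).
Qed.

(** Moving b across costs a coproduct on both sides: [om_tr] turns X_+(2) t(b) ∧ 1 into (X_+(2) ▷ b)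
    (X_+(3) ∧ 1), and [hob_mon_nr] draws the same factor X_+(2) ▷ b from the balancing over N. *)
Lemma obal_hob n w : obalanced t (fun x y =>
  \S_(x1, x2 <- D x) hob (nl n (nr (th x1) (om x2))) (vdn y w)).
Proof.
split=> [|b x y].
  split=> x; first exact: cop_lin (dia_hob n _).
  by apply: lin_so => x1 x2; exact: lin_ap (hob_lin.2 _) ((vdn_lin M).1 w).
have [m1 m2 m3] := mon_lin.
rewrite (cop_tr _ _ (dia_hob n _)) vdn_t.
transitivity (\S_(x1, x2 <- D x) \S_(y1, y2 <- D x2)
    hob (nl n (nr (th x1) (a y1 (i b) * om y2))) (vdn y w)).
  apply: so_ext => x1 x2; rewrite om_tr.
  exact: (so_lin _ _ (lin_ap (hob_lin.1 _) (m3 n x1))).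
rewrite -(copA (f := fun x y' z =>
    hob (nl n (nr (th x) (a y' (i b) * om z))) (vdn y w))).
- by apply: so_ext => x1 x2; rewrite [RHS]hob_mon_nr.
- have q x1 : lin (fun u => hob (nl n (nr (th x1) u)) (vdn y w)).
    exact: (lin_ap (hob_lin.1 _) (m3 n x1)).
  split=> x1 x2; [| apply: lin_ap (q _) _ | apply: lin_ap (q _) _]; try by bal.
  exact: (lin_ap (hob_lin.1 _) (m2 n _)).
- by move=> c x1 x2 x3; rewrite fm_th_t nrA ta_s mulrA.
- by move=> c x1 x2 x3; rewrite ta_t om_s mulrA.
Qed.

(** The inverse of λ at (n ⊗ X ⊗ 1) ◇ w. In (n ⊗ X ⊗ m) ◇ w the component m joins w as m w. *)
Definition lamV3 n X w : HobH Lb :=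
  \S_(x, y <- P X) \S_(x1, x2 <- D x) hob (nl n (nr (th x1) (om x2))) (vdn y w).

Lemma lamV3_lin : trilin lamV3.
Proof.
have [m1 m2 m3] := mon_lin.
split=> x y.
- apply: lin_so => z z'; apply: lin_so => x1 x2.
  exact: (lin_ap (hob_lin.1 _) (m1 _ _)).
- exact: tr_lin (obal_hob x y).
- apply: lin_so => z z'; apply: lin_so => x1 x2.
  exact: (lin_ap (hob_lin.2 _) ((vdn_lin M).2 _)).
Qed.

Lemma bal3_lamV w : bal3 T (fun n X m => lamV3 n X (nl m w)).
Proof.
have [l1 l2 l3] := lamV3_lin; split.
- split=> x y; [exact: l1 | exact: l2 | exact: lin_ap (l3 x y) ((bml_lin F).1 w)].
- move=> b n X m; rewrite /lamV3 (tr_s _ _ (obal_hob _ _)); apply: so_ext => x y.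
  rewrite (cop_s _ _ (dia_hob _ _)); apply: so_ext => x1 x2.
  by rewrite fm_th_s -nlr nlA.
- move=> b n X m; rewrite /lamV3 (tr_t _ _ (obal_hob _ _)); apply: so_ext => x y.
  by apply: so_ext => x1 x2; rewrite vdn_sr nlA.
Qed.

Definition lamV2 w : L -> HobH Lb := s2val (fm_lift F (bal3_lamV w)).

Lemma lamV2_lin w : lin (lamV2 w).
Proof. exact: (s2valP (fm_lift F (bal3_lamV w))). Qed.

Lemma lamV2_mon w n X m : lamV2 w (nl n (nr (th X) m)) = lamV3 n X (nl m w).
Proof. exact: (s2valP' (fm_lift F (bal3_lamV w))). Qed.

Lemma balhd_lamV : balhd (fun u w => lamV2 w u).
Proof.
have [l1 l2 l3] := lamV3_lin; split=> [|c u w].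
  split=> [w|u c w w']; first exact: lamV2_lin.
  move: u; apply: (@fm_ext _ _ _ _ _ _ _ F); first exact: lamV2_lin.
    exact: lin_axpy (lamV2_lin w) (lamV2_lin w').
  by move=> n X m; rewrite !lamV2_mon (bml_lin F).2 l3.
move: u; apply: (@fm_ext _ _ _ _ _ _ _ F).
- exact: lin_ap (lamV2_lin w) ((bmr_lin F).1 c).
- exact: lamV2_lin.
by move=> n X m; rewrite nr_mon !lamV2_mon nlA.
Qed.

Definition lamV (z : LL) : HobH Lb := hdlift (fun u w => lamV2 w u) z.

Lemma lamV_lin : lin lamV.
Proof. exact: hdlift_lin balhd_lamV. Qed.

Lemma lamV_hd u w : lamV (hd u w) = lamV2 w u.
Proof. exact: hdliftE balhd_lamV. Qed.

Lemma lam_hob u w : lam (hob u w) = hdlift (fun x y => hd x (fmul y w)) (free_Delta F u).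
Proof. exact: (lamE Lb u w). Qed.

Lemma lam_mon n X m w : lam (hob (nl n (nr (th X) m)) w) =
  \S_(x, y <- D X) hd (nl n (th x)) (nr (va y w) m).
Proof.
rewrite lam_hob hdlift_fdelta.
  by apply: so_ext => x y; rewrite fmul_nr fmul_th.
split=> [|c x y]; last by rewrite fmul_nl hd_bal.
by split=> x; [exact: h1 | exact: lin_ap (h2 _) (fmul_linl F _)].
Qed.

(** Coassociativity regroups X_+(2) ▶ (X_- ∨ w) and X_+(3) ∧ 1 into X_+(2) ∧ (X_- ∨ w), which is the
    situation of [vgalois_surj]. *)
Lemma lam_lamV3 n X w : lam (lamV3 n X w) = hd (nl n (th X)) w.
Proof.
have lm := @lam_lin _ _ _ Lb.
have [m1 m2 m3] := mon_lin.
have tl : lin (fun x => nl n (th x)).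
  exact: lin_ap ((bml_lin F).2 n) (fm_th_lin F).
rewrite -(vgalois_surj (M := M) (f := fun x u => hd (nl n (th x)) u) X w); first last.
- by move=> b x u; rewrite fm_th_t nlr hd_bal.
- by split=> x; [exact: lin_ap (h1 _) tl | exact: h2].
rewrite (so_lin _ _ lm); apply: so_ext => x y; rewrite (so_lin _ _ lm).
under so_ext => x1 x2 do rewrite lam_mon.
rewrite (copA (f := fun x1 x2 x3 => hd (nl n (th x1)) (nr (va x2 (vdn y w)) (om x3)))).
- by apply: so_ext => x1 x2; rewrite -(so_lin _ _ (h2 _)).
- split=> x1 x2.
  + exact: lin_ap (h1 _) tl.
  + exact: lin_ap (h2 _) (lin_ap ((bmr_lin F).1 _) ((fva_lin F).1 _)).
  + exact: lin_ap (h2 _) (lin_ap ((bmr_lin F).2 _) (om_lin T)).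
- by move=> b x1 x2 x3; rewrite fm_th_t nlr hd_bal fva_s -nlr.
- by move=> b x1 x2 x3; rewrite fva_t om_s nrA.
Qed.

Lemma lamVK : cancel lamV (@lam _ _ _ Lb).
Proof.
have lm := @lam_lin _ _ _ Lb.
apply: hd_ext; [exact: lin_ap lm lamV_lin | by [] |] => u w.
rewrite lamV_hd; move: u; apply: (@fm_ext _ _ _ _ _ _ _ F).
- exact: lin_ap lm (lamV2_lin w).
- exact: h1.
by move=> n X m; rewrite lamV2_mon lam_lamV3 -hd_bal -nlr.
Qed.

(** [vgalois_inj] for the map sending x, m, u to (n ⊗ x ⊗ m) ⊗ u; its balancing hypothesis over N is
    [hob_mon_nr]. *)
Lemma lamK : cancel (@lam _ _ _ Lb) lamV.
Proof.
have lm := @lam_lin _ _ _ Lb.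
have [m1 m2 m3] := mon_lin.
apply: tens_ext; [exact: lin_ap lamV_lin lm | by [] |] => u w.
rewrite -[pure _ _ _ _]/(hob u w); move: u; apply: (@fm_ext _ _ _ _ _ _ _ F).
- exact: lin_ap lamV_lin (lin_ap lm (hob_lin.1 w)).
- exact: hob_lin.1.
move=> n X m; rewrite lam_mon (so_lin _ _ lamV_lin).
rewrite -(vgalois_inj (M := M) (f := fun x m u => hob (nl n (nr (th x) m)) u)).
- apply: so_ext => x y; rewrite lamV_hd -[nl n (th x)](congr1 (nl n) (nr1 F (th x))).
  by rewrite lamV2_mon nl1.
- split=> x y; [exact: lin_ap (hob_lin.1 _) (m2 n _)
    | exact: lin_ap (hob_lin.1 _) (m3 n x) | exact: hob_lin.2].
- by move=> b x m' u; rewrite fm_th_t nrA.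
- by move=> x m' u c; rewrite [LHS]hob_mon_nr.
Qed.

Definition hoo (u w : L) : HoH Lb :=
  pure (fun n (u : A) => u * src Lb n) (fun n (u : A) => src Lb n * u) u w.

Lemma hoo_lin : bilin hoo.
Proof.
exact: (balan_pure (fun n (u : A) => u * src Lb n) (fun n (u : A) => src Lb n * u)).1.
Qed.

Lemma hoo_bal n u w : hoo (fmul u (nl n (th 1))) w = hoo u (nl n w).
Proof.
have [_ hb] := balan_pure (fun n (u : A) => u * src Lb n) (fun n (u : A) => src Lb n * u).
by have := hb n u w; rewrite [src Lb n * w]free_srcM.
Qed.

Lemma fmul_mon_src n X m c : fmul (nl n (nr (th X) m)) (nl c (th 1)) =
  \S_(x, y <- D X) nl (n * a x c) (nr (th y) m).
Proof.
rewrite fmul_mon fva_l bmr_sol bml_sor; apply: so_ext => x y.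
by rewrite fva_th gact_X1 -nlr nlA.
Qed.

Lemma hoo_mon_nl n X m c w : hoo (nl n (nr (th X) m)) (nl c w) =
  \S_(x, y <- D X) hoo (nl (n * a x c) (nr (th y) m)) w.
Proof. by rewrite -hoo_bal fmul_mon_src (so_lin _ _ (hoo_lin.1 w)). Qed.

Lemma dia_hoo m w : dbalanced s t (fun x y => hoo (nl (nu x) (nr (th y) m)) w).
Proof.
have [m1 m2 m3] := mon_lin.
split=> [|b x y]; last by rewrite fm_th_s -nlr nlA nu_t.
split=> x; first exact: lin_ap (hoo_lin.1 w) (lin_ap (m1 x m) (nu_lin T)).
exact: lin_ap (hoo_lin.1 w) (m2 (nu x) m).
Qed.

Lemma obal_hoo m w : obalanced s (fun x y =>
  \S_(x1, x2 <- D x) hoo (nl (nu x1) (nr (th x2) m)) (vup y w)).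
Proof.
split=> [|b x y].
  split=> x; first exact: cop_lin (dia_hoo m _).
  by apply: lin_so => x1 x2; exact: lin_ap (hoo_lin.2 _) ((vup_lin M).1 w).
have [m1 m2 m3] := mon_lin.
rewrite (cop_sr _ _ (dia_hoo m _)) vup_s.
transitivity (\S_(x1, x2 <- D x) \S_(y1, y2 <- D x1)
    hoo (nl (nu y1 * a y2 (i b)) (nr (th x2) m)) (vup y w)).
  apply: so_ext => x1 x2; rewrite nu_sr.
  exact: (so_lin _ _ (lin_ap (hoo_lin.1 _) (m1 x2 m))).
rewrite (copA (f := fun x y' z =>
    hoo (nl (nu x * a y' (i b)) (nr (th z) m)) (vup y w))).
- by apply: so_ext => x1 x2; rewrite [RHS]hoo_mon_nl.
- have q x2 : lin (fun u => hoo (nl u (nr (th x2) m)) (vup y w)).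
    exact: (lin_ap (hoo_lin.1 _) (m1 x2 m)).
  split=> x1 x2; [apply: lin_ap (q _) _ | apply: lin_ap (q _) _ |]; try by bal.
  exact: (lin_ap (hoo_lin.1 _) (m2 _ m)).
- by move=> c x1 x2 x3; rewrite nu_t ta_s mulrA.
- by move=> c x1 x2 x3; rewrite ta_t fm_th_s -nlr nlA mulrA.
Qed.

(** The inverse of μ at w ◇ (1 ⊗ X ⊗ m). The argument mirrors the one for λ, with [vgaloisb_surj]
    and [vgaloisb_inj]; here the component n joins w from the right, as w n. *)
Definition muV3 X m w : HoH Lb :=
  \S_(x, y <- Q X) \S_(x1, x2 <- D x) hoo (nl (nu x1) (nr (th x2) m)) (vup y w).

Lemma muV3_lin : trilin muV3.
Proof.
have [m1 m2 m3] := mon_lin.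
split=> x y.
- exact: trb_lin (obal_hoo x y).
- apply: lin_so => z z'; apply: lin_so => x1 x2.
  exact: (lin_ap (hoo_lin.1 _) (m3 _ _)).
- apply: lin_so => z z'; apply: lin_so => x1 x2.
  exact: (lin_ap (hoo_lin.2 _) ((vup_lin M).2 _)).
Qed.

Lemma bal3_muV w : bal3 T (fun n X m => muV3 X m (nr w n)).
Proof.
have [l1 l2 l3] := muV3_lin; split.
- split=> x y; [exact: lin_ap (l3 x y) ((bmr_lin F).2 w) | exact: l1 | exact: l2].
- move=> b n X m; rewrite /muV3 (trb_s _ _ (obal_hoo _ _)); apply: so_ext => x y.
  by apply: so_ext => x1 x2; rewrite vup_tr nrA.
- move=> b n X m; rewrite /muV3 (tr_s (S := coopp S) _ _ (obal_hoo _ _)).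
  apply: so_ext => x y.
  rewrite (cop_t _ _ (dia_hoo _ _)); apply: so_ext => x1 x2.
  by rewrite fm_th_t nrA.
Qed.

Definition muV2 w : L -> HoH Lb := s2val (fm_lift F (bal3_muV w)).

Lemma muV2_lin w : lin (muV2 w).
Proof. exact: (s2valP (fm_lift F (bal3_muV w))). Qed.

Lemma muV2_mon w n X m : muV2 w (nl n (nr (th X) m)) = muV3 X m (nr w n).
Proof. exact: (s2valP' (fm_lift F (bal3_muV w))). Qed.

Lemma balhd_muV : balhd muV2.
Proof.
have [l1 l2 l3] := muV3_lin; split=> [|c u w].
  split=> [w c u u'|u]; last exact: muV2_lin.
  move: w; apply: (@fm_ext _ _ _ _ _ _ _ F); first exact: muV2_lin.
    exact: lin_axpy (muV2_lin u) (muV2_lin u').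
  by move=> n X m; rewrite !muV2_mon (bmr_lin F).1 l3.
move: w; apply: (@fm_ext _ _ _ _ _ _ _ F).
- exact: muV2_lin.
- exact: lin_ap (muV2_lin u) ((bml_lin F).2 c).
by move=> n X m; rewrite nlA !muV2_mon nrA.
Qed.

Definition muV (z : LL) : HoH Lb := hdlift muV2 z.

Lemma muV_lin : lin muV.
Proof. exact: hdlift_lin balhd_muV. Qed.

Lemma muV_hd u w : muV (hd u w) = muV2 u w.
Proof. exact: hdliftE balhd_muV. Qed.

Lemma mu_hoo u w : mu (hoo u w) = hdlift (fun x y => hd (fmul x w) y) (free_Delta F u).
Proof. exact: (muE Lb u w). Qed.

Lemma mu_mon n X m w : mu (hoo (nl n (nr (th X) m)) w) =
  \S_(x, y <- D X) hd (nl n (va x w)) (nr (th y) m).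
Proof.
rewrite mu_hoo hdlift_fdelta.
  by apply: so_ext => x y; rewrite fmul_nl fmul_th.
split=> [|c x y]; last by rewrite fmul_nr hd_bal.
by split=> x; [exact: lin_ap (h1 _) (fmul_linl F _) | exact: h2].
Qed.

Lemma mu_muV3 X m w : mu (muV3 X m w) = hd w (nr (th X) m).
Proof.
have lm := @mu_lin _ _ _ Lb.
have [m1 m2 m3] := mon_lin.
have tl : lin (fun x => nr (th x) m).
  exact: lin_ap ((bmr_lin F).1 m) (fm_th_lin F).
rewrite -(vgaloisb_surj (M := M) (f := fun x u => hd u (nr (th x) m)) X w); first last.
- by move=> b x u; rewrite fm_th_s -nlr hd_bal.
- by split=> x; [exact: lin_ap (h2 _) tl | exact: h1].
rewrite (so_lin _ _ lm); apply: so_ext => x y; rewrite (so_lin _ _ lm).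
under so_ext => x1 x2 do rewrite mu_mon.
rewrite -(copA (f := fun x1 x2 x3 => hd (nl (nu x1) (va x2 (vup y w))) (nr (th x3) m))).
- by apply: so_ext => x1 x2; rewrite -(so_lin _ _ (h1 _)).
- split=> x1 x2.
  + exact: lin_ap (h1 _) (lin_ap ((bml_lin F).1 _) (nu_lin T)).
  + exact: lin_ap (h1 _) (lin_ap ((bml_lin F).2 _) ((fva_lin F).1 _)).
  + exact: lin_ap (h2 _) tl.
- by move=> b x1 x2 x3; rewrite fva_s nu_t nlA.
- by move=> b x1 x2 x3; rewrite fm_th_s -nlr -hd_bal fva_t nlr.
Qed.

Lemma muVK : cancel muV (@mu _ _ _ Lb).
Proof.
have lm := @mu_lin _ _ _ Lb.
apply: hd_ext; [exact: lin_ap lm muV_lin | by [] |] => u w.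
rewrite muV_hd; move: w; apply: (@fm_ext _ _ _ _ _ _ _ F).
- exact: lin_ap lm (muV2_lin u).
- exact: h2.
by move=> n X m; rewrite muV2_mon mu_muV3 hd_bal.
Qed.

Lemma muK : cancel (@mu _ _ _ Lb) muV.
Proof.
have lm := @mu_lin _ _ _ Lb.
have [m1 m2 m3] := mon_lin.
apply: tens_ext; [exact: lin_ap muV_lin lm | by [] |] => u w.
rewrite -[pure _ _ _ _]/(hoo u w); move: u; apply: (@fm_ext _ _ _ _ _ _ _ F).
- exact: lin_ap muV_lin (lin_ap lm (hoo_lin.1 w)).
- exact: hoo_lin.1.
move=> n X m; rewrite mu_mon (so_lin _ _ muV_lin).
rewrite -(vgaloisb_inj (M := M) (f := fun x n u => hoo (nl n (nr (th x) m)) u)).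
- apply: so_ext => x y; rewrite muV_hd -[nr (th y) m](nl1 F).
  by rewrite muV2_mon nr1.
- split=> x y; [exact: lin_ap (hoo_lin.1 _) (m2 _ m)
    | exact: lin_ap (hoo_lin.1 _) (m1 x m) | exact: hoo_lin.2].
- by move=> b x m' u; rewrite fm_th_s -nlr nlA.
- by move=> x m' u c; rewrite [LHS]hoo_mon_nl.
Qed.

Definition free_hopf : hopf_algebroid N A :=
  @HopfAlgebroid _ _ _ Lb (Bijective lamK lamVK) (Bijective muK muVK).

(** The inverse of λ at w = 1: X_- ∨ (m ⊗ 1 ⊗ 1) splits as (X_-(1) ∨ m) ⊗ X_-(2) ⊗ 1, because X ▶ (1
    ⊗ 1 ⊗ 1) = 1 ⊗ X ⊗ 1. *)
Lemma transl_mon n X m : transl Lb (nl n (nr (th X) m)) =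
  \S_(x, y <- P X) \S_(x1, x2 <- D x) \S_(y1, y2 <- D y)
    hob (nl n (nr (th x1) (twist_wedge T x2 1))) (nl (twist_vee T y1 m) (th y2)).
Proof.
have lm : lam (transl Lb (nl n (nr (th X) m))) = hd (nl n (nr (th X) m)) (th 1).
  exact: (lam_transl free_hopf (nl n (nr (th X) m))).
rewrite -[LHS]lamK lm lamV_hd lamV2_mon; apply: so_ext => x y.
apply: so_ext => x1 x2; rewrite vdn_nl (so_lin _ _ (hob_lin.2 _)).
by apply: so_ext => y1 y2; rewrite up_1 [tva M _ _]fva_th gact_X1.
Qed.

Lemma translb_mon n X m : translb Lb (nl n (nr (th X) m)) =
  \S_(x, y <- Q X) \S_(x1, x2 <- D x) \S_(y1, y2 <- D y)
    hoo (nl (twist_vee T x1 1) (nr (th x2) m)) (nr (th y1) (twist_wedge T y2 n)).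
Proof.
have lm : mu (translb Lb (nl n (nr (th X) m))) = hd (th 1) (nl n (nr (th X) m)).
  exact: (mu_translb free_hopf (nl n (nr (th X) m))).
rewrite -[LHS]muK lm muV_hd muV2_mon; apply: so_ext => x y.
apply: so_ext => x1 x2; rewrite vup_nr (so_lin _ _ (hoo_lin.2 _)).
by apply: so_ext => y1 y2; rewrite dn_1 [tva M _ _]fva_th gact_X1.
Qed.

End FreeGalois.

(** * The bimodule N ⊗ H ◇ N *)

Section CocycleTwist.
Variables (k : fieldType) (B H N : algebra k) (h : hopf_algebroid B H).
Variables (i : B_ring B N) (c : cocycle h i) (ci : cocycle_inverse c).
Local Notation s := (src h).
Local Notation t := (tgt h).
Local Notation a := (act c).
Local Notation g := (fun X Y => sigma c (X ⊗ Y)).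
Local Notation v := (fun X Y => sigmaV ci (X ⊗ Y)).

Let s1 : s 1 = 1 := (src_morph h).1.
Let t1 : t 1 = 1 := (tgt_morph h).1.
Let i1 : i 1 = 1 := (br_morph i).1.

(** The axioms for s(b) t(b') X are split by setting b or b' to 1. In [twist] the coproduct of the
    last argument is outermost, hence the exchanges of sums. *)
Definition cocycle_twist : twist N (calc h).
Proof.
refine (@Twist k H N B (calc h) a g v i
  _ _ _ _ _ _ _ _ _ _ _ _ _ _ _ _ _ _ _ _ _ _).
- by split=> [n|X] d u w; [rewrite linearPl | rewrite linearPr].
- have [[p1 p2] _] := balan_pure (fun b (X : H) => X * t b) (fun b (Y : H) => t b * Y).
  split=> x; apply: lin_ap (lin_linear _) _; [exact: p1 | exact: p2].
- have [[p1 p2] _] := balan_pure (fun b (X : H) => X * s b) (fun b (Y : H) => s b * Y).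
  split=> x; apply: lin_ap (lin_linear _) _; [exact: p1 | exact: p2].
- by move=> b X n; have := act_base c b 1 X n; rewrite t1 i1 !mulr1.
- by move=> b X n; have := act_base c 1 b X n; rewrite s1 i1 !mul1r.
- exact: act_unit.
- exact: act1.
- exact: actM.
- by move=> b X Y; have := sigma_base c b 1 X Y; rewrite t1 i1 !mulr1.
- by move=> b X Y; have := sigma_base c 1 b X Y; rewrite s1 i1 !mul1r.
- move=> b X Y.
  have [_ pb] := balan_pure (fun b (X : H) => X * t b) (fun b (Y : H) => t b * Y).
  exact: congr1 (pb b X Y).
- by move=> X; rewrite sigmaX1 act_unit.
- by move=> X; rewrite sigma1X act_unit.
- by move=> b X Y; rewrite -sigma_src.
- by move=> b X Y; have := sigmaV_base ci b 1 X Y; rewrite t1 i1 !mulr1.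
- by move=> b X Y; have := sigmaV_base ci 1 b X Y; rewrite s1 i1 !mul1r.
- move=> b X Y.
  have [_ pb] := balan_pure (fun b (X : H) => X * s b) (fun b (Y : H) => s b * Y).
  exact: congr1 (pb b X Y).
- by move=> b X Y; rewrite -sigmaV_tgt.
- by move=> X Y; rewrite so_swap -(sigmaK ci).
- by move=> X Y; rewrite so_swap -(sigmaVK ci).
- move=> X Y Z; rewrite so_swap [RHS]so_swap.
  under so_ext => ? ? do rewrite so_swap.
  by rewrite so_swap; exact: sigma_cocycle.
- by move=> X Y n; rewrite so_swap [RHS]so_swap; exact: sigma_act.
Defined.

End CocycleTwist.


Lemma lin_tlift_fun (k : fieldType) (M N V W : lmodType k) (A : Type)
    (r : A -> M -> M) (l : A -> N -> N) (u : tens r l) (F : V -> M -> N -> W) :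
  (forall m n, lin (fun z => F z m n)) -> lin (fun z => tlift u (F z)).
Proof.
move=> Fl c z z'; rewrite /tlift scaler_sumr -big_split.
by apply: eq_bigr => p _; apply: Fl.
Qed.

Section FreeBimoduleModel.
Variables (k : fieldType) (B H N : algebra k) (h : hopf_algebroid B H).
Variables (i : B_ring B N) (c : cocycle h i) (ci : cocycle_inverse c).
Local Notation s := (src h).
Local Notation t := (tgt h).
Local Notation T := (cocycle_twist ci).
Local Notation L := (NoHdN h i).
Local Notation NH := (NoH h i).
Local Notation rN := (fun b (n : N) => n * i b).
Local Notation lH := (fun b (X : H) => s b * X).
Local Notation rNH := (fun b (u : NH) => \sw_(n, X <- u) (n ⊗ t b * X : NH)).
Local Notation lN := (fun b (n : N) => i b * n).
Local Notation mon := (tens3 h i).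

Lemma balan_NH_t b : balan rN lH (fun n X => (n ⊗ t b * X : NH)).
Proof.
have [[p1 p2] pb] := balan_pure rN lH; split=> [|b' n X].
  by split=> x; [exact: p1 | exact: lin_ap (p2 x) (lin_mulr _ (@lin_id _ _))].
by rewrite pb !mulrA src_tgt_comm.
Qed.

Lemma balan_NH_l m : balan rN lH (fun n X => (m * n ⊗ X : NH)).
Proof.
have [[p1 p2] pb] := balan_pure rN lH; split=> [|b' n X].
  by split=> x; [exact: lin_ap (p1 x) (lin_mulr _ (@lin_id _ _)) | exact: p2].
by rewrite mulrA pb.
Qed.

Definition NH_l m (u : NH) : NH := \sw_(n, X <- u) (m * n ⊗ X : NH).

Lemma NH_l_lin : bilin NH_l.
Proof.
split=> [u|m]; last exact: tlift_lin (balan_NH_l m).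
apply: lin_tlift_fun => n X; have [[p1 _] _] := balan_pure rN lH.
exact: lin_ap (p1 X) (lin_mull _ (@lin_id _ _)).
Qed.

Lemma NH_lE m n X : NH_l m (n ⊗ X : NH) = (m * n ⊗ X : NH).
Proof. exact: tliftE (balan_NH_l m). Qed.

Lemma NH_tE b n X : rNH b (n ⊗ X : NH) = (n ⊗ t b * X : NH).
Proof. exact: tliftE (balan_NH_t b). Qed.

Lemma NH_t_l m b u : NH_l m (rNH b u) = rNH b (NH_l m u).
Proof.
have tl := tlift_lin (balan_NH_t b).
move: u; apply: tens_ext => [||n X].
- exact: lin_ap (NH_l_lin.2 m) tl.
- exact: lin_ap tl (NH_l_lin.2 m).
by rewrite NH_tE !NH_lE NH_tE.
Qed.

Lemma NHN_ext (V : lmodType k) (phi psi : L -> V) : lin phi -> lin psi ->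
  (forall n X m, phi (mon n X m) = psi (mon n X m)) -> forall u, phi u = psi u.
Proof.
move=> pl ql pq; have [[p1 _] _] := balan_pure rNH lN.
apply: tens_ext => // u m; move: u; apply: tens_ext => [||n X]; last exact: pq.
- exact: lin_ap pl (p1 m).
- exact: lin_ap ql (p1 m).
Qed.

Lemma mon_trilin : trilin mon.
Proof.
have [[p1 p2] _] := balan_pure rNH lN; have [[q1 q2] _] := balan_pure rN lH.
split=> x y.
- exact: lin_ap (p1 y) (q1 x).
- exact: lin_ap (p1 y) (q2 x).
- exact: p2.
Qed.

Lemma balan_L_l m : balan rNH lN (fun u n => (NH_l m u ⊗ n : L)).
Proof.
have [[p1 p2] pb] := balan_pure rNH lN; split=> [|b u n].
  by split=> x; [exact: lin_ap (p1 x) (NH_l_lin.2 m) | exact: p2].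
by rewrite NH_t_l pb.
Qed.

Lemma balan_L_r m : balan rNH lN (fun u n => (u ⊗ n * m : L)).
Proof.
have [[p1 p2] pb] := balan_pure rNH lN; split=> [|b u n].
  by split=> x; [exact: p1 | exact: lin_ap (p2 x) (lin_mull _ (@lin_id _ _))].
by rewrite pb mulrA.
Qed.

Definition NHN_l m (u : L) : L := \sw_(w, n <- u) (NH_l m w ⊗ n : L).
Definition NHN_r (u : L) m : L := \sw_(w, n <- u) (w ⊗ n * m : L).

Lemma NHN_lE m n X m' : NHN_l m (mon n X m') = mon (m * n) X m'.
Proof. by rewrite /NHN_l (tliftE _ _ (balan_L_l m)) NH_lE. Qed.

Lemma NHN_rE n X m' m : NHN_r (mon n X m') m = mon n X (m' * m).
Proof. exact: tliftE (balan_L_r m). Qed.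

Lemma NHN_l_lin : bilin NHN_l.
Proof.
split=> [u|m]; last exact: tlift_lin (balan_L_l m).
apply: lin_tlift_fun => w n; have [[p1 _] _] := balan_pure rNH lN.
exact: lin_ap (p1 n) (NH_l_lin.1 w).
Qed.

Lemma NHN_r_lin : bilin NHN_r.
Proof.
split=> [m|u]; first exact: tlift_lin (balan_L_r m).
apply: lin_tlift_fun => w n; have [[_ p2] _] := balan_pure rNH lN.
exact: lin_ap (p2 w) (lin_mulr _ (@lin_id _ _)).
Qed.

Definition NHN_bimod : bimodule N L.
Proof.
refine (@Bimodule k N L NHN_l NHN_r NHN_l_lin NHN_r_lin _ _ _ _ _).
- move=> m n; apply: NHN_ext => [||n' X m'].
  + exact: lin_ap (NHN_l_lin.2 m) (NHN_l_lin.2 n).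
  + exact: NHN_l_lin.2.
  by rewrite !NHN_lE mulrA.
- move=> m n; apply: NHN_ext => [||n' X m'].
  + exact: lin_ap (NHN_r_lin.1 n) (NHN_r_lin.1 m).
  + exact: NHN_r_lin.1.
  by rewrite !NHN_rE mulrA.
- move=> m n; apply: NHN_ext => [||n' X m'].
  + exact: lin_ap (NHN_l_lin.2 m) (NHN_r_lin.1 n).
  + exact: lin_ap (NHN_r_lin.1 n) (NHN_l_lin.2 m).
  by rewrite NHN_rE !NHN_lE NHN_rE.
- apply: (NHN_ext (psi := id)) => [|//|n' X m'].
    exact: NHN_l_lin.2.
  by rewrite NHN_lE mul1r.
- apply: (NHN_ext (psi := id)) => [|//|n' X m'].
    exact: NHN_r_lin.1.
  by rewrite NHN_rE mulr1.
Defined.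

Lemma mon_s n b X m : mon n (s b * X) m = mon (n * i b) X m.
Proof. by have [_ pb] := balan_pure rN lH; rewrite /tens3 pb. Qed.

Lemma mon_t n b X m : mon n (t b * X) m = mon n X (i b * m).
Proof.
have [_ pb] := balan_pure rNH lN.
by rewrite -[RHS](pb b (n ⊗ X : NH) m) NH_tE.
Qed.

Lemma NHN_mon n X m : NHN_l n (NHN_r (mon 1 X 1) m) = mon n X m.
Proof. by rewrite NHN_rE NHN_lE mul1r mulr1. Qed.

Section Lift.
Variables (W : lmodType k) (f : N -> H -> N -> W).
Hypothesis fb : bal3 T f.

Lemma bal3_NH m : balan rN lH (fun n X => f n X m).
Proof.
have [[f1 f2 f3] fs ft] := fb.
by split=> [|b n X]; [split=> ? | exact: fs].
Qed.

Lemma bal3_NHN : balan rNH lN (fun u m => \sw_(n, X <- u) f n X m).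
Proof.
have [[f1 f2 f3] fs ft] := fb; split=> [|b u m].
  split=> [m|u]; first exact: tlift_lin (bal3_NH m).
  by apply: lin_tlift_fun => n X.
move: u; apply: tens_ext => [||n X].
- exact: lin_ap (tlift_lin (bal3_NH m)) (tlift_lin (balan_NH_t b)).
- exact: tlift_lin (bal3_NH _).
by rewrite NH_tE !(tliftE _ _ (bal3_NH _)) ft.
Qed.

Definition NHN_lift (z : L) : W := \sw_(u, m <- z) \sw_(n, X <- u) f n X m.

Lemma NHN_lift_lin : lin NHN_lift.
Proof. exact: tlift_lin bal3_NHN. Qed.

Lemma NHN_liftE n X m : NHN_lift (mon n X m) = f n X m.
Proof. by rewrite /NHN_lift (tliftE _ _ bal3_NHN) (tliftE _ _ (bal3_NH m)). Qed.

End Lift.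

Definition NHN_free : free_bimod T L.
Proof.
refine (@FreeBimod k H N B (calc h) T L NHN_bimod (fun X => mon 1 X 1) _ _ _ _ _).
- by have [_ m2 _] := mon_trilin; apply: m2.
- by move=> b X; rewrite /= NHN_lE mon_s mul1r mulr1.
- by move=> b X; rewrite /= NHN_rE mon_t mul1r mulr1.
- move=> W f fb; exists (NHN_lift f); first exact: NHN_lift_lin.
  by move=> n X m; rewrite /= NHN_mon NHN_liftE.
- move=> W phi psi pl ql pq; apply: NHN_ext => // n X m.
  by rewrite -NHN_mon pq.
Defined.

End FreeBimoduleModel.

(** * The crossed product *)

Section CrossSums.
Variables (k : fieldType) (H N : algebra k) (B : Type) (S : hopf_calculus H B).
Variables (T : twist N S) (V : lmodType k) (p : N -> H -> V).
Local Notation s := (hs S).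
Local Notation t := (ht S).
Local Notation D := (cop S).
Local Notation P := (tr S).
Local Notation a := (ta T).
Local Notation g := (tg T).
Local Notation i := (tb T).
Local Notation om := (twist_wedge1 T).
Local Notation nu := (twist_vee1 T).
Local Notation up := (twist_wedge T).
Local Notation dn := (twist_vee T).
Hypothesis p_lin : bilin p.
Hypothesis p_bal : forall b n X, p (n * i b) X = p n (s b * X).

(* (n ⊗ X)(1 ⊗ Y) in the crossed product, as a value of p. *)
Definition cross1 n X Y :=
  \S_(y1, y2 <- D Y) \S_(x1, x2 <- D X) p (n * g x1 y1) (x2 * y2).

Lemma dia_cross1 n y y' : dbalanced s t (fun x x' => p (n * g x y) (x' * y')).
Proof. by bal; rewrite tg_t mulrA p_bal mulrA. Qed.

Lemma dia_cross1r n X :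
  dbalanced s t (fun y y' => \S_(x1, x2 <- D X) p (n * g x1 y) (x2 * y')).
Proof.
bal; under so_ext => ? ? do rewrite -tg_bal.
rewrite (cop_tak _ _ (dia_cross1 n _ _)).
by apply: so_ext => *; rewrite mulrA.
Qed.

Lemma cross1_lin : trilin cross1.
Proof.
split=> x y; rewrite /cross1.
- by bal.
- by apply: lin_so => *; apply: cop_lin (dia_cross1 _ _ _).
- exact: cop_lin (dia_cross1r _ _).
Qed.

Lemma cross1_s b n X Y : cross1 n (s b * X) Y = cross1 (n * i b) X Y.
Proof.
apply: so_ext => y1 y2; rewrite (cop_s _ _ (dia_cross1 _ _ _)).
by apply: so_ext => x1 x2; rewrite tg_s mulrA.
Qed.

Lemma cross1_bal b n X Y : cross1 n (X * t b) Y = cross1 n X (t b * Y).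
Proof.
rewrite /cross1 (cop_t _ _ (dia_cross1r n X)); apply: so_ext => y1 y2.
rewrite (cop_tr _ _ (dia_cross1 _ _ _)).
by apply: so_ext => x1 x2; rewrite mulrA.
Qed.

Lemma cross1_src b n X Y :
  cross1 n X (s b * Y) = \S_(x1, x2 <- D X) cross1 (n * a x1 (i b)) x2 Y.
Proof.
rewrite /cross1 (cop_s _ _ (dia_cross1r n X)) [RHS]so_swap; apply: so_ext => y1 y2.
rewrite -(copA (f := fun x x' x'' => p (n * a x (i b) * g x' y1) (x'' * y2))).
- apply: so_ext => x1 x2; rewrite tg_src so_mulrr.
  rewrite (so_lin _ _ (p_lin.1 _)).
  by apply: so_ext => *; rewrite mulrA.
- by bal.
- by move=> *; rewrite ta_t tg_s !mulrA.
- by move=> *; rewrite tg_t mulrA p_bal mulrA.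
Qed.

Lemma cross1_X1 n X : cross1 n X 1 = p n X.
Proof.
rewrite /cross1 (cop_1 (dia_cross1r n X)) -[RHS](cop_epl S X (p_lin.2 n)).
by apply: so_ext => x1 x2; rewrite tg_X1 ta_unit p_bal mulr1.
Qed.

(** [tr_cop_mul] collapses the H-component X_+(2) X_-(2) to 1; this is why [rhot](X_+) n [rhot](X_-)
    lies in N. *)
Lemma tr_cross1 n X : \S_(x, y <- P X) cross1 n x y = p (n * om X) 1.
Proof.
under so_ext => x y do rewrite /cross1 so_swap.
rewrite (tr_cop_mul (f := fun x y z => p (n * g x y) z)).
- by rewrite /om so_mulrr (so_lin _ _ (p_lin.1 1)).
- by bal.
- by move=> *; rewrite tg_t mulrA p_bal.
- by move=> *; rewrite tg_bal.
Qed.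

Definition cross n X m Y := \S_(x1, x2 <- D X) cross1 (n * a x1 m) x2 Y.

Lemma dia_cross n m Y : dbalanced s t (fun x y => cross1 (n * a x m) y Y).
Proof. by have cl := cross1_lin; bal; rewrite ta_t mulrA cross1_s. Qed.

Lemma crossE n X m Y : cross n X m Y =
  \S_(x1, x' <- D X) \S_(x2, x3 <- D x') \S_(y1, y2 <- D Y)
    p (n * a x1 m * g x2 y1) (x3 * y2).
Proof. by apply: so_ext => x1 x'; rewrite /cross1 so_swap. Qed.

Lemma cross_linl m Y : bilin (fun n X => cross n X m Y).
Proof.
have cl := cross1_lin.
by split=> x; [rewrite /cross; bal | exact: cop_lin (dia_cross _ _ _)].
Qed.

Lemma cross_linr n X : bilin (cross n X).
Proof. by have cl := cross1_lin; split=> x; rewrite /cross; bal. Qed.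

Lemma cross_ball b n X m Y : cross (n * i b) X m Y = cross n (s b * X) m Y.
Proof.
rewrite /cross (cop_s _ _ (dia_cross n m Y)).
by apply: so_ext => x1 x2; rewrite ta_s mulrA.
Qed.

Lemma cross_balr b n X m Y : cross n X (m * i b) Y = cross n X m (s b * Y).
Proof.
have cl := cross1_lin; have [cl1 _ _] := cl; rewrite /cross.
under [RHS]so_ext => x1 x2 do rewrite cross1_src.
rewrite -(copA (f := fun x x' x'' => cross1 (n * a x m * a x' (i b)) x'' Y)).
- apply: so_ext => x1 x2; rewrite ta_mul so_mulrr (so_lin _ _ (cl1 _ _)).
  by apply: so_ext => *; rewrite mulrA.
- by bal.
- by move=> *; rewrite ta_t ta_s !mulrA.
- by move=> *; rewrite ta_t mulrA cross1_s.
Qed.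

Lemma cross_m1 n X Y : cross n X 1 Y = cross1 n X Y.
Proof.
have [_ c2 _] := cross1_lin.
rewrite /cross -[RHS](cop_epl S X (c2 n Y)).
by apply: so_ext => x1 x2; rewrite ta_unit cross1_s.
Qed.

Lemma cross_Y1 n X m : cross n X m 1 = \S_(x1, x2 <- D X) p (n * a x1 m) x2.
Proof. by apply: so_ext => x1 x2; rewrite cross1_X1. Qed.

(** The value of [rhot](X_+) n [rhot](X_-): passing n over X_+ leaves X_(1) ▷ n in front, by
    [tr_copl], and the rest contributes X_(2) ∧ 1. *)
Lemma tr_cross_act X n :
  \S_(x, y <- P X) \S_(x1, x2 <- D x) cross (a x1 n) x2 1 y = p (up X n) 1.
Proof.
have cl := cross1_lin.
under so_ext => x y do under so_ext => x1 x2 do rewrite cross_m1.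
rewrite (tr_copl (f := fun x y z => cross1 (a x n) y z)).
- under so_ext => x y do rewrite tr_cross1.
  by rewrite [RHS](so_lin _ _ (p_lin.1 1)).
- by bal.
- by move=> *; rewrite ta_t cross1_s.
- by move=> *; rewrite cross1_bal.
Qed.

Lemma cross_tr b n X m Y : cross n (X * t b) m Y = cross n X m (t b * Y).
Proof.
rewrite /cross (cop_tr _ _ (dia_cross n m Y)).
by apply: so_ext => x1 x2; rewrite cross1_bal.
Qed.

(** That [rhot](X_+) [rho](X_-) is the counit, with m in front; it rests on X_+ ∧ (X_- ∨ 1) = X ▷
    1. *)
Lemma tr_cross_nu m X :
  \S_(x, y <- P X) \S_(y1, y2 <- D y) cross m x (nu y1) y2 = p (m * a X 1) 1.
Proof.
have cl := cross1_lin.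
have c1 m' Y' := cross_linl m' Y'; have c2 n X' := cross_linr n X'.
rewrite (tr_copr (f := fun x y z => cross m x (nu y) z)).
- rewrite -(tr_up_nu T) so_mulrr (so_lin _ _ (p_lin.1 1)); apply: so_ext => x y.
  rewrite (tr_copl (f := fun x y' z => cross1 (m * a x (nu y)) y' z)).
  + under so_ext => x1 x2 do rewrite tr_cross1.
    rewrite [RHS](so_lin _ _ (lin_ap (p_lin.1 1) (lin_mulr m (@lin_id _ _)))).
    by apply: so_ext => *; rewrite mulrA.
  + by bal.
  + by move=> *; rewrite ta_t mulrA cross1_s.
  + by move=> *; rewrite cross1_bal.
- split=> x y; [exact: (c1 _ _).2 | exact: lin_ap ((c2 _ _).1 _) (nu_lin T) | exact: (c2 _ _).2].
- by move=> *; rewrite cross_tr.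
- by move=> *; rewrite nu_t cross_balr.
Qed.

(** [rho](X_+) n is (X_+(1) ∨ n) ⊗ X_+(2). Taking the coproduct out to X by [tr_copl] leaves
    [rhot](X_(2)+) [rho](X_(2)-), a counit. So the product over X_+ ⊗ X_- that defines ∨ agrees with
    the closed formula, which uses X_[+] ⊗ X_[-]. *)
Lemma tr_cross_dn X n :
  \S_(x, y <- P X) \S_(x1, x2 <- D x) \S_(y1, y2 <- D y)
    cross (dn x1 n) x2 (nu y1) y2 = p (dn X n) 1.
Proof.
have c1 m' Y' := cross_linl m' Y'; have c2 m' X' := cross_linr m' X'.
have dc m x : dbalanced s t (fun y y' => cross m x (nu y) y').
  split=> [|b y y']; last by rewrite nu_t cross_balr.
  by split=> z; [exact: lin_ap ((c2 _ _).1 _) (nu_lin T) | exact: (c2 _ _).2].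
rewrite (tr_copl (f := fun x x' y => \S_(y1, y2 <- D y) cross (dn x n) x' (nu y1) y2)).
- under so_ext => x x' do rewrite tr_cross_nu.
  rewrite -(so_lin _ _ (p_lin.1 1)); congr (p _ 1).
  rewrite -[RHS](cop_epr S X ((dn_lin T).1 n)).
  by apply: so_ext => x x'; rewrite dn_t ta_unit.
- split=> x y.
  + apply: lin_so => *; exact: lin_ap ((c1 _ _).1 _) ((dn_lin T).1 n).
  + apply: lin_so => *; exact: (c1 _ _).2.
  + exact: cop_lin (dc _ _).
- by move=> *; apply: so_ext => *; rewrite dn_t cross_ball.
- by move=> b x y z; rewrite (cop_t _ _ (dc _ _)); apply: so_ext => *; rewrite cross_tr.
Qed.

End CrossSums.

Lemma tlift_ext (k : fieldType) (M N V : lmodType k) (A : Type)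
    (r : A -> M -> M) (l : A -> N -> N) (u : tens r l) (f g : M -> N -> V) :
  (forall m n, f m n = g m n) -> tlift u f = tlift u g.
Proof. by move=> fg; apply: eq_bigr => p _; apply: fg. Qed.

Section WedgeVee.
Variables (k : fieldType) (B H N : algebra k) (h : hopf_algebroid B H).
Variables (i : B_ring B N) (c : cocycle h i) (ci : cocycle_inverse c).
Local Notation s := (src h).
Local Notation t := (tgt h).
Local Notation T := (cocycle_twist ci).
Local Notation NH := (NoH h i).
Local Notation P := (fun X => tsum (transl h X)).
Local Notation D := (fun X => tsum (Delta h X)).
Local Notation rN := (fun b (n : N) => n * i b).
Local Notation lH := (fun b (X : H) => s b * X).
Local Notation p := (fun n X => n ⊗ X : NH).
Local Notation cr := (cross T p).

Let p_lin : bilin p := (balan_pure rN lH).1.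
Let p_bal b n X : (n * i b ⊗ X : NH) = (n ⊗ s b * X : NH) := (balan_pure rN lH).2 b n X.

Lemma balan_cross n X : balan rN lH (cr n X).
Proof. by split=> [|b m Y]; [exact: cross_linr | exact: cross_balr]. Qed.

Lemma cross_mulE u v : cross_mul c u v = \sw_(n, X <- u) \sw_(m, Y <- v) cr n X m Y.
Proof. by apply: tlift_ext => n X; apply: tlift_ext => m Y; rewrite crossE. Qed.

Lemma balan_cross_mul (v : NH) : balan rN lH (fun n X => \sw_(m, Y <- v) cr n X m Y).
Proof.
split=> [|b n X]; last by apply: tlift_ext => m Y; apply: cross_ball.
by split=> x; apply: lin_tlift_fun => m Y; have [c1 c2] := cross_linl (T := T) p_lin p_bal m Y.
Qed.

Lemma cross_mul_lin v : lin (fun u => cross_mul c u v).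
Proof.
by move=> d u w; rewrite !cross_mulE; exact: (tlift_lin (balan_cross_mul v)).
Qed.

Lemma cross_mul_linr n X : lin (cross_mul c (n ⊗ X : NH)).
Proof.
move=> d u w; rewrite !cross_mulE !(tliftE _ _ (balan_cross_mul _)).
exact: (tlift_lin (balan_cross n X)).
Qed.

Lemma cross_mul_pure n X m Y : cross_mul c (n ⊗ X : NH) (m ⊗ Y : NH) = cr n X m Y.
Proof.
by rewrite cross_mulE (tliftE _ _ (balan_cross_mul _)) (tliftE _ _ (balan_cross n X)).
Qed.

Lemma pure1_inj (n n' : N) : (n ⊗ 1 : NH) = (n' ⊗ 1 : NH) -> n = n'.
Proof.
have fb : balan rN lH (fun n X => n * i (counit h X)).
  have [_ iM] := br_morph i; have [t1 _] := tgt_morph h.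
  split=> [|b m X].
    split=> x; first exact: lin_mull (@lin_id _ _).
    exact: lin_mulr (lin_ap (lin_linear i) (lin_linear _)).
  have := counit_base h b 1 X; rewrite [tgt h 1]t1 !mulr1 => ->.
  by rewrite iM mulrA.
move=> /(congr1 (fun u : NH => tlift u (fun (n : N) X => n * i (counit h X)))).
have [i1 _] := br_morph i.
by rewrite !(tliftE _ _ fb) counit1 [i 1]i1 !mulr1.
Qed.

Lemma wedgeE X n : wedge c X n = twist_wedge T X n.
Proof.
have E : \sw_(x, y <- transl h X)
      cross_mul c (cross_mul c (rhot h i x) (n ⊗ 1 : NH)) (rhot h i y)
    = (twist_wedge T X n ⊗ 1 : NH).
  rewrite -(tr_cross_act (T := T) p_lin p_bal).
  apply: (@so_ext k H _ (P X)) => x y.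
  rewrite cross_mul_pure cross_Y1 //.
  rewrite [LHS](so_lin _ _ (cross_mul_lin (rhot h i y))).
  by apply: so_ext => x1 x2; rewrite mul1r cross_mul_pure.
apply: pure1_inj; rewrite -[RHS]E /wedge.
(* By [E] the set is not empty, so [xget] returns one of its elements and not the default 0. *)
by apply: (xgetPex 0 (P := [set n' | (n' ⊗ 1 : NH) = _])); exists (twist_wedge T X n).
Qed.

Lemma rhoE X : rho ci X = \S_(x, y <- D X) (twist_vee1 T x ⊗ y : NH).
Proof. by []. Qed.

Lemma veeE X n : vee ci X n = twist_vee T X n.
Proof.
have c1 m Y := cross_linl (T := T) p_lin p_bal m Y.
have E : \sw_(x, y <- transl h X)
      cross_mul c (cross_mul c (rho ci x) (n ⊗ 1 : NH)) (rho ci y)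
    = (twist_vee T X n ⊗ 1 : NH).
  rewrite -(tr_cross_dn (T := T) p_lin p_bal).
  apply: (@so_ext k H _ (P X)) => x y.
  have -> : cross_mul c (rho ci x) (n ⊗ 1 : NH) =
      \S_(x1, x2 <- D x) (twist_vee T x1 n ⊗ x2 : NH).
    rewrite rhoE (so_lin _ _ (cross_mul_lin _)).
    under so_ext => x1 x2 do rewrite cross_mul_pure cross_Y1 //.
    rewrite -(copA (h := calc h) (f := fun x y z => (twist_vee1 T x * act c y n ⊗ z : NH))).
    - by apply: so_ext => x1 x2; rewrite -(so_lin _ _ (p_lin.1 x2)).
    - split=> z w.
      + exact: lin_ap (p_lin.1 w) (lin_mull _ (nu_lin T)).
      + exact: lin_ap (p_lin.1 w) (lin_mulr _ ((ta_lin T).1 n)).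
      + exact: p_lin.2.
    - by move=> b z w w'; rewrite (nu_t T b z) [act c (s b * w) n](ta_s T b w n) mulrA.
    - by move=> b z w w'; rewrite [act c (t b * w) n](ta_t T b w n) mulrA p_bal.
  rewrite (so_lin _ _ (cross_mul_lin _)); apply: so_ext => x1 x2.
  rewrite rhoE (so_lin _ _ (cross_mul_linr _ _)).
  by apply: so_ext => y1 y2; rewrite cross_mul_pure.
apply: pure1_inj; rewrite -[RHS]E /vee.
by apply: (xgetPex 0 (P := [set n' | (n' ⊗ 1 : NH) = _])); exists (twist_vee T X n).
Qed.

End WedgeVee.

(** * Rebracketing to the stated product formula *)

Section ProductFormula.
Variables (k : fieldType) (H N : algebra k) (B : Type) (S : hopf_calculus H B).
Variables (T : twist N S) (L : lmodType k) (F : free_bimod T L).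
Local Notation s := (hs S).
Local Notation t := (ht S).
Local Notation D := (cop S).
Local Notation a := (ta T).
Local Notation g := (tg T).
Local Notation v := (tv T).
Local Notation nl := (bml F).
Local Notation nr := (bmr F).
Local Notation th := (fm_th F).
Local Notation iL := (@inL _ _ _ F).
Local Notation gact := (gen_act F).

Lemma gactE_r X Y : gact X Y =
  \S_(y1, y' <- D Y) \S_(y2, y3 <- D y') \S_(x1, x' <- D X) \S_(x2, x3 <- D x')
    nl (g x1 y1) (nr (th (x2 * y2)) (v x3 y3)).
Proof.
have cig := cls_inN F (cls_g T); have civ := cls_inN F (cls_v T).
have cith : conv_class (sqz_bmeas T F) false false (fun X Y => iL (th (X * Y))).
  apply: (@cls_mul _ _ _ _ _ (sqz_bmeas T F) (fun X => iL (th X))).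
  split; first exact: (lin_ap (@inL_lin _ _ _ F) (fm_th_lin F)).
    by move=> b Z; rewrite fm_th_s -inN_inL.
  by move=> b Z; rewrite fm_th_t -inL_inN.
apply: (@iL_inj _ _ _ _ _ _ _ F).
rewrite [LHS](congr1 (fun f => f X Y) (gactE F)) (convA cig cith civ) inL_so.
apply: so_ext => y1 y'; rewrite inL_so.
under [RHS]so_ext => y2 y3 do rewrite inL_so.
rewrite [RHS]so_swap; apply: so_ext => x1 x'; rewrite so_mulrr.
apply: so_ext => y2 y3; rewrite so_mulrr inL_so.
by apply: so_ext => x2 x3; rewrite inL_inN inN_inL.
Qed.

Lemma free_actE_r X n Z m : mon_act F X n Z m =
  \S_(x1, x' <- D X) \S_(x2, x3 <- D x') nl (a x1 n) (nr (gact x2 Z) (a x3 m)).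
Proof.
have gl := gact_lin F.
apply: (copA (f := fun x y z => nl (a x n) (nr (gact y Z) (a z m)))).
- by bal.
- by move=> *; rewrite ta_t gact_s -nlr nlA.
- by move=> *; rewrite gact_t ta_s nrA.
Qed.

Lemma so_swap2 (V : lmodType k) (r : sumop k H) Y (f : H -> H -> H -> H -> H -> V) :
  \S_(x, x' <- r) \S_(y1, y' <- D Y) \S_(y2, y3 <- D y') f x x' y1 y2 y3 =
  \S_(y1, y' <- D Y) \S_(y2, y3 <- D y') \S_(x, x' <- r) f x x' y1 y2 y3.
Proof. by rewrite so_swap; apply: so_ext => *; apply: so_swap. Qed.

(** The free action splits the middle leg of X again when it reaches the generator, while the
    statement always splits the last leg. Only brackets and the order of the sums change. *)
Lemma fva_monE_r X n Y m : free_tact F X (nl n (nr (th Y) m)) =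
  \S_(x1, x' <- D X) \S_(x2, x'' <- D x') \S_(x3, x''' <- D x'')
  \S_(x4, x5 <- D x''') \S_(y1, y' <- D Y) \S_(y2, y3 <- D y')
    nl (a x1 n * g x2 y1) (nr (th (x3 * y2)) (v x4 y3 * a x5 m)).
Proof.
rewrite fva_mon free_actE_r; apply: so_ext => x1 x'.
under [RHS]so_ext => x2 x''.
  under so_ext => x3 x''' do rewrite so_swap2.
  rewrite so_swap2; over.
rewrite [RHS]so_swap2.
transitivity (\S_(y1, y' <- D Y) \S_(y2, y3 <- D y') \S_(r, x5 <- D x')
    \S_(x2, r' <- D r) \S_(x3, x4 <- D r')
    nl (a x1 n * g x2 y1) (nr (th (x3 * y2)) (v x4 y3 * a x5 m))).
  rewrite -so_swap2; apply: so_ext => r x5.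
  rewrite gactE_r bmr_sol bml_sor; apply: so_ext => y1 y'.
  rewrite bmr_sol bml_sor; apply: so_ext => y2 y3.
  rewrite bmr_sol bml_sor; apply: so_ext => x2 r'.
  rewrite bmr_sol bml_sor; apply: so_ext => x3 x4.
  by rewrite -nlr nlA nrA.
apply: so_ext => y1 y'; apply: so_ext => y2 y3.
pose f x2 x3 x4 x5 := nl (a x1 n * g x2 y1) (nr (th (x3 * y2)) (v x4 y3 * a x5 m)).
have f12 b x2 x3 x4 x5 : f (t b * x2) x3 x4 x5 = f x2 (s b * x3) x4 x5.
  by rewrite /f tg_t -mulrA fm_th_s -nlr nlA !mulrA.
have f23 b x2 x3 x4 x5 : f x2 (t b * x3) x4 x5 = f x2 x3 (s b * x4) x5.
  by rewrite /f tv_s -mulrA fm_th_t nrA !mulrA.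
have f34 b x2 x3 x4 x5 : f x2 x3 (t b * x4) x5 = f x2 x3 x4 (s b * x5).
  by rewrite /f tv_t ta_s mulrA.
have d34 x2 x3 : dbalanced s t (f x2 x3) by rewrite /f; bal; rewrite tv_t ta_s mulrA.
have d23 x2 x5 : dbalanced s t (fun x3 x4 => f x2 x3 x4 x5).
  by split=> [|b x3 x4]; [rewrite /f; bal | exact: f23].
rewrite -[LHS]/(\S_(r, x5 <- D x') \S_(x2, r' <- D r) \S_(x3, x4 <- D r')
    f x2 x3 x4 x5).
(* [copA] has three legs and four are present: r' stands for two of them, with their sum inside one
   trilinear map. A second use for [f x2] then splits the remaining three. *)
rewrite (copA (f := fun x2 r' x5 => \S_(x3, x4 <- D r') f x2 x3 x4 x5)).
- apply: so_ext => x2 x''.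
  by rewrite (copA (f := f x2)) //; rewrite /f; bal.
- split=> x y; first by rewrite /f; bal.
    exact: cop_lin (d23 _ _).
  by rewrite /f; bal.
- move=> b x y z; rewrite (cop_s _ _ (d23 _ _)).
  by apply: so_ext => *; apply: f12.
- move=> b x y z; rewrite (cop_t _ _ (d23 _ _)).
  by apply: so_ext => *; apply: f34.
Qed.

End ProductFormula.

(** * The stated formulas on N ⊗ H ◇ N *)

Section ConnesMoscovici.
Variables (k : fieldType) (B H N : algebra k) (h : hopf_algebroid B H).
Variables (i : B_ring B N) (c : cocycle h i) (ci : cocycle_inverse c).
Local Notation F := (NHN_free ci).
Local Notation L := (free_hopf F).
Local Notation mon := (tens3 h i).

Let bmlE n n' X m : bml F n (mon n' X m) = mon (n * n') X m.
Proof. exact: NHN_lE. Qed.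

Let bmrE n m' X m : bmr F (mon n X m) m' = mon n X (m * m').
Proof. exact: NHN_rE. Qed.

Let thE X : fm_th F X = mon 1 X 1.
Proof. by []. Qed.

Let nrthE X m : bmr F (fm_th F X) m = mon 1 X m.
Proof. by rewrite thE bmrE mul1r. Qed.

Let nlthE n X : bml F n (fm_th F X) = mon n X 1.
Proof. by rewrite thE bmlE mulr1. Qed.

Let monE n X m : bml F n (bmr F (fm_th F X) m) = mon n X m.
Proof. by rewrite nrthE bmlE mulr1. Qed.

Lemma NHN_src n : src L n = mon n 1 1.
Proof. exact: nlthE. Qed.

Lemma NHN_tgt n : tgt L n = mon 1 1 n.
Proof. exact: nrthE. Qed.

Lemma NHN_Delta n X m : Delta L (mon n X m) =
  \sw_(X1, X2 <- Delta h X) (mon n X1 1 ⊗ mon 1 X2 m : HdH L).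
Proof.
rewrite -monE; apply: etrans (fdelta_monE F n X m) _.
by apply: so_ext => x y; rewrite nlthE nrthE.
Qed.

Lemma NHN_counit n X m : counit L (mon n X m) = n * i (counit h X) * m.
Proof.
rewrite -monE -mulrA.
apply: etrans (orbit_mon F _ _ n X m) _.
by congr (_ * (_ * _)); exact: act_unit.
Qed.

Lemma NHN_mul n X m n' Y m' : amul (free_algebra_on F) (mon n X m) (mon n' Y m') =
  \sw_(X1, X' <- Delta h X) \sw_(X2, X'' <- Delta h X')
  \sw_(X3, X''' <- Delta h X'') \sw_(X4, X5 <- Delta h X''')
  \sw_(Y1, Y' <- Delta h Y) \sw_(Y2, Y3 <- Delta h Y')
    mon (n * act c X1 n' * sigma c (X2 ⊗ Y1)) (X3 * Y2)
        (sigmaV ci (X4 ⊗ Y3) * act c X5 m' * m).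
Proof.
rewrite -(monE n X m) -(monE n' Y m').
apply: etrans (fmul_mon F n X m _) _; rewrite fva_monE_r.
do 6![rewrite bmr_sol bml_sor; apply: so_ext => ? ?].
by rewrite nrthE bmlE bmrE bmlE mulr1 mulrA.
Qed.

Lemma NHN_transl n X m : transl L (mon n X m) =
  \sw_(Xp, Xm <- transl h X)
  \sw_(Xp1, Xp2 <- Delta h Xp) \sw_(Xm1, Xm2 <- Delta h Xm)
    (mon n Xp1 (wedge c Xp2 1) ⊗ mon (vee ci Xm1 m) Xm2 1 : HobH L).
Proof.
rewrite -monE; apply: etrans (transl_mon F n X m) _.
by do 3!apply: so_ext => ? ?; rewrite monE nlthE (wedgeE ci) veeE.
Qed.

Lemma NHN_translb n X m : translb L (mon n X m) =
  \sw_(Xp, Xm <- translb h X)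
  \sw_(Xp1, Xp2 <- Delta h Xp) \sw_(Xm1, Xm2 <- Delta h Xm)
    (mon (vee ci Xp1 1) Xp2 m ⊗ mon 1 Xm1 (wedge c Xm2 n) : HoH L).
Proof.
rewrite -monE; apply: etrans (translb_mon F n X m) _.
by do 3!apply: so_ext => ? ?; rewrite monE nrthE (wedgeE ci) veeE.
Qed.

End ConnesMoscovici.
Theorem mainTheorem3 (k : fieldType) (B H N : algebra k)
    (h : hopf_algebroid B H) (i : B_ring B N)
    (c : cocycle h i) (ci : cocycle_inverse c) :
  exists (a : algebra_on (NoHdN h i)) (L : hopf_algebroid N (Algebra a)),
  [/\ (forall n, src L n = tens3 h i n 1 1),
      (forall n, tgt L n = tens3 h i 1 1 n),
      (forall n X m, Delta L (tens3 h i n X m) =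
        \sw_(X1, X2 <- Delta h X) (tens3 h i n X1 1 ⊗ tens3 h i 1 X2 m : HdH L)),
      (forall n X m, counit L (tens3 h i n X m) = n * i (counit h X) * m)
    & (forall n X m n' Y m', amul a (tens3 h i n X m) (tens3 h i n' Y m') =
        \sw_(X1, X' <- Delta h X) \sw_(X2, X'' <- Delta h X')
        \sw_(X3, X''' <- Delta h X'') \sw_(X4, X5 <- Delta h X''')
        \sw_(Y1, Y' <- Delta h Y) \sw_(Y2, Y3 <- Delta h Y')
          tens3 h i (n * act c X1 n' * sigma c (X2 ⊗ Y1))
                    (X3 * Y2)
                    (sigmaV ci (X4 ⊗ Y3) * act c X5 m' * m))] /\
  [/\ (forall n X m, transl L (tens3 h i n X m) =
        \sw_(Xp, Xm <- transl h X)
        \sw_(Xp1, Xp2 <- Delta h Xp) \sw_(Xm1, Xm2 <- Delta h Xm)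
          (tens3 h i n Xp1 (wedge c Xp2 1)
             ⊗ tens3 h i (vee ci Xm1 m) Xm2 1 : HobH L))
    & (forall n X m, translb L (tens3 h i n X m) =
        \sw_(Xp, Xm <- translb h X)
        \sw_(Xp1, Xp2 <- Delta h Xp) \sw_(Xm1, Xm2 <- Delta h Xm)
          (tens3 h i (vee ci Xp1 1) Xp2 m
             ⊗ tens3 h i 1 Xm1 (wedge c Xm2 n) : HoH L))].
Proof.
exists (free_algebra_on (NHN_free ci)), (free_hopf (NHN_free ci)).
split; split.
- exact: NHN_src.
- exact: NHN_tgt.
- exact: NHN_Delta.
- exact: NHN_counit.
- exact: NHN_mul.
- exact: NHN_transl.
- exact: NHN_translb.
Qed.
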